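(* Let $Q$ be a quiver without oriented cycles. Then the set $\{\mathbf{1}_P\mid P \text{ a preprojective } Q\text{-module}\}$ (one element for each isomorphism class) is a $\mathbb{Z}$-basis of $\mathcal{C}_{\mathbb{Z}}(Q)^{prep}$ (hence a $\mathbb{C}$-basis of $\mathcal{C}(Q)^{prep}$).
   Context: All representations are finite dimensional over $\mathbb{C}$; ''module'' means representation. $Q$ is a finite connected quiver with vertex set $V$ and arrows $h:h'\to h''$. For $\alpha\in\mathbb{N}[V]$, $\mathbf{E}_\alpha=\prod_h\mathrm{Hom}(\mathbb{C}^{\alpha_{h'}},\mathbb{C}^{\alpha_{h''}})$ with the base-change action of $G_\alpha=\prod_i GL(\alpha_i,\mathbb{C})$. $\mathcal{H}_\alpha(Q)$ is the $\mathbb{C}$-space of $G_\alpha$-invariant constructible functions $\mathbf{E}_\alpha\to\mathbb{C}$ (finitely many values, constructible fibres), and $\mathcal{H}(Q)=\bigoplus_\alpha\mathcal{H}_\alpha(Q)$ with the associative product: for $f\in\mathcal{H}_\alpha(Q)$, $g\in\mathcal{H}_\beta(Q)$, $x\in\mathbf{E}_{\alpha+\beta}$, $$(fg)(x)=\sum_{a\in\mathbb{C}}a\,\chi(\{W\ x\text{-stable graded subspace},\ \underline{\dim}\,W=\beta,\ f(x_{\mathrm{quot}})g(x|_W)=a\}),$$ where $x_{\mathrm{quot}}$ is the induced representation on the quotient by $W$ and $\chi$ is Euler characteristic with compact support. $\mathbf{1}_M$ is the characteristic function of the orbit of $M$. Let $\tau$ be the Auslander–Reiten translation. An indecomposable $M$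 is preprojective if $\tau^{n}M=0$ for some $n>0$; a module is preprojective if all its indecomposable summands are (so $0$ is preprojective). $\mathcal{C}(Q)^{prep}$ (resp. $\mathcal{C}_{\mathbb{Z}}(Q)^{prep}$) is the $\mathbb{C}$-subalgebra (resp. $\mathbb{Z}$-subalgebra) of $\mathcal{H}(Q)$ generated by all $\mathbf{1}_P$ with $P$ preprojective. *)

(* Defs.v *)
(* MathComp / MathComp-Analysis; the complex numbers are R[i] for R : realType. *)
From HB Require Import structures.
From mathcomp Require Import all_boot all_order all_algebra.
From mathcomp Require Import all_classical all_reals all_analysis.
From mathcomp Require Import complex.
From mathcomp Require mpoly.

Set Implicit Arguments.
Unset Strict Implicit.
Unset Printing Implicit Defensive.

Import Order.TTheory GRing.Theory Num.Theory.
Import numFieldNormedType.Exports.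

Local Open Scope classical_set_scope.
Local Open Scope ring_scope.

(* ---------------------------------------------------------------------- *)
(* Constructible and semialgebraic sets                                   *)
(* ---------------------------------------------------------------------- *)

Inductive boolean_generated (T : Type) (G : set (set T)) : set T -> Prop :=
| BG_gen S : G S -> boolean_generated G S
| BG_setC S : boolean_generated G S -> boolean_generated G (~` S)
| BG_setI S S' : boolean_generated G S -> boolean_generated G S' ->
    boolean_generated G (S `&` S').

Definition semialgebraic (R : realType) (n : nat) : set 'rV[R]_n -> Prop :=
  boolean_generated
    [set S | exists p : mpoly.mpoly n R,
       S = [set v : 'rV[R]_n | 0 < mpoly.meval (fun i => v 0 i) p]].

(* [c] gives the coordinates of a complex affine space [T]. *)
Definition constructible (R : realType) (T : Type) (n : nat)
    (c : T -> 'I_n -> R[i]) : set T -> Prop :=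
  boolean_generated
    [set S | exists p : mpoly.mpoly n R[i],
       S = [set x | mpoly.meval (c x) p = 0]].

(* ---------------------------------------------------------------------- *)
(* Euler characteristic with compact support                              *)
(* ---------------------------------------------------------------------- *)

(* Open cell of dimension d: semialgebraically homeomorphic to R^d. *)
Definition is_cell (R : realType) (n d : nat) (S : set 'rV[R]_n) : Prop :=
  semialgebraic S /\
  exists (f : 'rV[R]_n -> 'rV[R]_d) (g : 'rV[R]_d -> 'rV[R]_n),
    [/\ semialgebraic [set w : 'rV[R]_(n + d) |
          S (lsubmx w) /\ rsubmx w = f (lsubmx w)],
        (forall v, S v -> g (f v) = v),
        (forall y, S (g y) /\ f (g y) = y),
        {within S, continuous f}
      & continuous g].

(* H_c^*(R^d) is one-dimensional in degree d, and chi is additive over finite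
   partitions into semialgebraic pieces, whence the sum of (-1)^d. *)
Definition has_euler_char (R : realType) (n : nat) (S : set 'rV[R]_n)
    (e : int) : Prop :=
  exists (m : nat) (d : 'I_m -> nat) (C : 'I_m -> set 'rV[R]_n),
    [/\ forall k, is_cell (d k) (C k),
        forall k l v, C k v -> C l v -> k = l,
        S = [set v | exists k, C k v]
      & e = \sum_(k < m) (-1) ^+ d k].

(* Every semialgebraic set (in particular, every constructible set) has a
   cell partition, and the sum does not depend on it; on other sets the value
   0 carries no meaning. *)
Definition euler_char (R : realType) (n : nat) (S : set 'rV[R]_n) : int :=
  xget 0 [set e | has_euler_char S e].

(* ---------------------------------------------------------------------- *)
(* Quivers                                                                *)
(* ---------------------------------------------------------------------- *)

Record quiver := Quiver {
  vertex : finType;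
  arrow : finType;
  src : arrow -> vertex;
  tgt : arrow -> vertex }.

Definition quiver_adj (Q : quiver) : rel (vertex Q) := fun u v =>
  [exists h : arrow Q, ((src h == u) && (tgt h == v))
                    || ((src h == v) && (tgt h == u))].

Definition connected_quiver (Q : quiver) : Prop :=
  (0 < #|vertex Q|)%N /\ forall u v : vertex Q, connect (@quiver_adj Q) u v.

(* Arrows are listed in the order in which they are traversed. *)
Fixpoint qpath (Q : quiver) (u : vertex Q) (p : seq (arrow Q)) (v : vertex Q)
    : bool :=
  if p is h :: p' then (src h == u) && qpath (tgt h) p' v else u == v.

Definition no_oriented_cycle (Q : quiver) : Prop :=
  forall (v : vertex Q) (p : seq (arrow Q)), qpath v p v -> p = [::].

(* ---------------------------------------------------------------------- *)
(* Representations                                                        *)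
(* ---------------------------------------------------------------------- *)

(* Matrices act on row vectors from the right, so that x h below is a linear
   map C^(a (src h)) -> C^(a (tgt h)). *)
Definition rep_space (R : realType) (Q : quiver) (a : vertex Q -> nat) : Type :=
  forall h : arrow Q, 'M[R[i]]_(a (src h), a (tgt h)).

Record rep (R : realType) (Q : quiver) := Rep {
  dimv : vertex Q -> nat;
  rmap : rep_space R dimv }.

Section Representations.
Variables (R : realType) (Q : quiver).
Local Notation C := R[i].
Implicit Types M N : rep R Q.

(* For representations of the same dimension vector a, this is the relation
   of being in the same G_a-orbit. *)
Definition rep_iso M N : Prop :=
  exists (g : forall i, 'M[C]_(dimv M i, dimv N i))
         (g' : forall i, 'M[C]_(dimv N i, dimv M i)),
    [/\ forall i, g i *m g' i = 1%:M,
        forall i, g' i *m g i = 1%:M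
      & forall h, rmap M h *m g (tgt h) = g (src h) *m rmap N h].

Definition rep_sum M N : rep R Q :=
  Rep (dimv := fun i => (dimv M i + dimv N i)%N)
      (fun h => block_mx (rmap M h) 0 0 (rmap N h)).

Definition is_zero_rep M : Prop := forall i, dimv M i = 0%N.

Definition indecomposable M : Prop :=
  ~ is_zero_rep M /\
  forall N N', rep_iso M (rep_sum N N') -> is_zero_rep N \/ is_zero_rep N'.

(* ---------------------------------------------------------------------- *)
(* The Auslander-Reiten translation                                       *)
(* ---------------------------------------------------------------------- *)

(* The path algebra A = CQ of an acyclic quiver is hereditary, so for the
   indecomposable projectives P_v (with (P_v)_i the span of the paths from v
   to i)
       (tau M)_v = (D Tr M)_v = D Ext^1(M, P_v),
   and the standard projective resolution of M computes Ext^1(M, P_v) as the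
   cokernel of
       (+)_i Hom(M_i, (P_v)_i) -> (+)_h Hom(M_(src h), (P_v)_(tgt h)),
       f |-> (P_v h \o f_(src h) - f_(tgt h) \o M_h)_h.
   A linear form on the target is a family u of vectors u h p in M_(src h),
   one for each arrow h and path p from v to tgt h: its value on g is the sum
   of g_(h,p) (u h p), where g_h = sum_p g_(h,p) p. It kills the image iff it
   kills the image of f (-) q for every path q : v -> i and form f on M_i,
   which is the second condition below. (Equivalently, [ar_space M v] is the
   kernel of nu P^1 -> nu P^0 at v, with nu the Nakayama functor.) *)
Definition ar_space M (v : vertex Q)
    (u : forall h : arrow Q, seq (arrow Q) -> 'rV[C]_(dimv M (src h))) : Prop :=
  (forall h p, ~~ qpath v p (tgt h) -> u h p = 0) /\
  (forall (i : vertex Q) (q : seq (arrow Q)), qpath v q i ->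
   forall f : forall j, 'cV[C]_(dimv M j),
     \sum_(h | src h == i) u h (rcons q h) *m f (src h)
     = \sum_(h | tgt h == i) u h q *m rmap M h *m f (tgt h)).

(* N is isomorphic to tau M. An arrow a : v -> w acts on tau M by the dual of
   P_w -> P_v, p |-> a :: p. *)
Definition ar_translate M N : Prop :=
  exists phi : forall v : vertex Q, 'rV[C]_(dimv N v) ->
                 forall h : arrow Q, seq (arrow Q) -> 'rV[C]_(dimv M (src h)),
    [/\ forall v (c : C) x y h p,
          phi v (c *: x + y) h p = c *: phi v x h p + phi v y h p,
        forall v x, (forall h p, phi v x h p = 0) -> x = 0,
        forall v u, ar_space v u <->
          exists x, forall h p, phi v x h p = u h p
      & forall (a : arrow Q) (x : 'rV[C]_(dimv N (src a))) h p,
          phi (tgt a) (x *m rmap N a) h p = phi (src a) x h (a :: p)].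

(* N is isomorphic to tau^n M. *)
Fixpoint ar_translate_iter (n : nat) M N : Prop :=
  if n is m.+1 then exists2 L, ar_translate_iter m M L & ar_translate L N
  else rep_iso M N.

Definition preprojective_indec M : Prop :=
  indecomposable M /\
  exists n N, [/\ (0 < n)%N, ar_translate_iter n M N & is_zero_rep N].

Definition preprojective M : Prop :=
  forall N N', rep_iso M (rep_sum N N') -> indecomposable N ->
    preprojective_indec N.

(* ---------------------------------------------------------------------- *)
(* The algebra H(Q)                                                       *)
(* ---------------------------------------------------------------------- *)

Definition rep_coord (a : vertex Q -> nat) (x : rep_space R a)
    (k : 'I_#|{: {h : arrow Q & ('I_(a (src h)) * 'I_(a (tgt h)))%type}}|) : C :=
  let t := enum_val k in x (tag t) (tagged t).1 (tagged t).2.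

(* An element of (+)_a H_a(Q) is encoded as a single function on all
   representations, its component in H_a(Q) being the restriction to those of
   dimension vector a. *)
Definition Hall (f : rep R Q -> C) : Prop :=
  [/\ finite_set [set a | exists x : rep_space R a, f (Rep x) <> 0],
      forall M N, rep_iso M N -> f M = f N,
      forall a, finite_set (range (fun x : rep_space R a => f (Rep x)))
    & forall (a : vertex Q -> nat) (z : C),
        constructible (@rep_coord a) [set x | f (Rep x) = z]].

(* 1_M, the characteristic function of the orbit of M. *)
Definition char_orbit M : rep R Q -> C := fun N => (`[< rep_iso M N >])%:R.

(* A graded subspace W of C^a is given by the orthogonal projectors W i onto
   its components: the component at i is the row space of W i. This embeds the
   Grassmannians homeomorphically in real affine spaces. *)
Definition is_graded_subspace (a : vertex Q -> nat)
    (W : forall i, 'M[C]_(a i)) : Prop :=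
  forall i, W i *m W i = W i /\ (map_mx Num.conj (W i))^T = W i.

Definition stable M (W : forall i, 'M[C]_(dimv M i)) : Prop :=
  forall h, (W (src h) *m rmap M h <= W (tgt h))%MS.

(* For stable W, the restriction M|_W in the bases [row_base (W i)]. *)
Definition sub_rep M (W : forall i, 'M[C]_(dimv M i)) : rep R Q :=
  Rep (dimv := fun i => \rank (W i))
      (fun h => row_base (W (src h)) *m rmap M h
                *m pinvmx (row_base (W (tgt h)))).

(* The projection C^(dimv M i) -> C^(dimv M i) / W i is realised as right
   multiplication by [cokermx (W i)], whose kernel is W i; the quotient is its
   image, with basis [row_base (cokermx (W i))]. *)
Definition quot_rep M (W : forall i, 'M[C]_(dimv M i)) : rep R Q :=
  Rep (dimv := fun i => \rank (cokermx (W i)))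
      (fun h => row_base (cokermx (W (src h))) *m pinvmx (cokermx (W (src h)))
                *m rmap M h *m cokermx (W (tgt h))
                *m pinvmx (row_base (cokermx (W (tgt h))))).

Definition real_coord (a : vertex Q -> nat) (W : forall i, 'M[C]_(a i)) :
    'rV[R]_#|{: {i : vertex Q & ('I_(a i) * 'I_(a i) * bool)%type}}| :=
  \row_k let t := enum_val k in
         let z := W (tag t) (tagged t).1.1 (tagged t).1.2 in
         if (tagged t).2 then complex.Re z else complex.Im z.

Definition mul_fibre (f g : rep R Q -> C) M (b : vertex Q -> nat) (z : C) :
    set (forall i, 'M[C]_(dimv M i)) :=
  [set W | [/\ is_graded_subspace W, stable W,
               forall i, \rank (W i) = b i
             & f (quot_rep W) * g (sub_rep W) = z]].

(* The bilinear extension of the product to the direct sum: at M, sum over the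
   dimension vectors b of subspaces, 0 <= b i <= dimv M i. *)
Definition Hall_mul (f g : rep R Q -> C) : rep R Q -> C := fun M =>
  \sum_(b : {dffun forall i : vertex Q, 'I_(dimv M i).+1})
    \sum_(z \in [set: C])
      z * (euler_char [set real_coord W | W in
             @mul_fibre f g M (fun i => b i : nat) z])%:~R.

(* ---------------------------------------------------------------------- *)
(* Subalgebras and bases, with scalars in a subring K of C                *)
(* ---------------------------------------------------------------------- *)

(* No closure under the unit is required: the unit of H(Q) is 1_0, and 0 is
   preprojective. *)
Definition is_subalgebra (K : set C) (A : set (rep R Q -> C)) : Prop :=
  [/\ A `<=` Hall,
      A (fun=> 0),
      forall f g, A f -> A g -> A (fun M => f M + g M),
      forall c f, K c -> A f -> A (fun M => c * f M)
    & forall f g, A f -> A g -> A (Hall_mul f g)].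

Definition generated_subalgebra (K : set C) (B : set (rep R Q -> C)) :
    set (rep R Q -> C) :=
  [set f | forall A, is_subalgebra K A -> B `<=` A -> A f].

Definition is_basis (K : set C) (A B : set (rep R Q -> C)) : Prop :=
  [/\ B `<=` A,
      forall f, A f -> exists (n : nat) (b : 'I_n -> rep R Q -> C) (c : 'I_n -> C),
        [/\ forall k, B (b k), forall k, K (c k)
          & f = fun M => \sum_(k < n) c k * b k M]
    & forall (n : nat) (b : 'I_n -> rep R Q -> C) (c : 'I_n -> C),
        injective b -> (forall k, B (b k)) -> (forall k, K (c k)) ->
        (forall M, \sum_(k < n) c k * b k M = 0) -> forall k, c k = 0].

Definition prep_functions : set (rep R Q -> C) :=
  [set char_orbit P | P in preprojective].

Definition int_scalars : set C := range (fun m : int => m%:~R).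

Definition C_prep_Z : set (rep R Q -> C) :=
  generated_subalgebra int_scalars prep_functions.

Definition C_prep : set (rep R Q -> C) :=
  generated_subalgebra setT prep_functions.

End Representations.

(* Main.v *)
(* tau = D Ext^1(-, CQ) is left exact, so tau^n M = 0 holds for an extension M
   as soon as it holds for both ends, and passes to subrepresentations. Hence M
   is preprojective iff tau^n M = 0 for some n, and preprojectives are closed
   under extensions.

   Locally at a vertex, tau is Bernstein-Gelfand-Ponomarev's composite of
   reflections. On an indecomposable M with tau M <> 0 every reflection acts
   reversibly: tau M is again indecomposable, its dimension vector is determined
   by that of M, and M can be recovered from tau M. So a preprojective
   indecomposable is determined by its dimension vector, and there are finitely
   many preprojectives of bounded dimension up to isomorphism.

   If f and g are combinations of functions 1_P, then (fg)(M) <> 0 forces M to be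
   an extension of preprojectives of bounded dimension; as fg is constant on
   isomorphism classes and its values are sums of products of the scalars and of
   integers chi, it is again a combination of finitely many 1_P. This needs no
   additivity of chi, only its invariance under an isomorphism M -> M', which
   acts on orthogonal projectors by a rational map. Orbits are constructible by
   quantifier elimination over algebraically closed fields. *)
Require Import Defs.
From HB Require Import structures.
From mathcomp Require Import all_boot all_order all_algebra.
From mathcomp Require Import all_classical all_reals all_analysis.
From mathcomp Require Import complex.
From mathcomp Require mpoly closed_field.
From Stdlib Require List.
(* Imported again so that [dimv] denotes the dimension vector of a representation
   and not that of a [{vspace _}]. *)
Require Import Defs.

Set Implicit Arguments.
Unset Strict Implicit.
Unset Printing Implicit Defensive.

Import Order.TTheory GRing.Theory Num.Theory.
Import numFieldNormedType.Exports.
Local Open Scope classical_set_scope.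
Local Open Scope ring_scope.

(** * Linear algebra over finite direct sums *)

(** Reflecting one vertex at a time would change the quiver at every step. Only the two ends [M] and
    [N] = tau [M] are kept instead, joined by maps N_(tgt h) -> M_(src h). For a set [S] of vertices
    closed under successors, the partially reflected representation has the spaces of [N] in [S] and
    those of [M] outside. A morphism of such mixed data lifts to [M], uniquely if all reflections in
    [S] are onto, so that an indecomposable [M] leaves 0 and 1 as the only idempotents there. The
    lowest vertex at which a reflection is not onto therefore leaves a one-dimensional simple piece
    and forces tau [M] = 0. For two indecomposables with equal dimension vectors, either such a
    vertex exists for one of them, and the other is compared with it there, or both may be replaced
    by their translates.

    The basis statement is proved once, for a set [K] of scalars containing the integers and closed
    under sums and products. Coefficients are read off as values of the function, so integral
    coefficients reduce to integral values. *)

Section FiniteDirectSums.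
Variables (F : fieldType) (I : finType) (d : I -> nat).

(** The summands have varying dimensions, so the basis is indexed by dependent pairs. [rowsum] and
    [colsum] assemble maps into and out of the direct sum. *)
Definition dsum : nat := #|{: {i : I & 'I_(d i)}}|.

Definition rowsum m (B : forall i, 'M[F]_(m, d i)) : 'M[F]_(m, dsum) :=
  \matrix_(r, k) B (tag (enum_val k)) r (tagged (enum_val k)).

Definition colsum n (A : forall i, 'M[F]_(d i, n)) : 'M[F]_(dsum, n) :=
  \matrix_(k, c) A (tag (enum_val k)) (tagged (enum_val k)) c.

Definition dproj i : 'M[F]_(dsum, d i) :=
  \matrix_(k, j) (enum_val k == Tagged (fun i => 'I_(d i)) j)%:R.

Lemma mul_rowsum_colsum m n (B : forall i, 'M[F]_(m, d i))
    (A : forall i, 'M[F]_(d i, n)) :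
  rowsum B *m colsum A = \sum_i B i *m A i.
Proof.
apply/matrixP => r c; rewrite !mxE summxE.
under [RHS]eq_bigr => i _ do rewrite mxE.
rewrite (sig_big_dep _ _ (fun i j => B i r j * A i j c)) /=.
rewrite (reindex (@enum_val _ {: {i : I & 'I_(d i)}})) /=; last first.
  exact/onW_bij/enum_val_bij.
by apply: eq_bigr => k _; rewrite !mxE.
Qed.

Lemma mul_rowsum_dproj m (B : forall i, 'M[F]_(m, d i)) i :
  rowsum B *m dproj i = B i.
Proof.
apply/matrixP => r j; rewrite mxE.
pose k := enum_rank (Tagged (fun i => 'I_(d i)) j).
rewrite (bigD1 k) //= big1 ?addr0 => [|l lk].
  by rewrite !mxE enum_rankK eqxx mulr1.
rewrite !mxE; case: eqP => [e|]; last by rewrite mulr0.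
by case/eqP: lk; apply: enum_val_inj; rewrite e enum_rankK.
Qed.

Lemma rowsum_dproj m (x : 'M[F]_(m, dsum)) :
  rowsum (fun i => x *m dproj i) = x.
Proof.
apply/matrixP => r k; rewrite !mxE (bigD1 k) //= big1 ?addr0 => [|l lk].
  by rewrite !mxE; case: (enum_val k) => i j; rewrite eqxx mulr1.
rewrite !mxE; case: eqP => [e|]; last by rewrite mulr0.
case/eqP: lk; apply: enum_val_inj; rewrite e.
by case: (enum_val k).
Qed.

Lemma mul_rowsum m p (x : 'M[F]_(p, m)) (B : forall i, 'M[F]_(m, d i)) :
  x *m rowsum B = rowsum (fun i => x *m B i).
Proof.
by apply/matrixP => r k; rewrite !mxE; apply: eq_bigr => j _; rewrite !mxE.
Qed.

Lemma mul_colsum n p (A : forall i, 'M[F]_(d i, n)) (x : 'M[F]_(n, p)) :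
  colsum A *m x = colsum (fun i => A i *m x).
Proof.
by apply/matrixP => r k; rewrite !mxE; apply: eq_bigr => j _; rewrite !mxE.
Qed.

Lemma eq_rowsum m (B B' : forall i, 'M[F]_(m, d i)) :
  (forall i, B i = B' i) -> rowsum B = rowsum B'.
Proof. by move=> e; apply/matrixP => r k; rewrite !mxE e. Qed.

Lemma eq_colsum n (A A' : forall i, 'M[F]_(d i, n)) :
  (forall i, A i = A' i) <-> colsum A = colsum A'.
Proof.
split=> [e|e i]; first by apply/matrixP => r k; rewrite !mxE e.
apply/matrixP => j c.
have /matrixP/(_ (enum_rank (Tagged (fun i => 'I_(d i)) j)) c) := e.
by rewrite !mxE enum_rankK.
Qed.

End FiniteDirectSums.

(** A matrix of maximal rank among those with rows in [S] already spans [S]: adjoining another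
    vector of [S] cannot raise the rank. *)
Lemma subspace_mx (F : fieldType) (n : nat) (S : 'rV[F]_n -> Prop) :
  S 0 -> (forall c x y, S x -> S y -> S (c *: x + y)) ->
  exists r (B : 'M[F]_(r, n)), row_free B /\ forall x, S x <-> (x <= B)%MS.
Proof.
move=> S0 SL.
have Smul m (x : 'rV[F]_m) (B : 'M[F]_(m, n)) : (forall i, S (row i B)) -> S (x *m B).
  move=> SB; rewrite mulmx_sum_row; elim/big_ind: _ => //.
    by move=> y z Sy Sz; rewrite -[y]scale1r; apply: SL.
  by move=> i _; rewrite -[_ *: _]addr0; apply: SL.
pose T k := `[< exists B : 'M[F]_n, (forall i, S (row i B)) /\ \rank B = k >].
have T0 : exists k, T k.
  by exists 0; apply/asboolP; exists 0; split=> [i|]; rewrite ?row0 ?mxrank0.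
have Tle k : T k -> (k <= n)%N.
  by move/asboolP=> [B [_ <-]]; apply: rank_leq_row.
case: (ex_maxnP T0 Tle) => k /asboolP[B [SB rB]] kmax.
exists _, (row_base B); split=> [|x]; first exact: row_base_free.
rewrite eq_row_base; split=> [Sx|/submxP[y ->]]; last exact: Smul.
have /kmax : T (\rank (B + x)%MS).
  apply/asboolP; exists (B + x)%MS; split=> // i.
  have /sub_addsmxP[u ->] : (row i (B + x)%MS <= B + x)%MS by apply: row_sub.
  rewrite -[_ *m B]scale1r; apply: SL; first exact: Smul.
  apply: Smul => j; have -> : row j x = x by rewrite (ord1 j); apply/rowP=> l; rewrite mxE.
  by [].
rewrite -rB => le; have /mxrank_leqif_sup[_ ] := addsmxSl B x.
have -> : \rank B == \rank (B + x)%MS.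
  by rewrite eqn_leq le andbT mxrankS // addsmxSl.
by move/esym => h; apply: submx_trans h; apply: addsmxSr.
Qed.

Section Delta.
Variables (F : fieldType) (V : finType).
Implicit Types d : V -> nat.

(* The identity of F^(d i) if i = j, and 0 otherwise: identifies homogeneous
   components whose indices are only propositionally equal. *)
Definition dlt d i j : 'M[F]_(d i, d j) :=
  \matrix_(k, l) ((i == j) && (k == l :> nat))%:R.

Lemma dltii d i : dlt d i i = 1%:M.
Proof. by apply/matrixP => k l; rewrite !mxE eqxx. Qed.

Lemma dlt0 d i j : i != j -> dlt d i j = 0.
Proof. by move=> /negPf ij; apply/matrixP => k l; rewrite !mxE ij. Qed.

Lemma dlt_nat d d' i j (g : forall i, 'M[F]_(d i, d' i)) :
  dlt d i j *m g j = g i *m dlt d' i j.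
Proof.
case: (eqVneq i j) => [<-|ij]; first by rewrite !dltii mul1mx mulmx1.
by rewrite !dlt0 // mul0mx mulmx0.
Qed.

End Delta.

(** * Representations, direct sums and idempotents *)

Section RepresentationBasics.
Variables (R : realType) (Q : quiver).
Local Notation C := R[i].
Local Notation rep := (rep R Q).
Implicit Types L M N : rep.

Definition gmx M N := forall v : vertex Q, 'M[C]_(dimv M v, dimv N v).

Definition is_hom M N (g : gmx M N) : Prop :=
  forall h, rmap M h *m g (tgt h) = g (src h) *m rmap N h.

Lemma rep_iso_refl M : rep_iso M M.
Proof.
by exists (fun=> 1%:M), (fun=> 1%:M); split=> *; rewrite ?mulmx1 // mul1mx.
Qed.

Lemma rep_iso_homs M N : rep_iso M N -> exists (g : gmx M N) (g' : gmx N M),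
  [/\ is_hom g, is_hom g', forall v, g v *m g' v = 1%:M
    & forall v, g' v *m g v = 1%:M].
Proof.
move=> [g [g' [gg' g'g gh]]]; exists g, g'; split=> // h.
rewrite -[LHS]mul1mx -g'g -mulmxA (mulmxA _ _ (g' _)) -gh.
by rewrite -mulmxA gg' mulmx1.
Qed.

Lemma rep_iso_sym M N : rep_iso M N -> rep_iso N M.
Proof. by move=> /rep_iso_homs[g [g' []]]; exists g', g. Qed.

Lemma rep_iso_trans N M L : rep_iso M N -> rep_iso N L -> rep_iso M L.
Proof.
move=> [g [g' [gg' g'g gh]]] [f [f' [ff' f'f fh]]].
exists (fun v => g v *m f v), (fun v => f' v *m g' v); split=> [v|v|h].
- by rewrite mulmxA -(mulmxA _ _ (f' v)) ff' mulmx1.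
- by rewrite mulmxA -(mulmxA _ _ (g v)) g'g mulmx1.
- by rewrite mulmxA gh -mulmxA fh mulmxA.
Qed.

Lemma invertible_dim (m n : nat) (g : 'M[C]_(m, n)) (g' : 'M[C]_(n, m)) :
  g *m g' = 1%:M -> g' *m g = 1%:M -> m = n.
Proof.
move=> e e'; apply/eqP; rewrite eqn_leq; apply/andP; split.
  by rewrite -(mxrank1 C m) -e (leq_trans (mxrankM_maxl _ _)) ?rank_leq_col.
by rewrite -(mxrank1 C n) -e' (leq_trans (mxrankM_maxl _ _)) ?rank_leq_col.
Qed.

Lemma rep_iso_dimv M N : rep_iso M N -> dimv M = dimv N.
Proof.
move=> [g [g' [gg' g'g _]]]; apply/funext => v.
exact: invertible_dim (gg' v) (g'g v).
Qed.

Lemma is_zero_rep_iso M N : is_zero_rep M -> is_zero_rep N -> rep_iso M N.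
Proof.
move=> M0 N0; exists (fun=> 0), (fun=> 0); split=> v.
- by apply/matrixP => i; have := ltn_ord i; rewrite [X in (_ < X)%N]M0.
- by apply/matrixP => i; have := ltn_ord i; rewrite [X in (_ < X)%N]N0.
- by rewrite mulmx0 mul0mx.
Qed.

(** In the form of biproduct equations, summands can be regrouped and refined by composing maps,
    without reindexing block matrices. *)
Lemma rep_iso_sumP M N N' :
  rep_iso M (rep_sum N N') <->
  exists (p : gmx M N) (p' : gmx M N') (i : gmx N M) (i' : gmx N' M),
    [/\ [/\ is_hom p, is_hom p', is_hom i & is_hom i'],
        forall v, p v *m i v + p' v *m i' v = 1%:M,
        forall v, i v *m p v = 1%:M /\ i' v *m p' v = 1%:M
      & forall v, i v *m p' v = 0 /\ i' v *m p v = 0].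
Proof.
split=> [iso | [p [p' [i [i' [[hp hp' hi hi'] s1 s2 s3]]]]]].
  have [g [g' [gh g'h gg' g'g]]] := rep_iso_homs iso.
  exists (fun v => lsubmx (g v)), (fun v => rsubmx (g v)).
  exists (fun v => usubmx (g' v)), (fun v => dsubmx (g' v)).
  have gE v : g v = row_mx (lsubmx (g v)) (rsubmx (g v)) by rewrite hsubmxK.
  have g'E v : g' v = col_mx (usubmx (g' v)) (dsubmx (g' v)) by rewrite vsubmxK.
  split=> [|v|v|v]; first split=> h.
  - have := gh h; rewrite [in X in X -> _](gE (tgt h)) [in X in X -> _](gE (src h)).
    by rewrite /= mul_mx_row mul_row_block !mulmx0 addr0 add0r => /eq_row_mx[].
  - have := gh h; rewrite [in X in X -> _](gE (tgt h)) [in X in X -> _](gE (src h)).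
    by rewrite /= mul_mx_row mul_row_block !mulmx0 addr0 add0r => /eq_row_mx[].
  - have := g'h h.
    rewrite [in X in X -> _](g'E (tgt h)) [in X in X -> _](g'E (src h)).
    by rewrite /= mul_block_col mul_col_mx !mul0mx addr0 add0r => /eq_col_mx[].
  - have := g'h h.
    rewrite [in X in X -> _](g'E (tgt h)) [in X in X -> _](g'E (src h)).
    by rewrite /= mul_block_col mul_col_mx !mul0mx addr0 add0r => /eq_col_mx[].
  - by rewrite -mul_row_col -gE -g'E gg'.
  - have := g'g v; rewrite [in X in X -> _]gE [in X in X -> _]g'E mul_col_row.
    rewrite scalar_mx_block => H; have [e1 e2 e3 e4] := eq_block_mx H. by split.
  - have := g'g v; rewrite [in X in X -> _]gE [in X in X -> _]g'E mul_col_row.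
    rewrite scalar_mx_block => H; have [e1 e2 e3 e4] := eq_block_mx H. by split.
exists (fun v => row_mx (p v) (p' v)), (fun v => col_mx (i v) (i' v)).
split=> [v|v|h] /=; first by rewrite mul_row_col s1.
  rewrite mul_col_row.
  by have [-> ->] := s2 v; have [-> ->] := s3 v; rewrite -scalar_mx_block.
by rewrite mul_mx_row mul_row_block !mulmx0 addr0 add0r hp hp'.
Qed.

Lemma rep_sum_swap M N N' : rep_iso M (rep_sum N N') -> rep_iso M (rep_sum N' N).
Proof.
move=> /rep_iso_sumP[p [p' [i [i' [[hp hp' hi hi'] s1 s2 s3]]]]].
apply/rep_iso_sumP; exists p', p, i', i; split=> // v.
- by rewrite addrC.
- by have [] := s2 v.
- by have [] := s3 v.
Qed.

Lemma is_hom_comp M N L (f : gmx M N) (g : gmx N L) :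
  is_hom f -> is_hom g -> is_hom (fun v => f v *m g v).
Proof. by move=> hf hg h; rewrite mulmxA hf -mulmxA hg mulmxA. Qed.

Lemma rep_sum_assoc M N N' L L' : rep_iso M (rep_sum N N') ->
  rep_iso N (rep_sum L L') -> rep_iso M (rep_sum L (rep_sum L' N')).
Proof.
move=> /rep_iso_sumP[p [p' [i [i' [[hp hp' hi hi'] s1 s2 s3]]]]].
move=> /rep_iso_sumP[q [q' [j [j' [[hq hq' hj hj'] t1 t2 t3]]]]].
apply/rep_iso_sumP; exists (fun v => p v *m q v).
exists (fun v => row_mx (p v *m q' v) (p' v)), (fun v => j v *m i v).
exists (fun v => col_mx (j' v *m i v) (i' v)).
split=> [|v|v|v]; first split=> /=.
- exact: is_hom_comp.
- move=> h; rewrite mul_mx_row mul_row_block !mulmx0 addr0 add0r hp'.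
  by rewrite mulmxA hp -!mulmxA hq'.
- exact: is_hom_comp.
- move=> h; rewrite mul_block_col mul_col_mx !mul0mx addr0 add0r hi'.
  by rewrite mulmxA hj' -!mulmxA hi.
- rewrite mul_row_col addrA -(s1 v) !mulmxA -!(mulmxA (p v)) -mulmxDr -mulmxDl.
  by rewrite t1 mul1mx.
- have [e1 e2] := s2 v; have [e3 e4] := t2 v; have [e5 e6] := s3 v.
  rewrite mul_col_row !mulmxA -!(mulmxA _ (i v)) e1 !mulmx1 e3 e4; split=> //.
  rewrite e2 e5 mulmx0 e6 mul0mx.
  by rewrite -scalar_mx_block.
- have [e1 e2] := s2 v; have [e3 e4] := t3 v; have [e5 e6] := s3 v.
  rewrite mul_mx_row mul_col_mx !mulmxA -!(mulmxA _ (i v)) e1 !mulmx1 e3 e4.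
  by rewrite e5 e6 mulmx0 mul0mx row_mx0 col_mx0.
Qed.

(** The rank factorisation [e = col_base e *m row_base e] provides the projection onto the image and
    its inclusion; [1 - e] provides the complement. *)
Lemma idempotent_split M (e : gmx M M) : is_hom e ->
  (forall v, e v *m e v = e v) ->
  exists N N' : rep, [/\ rep_iso M (rep_sum N N'),
    forall v, dimv N v = \rank (e v) & forall v, dimv N' v = \rank (1%:M - e v)].
Proof.
move=> he ee; pose f v := 1%:M - e v.
have ff v : f v *m f v = f v.
  by rewrite /f mulmxBl mul1mx mulmxBr mulmx1 ee subrr subr0.
have hf : is_hom f by move=> h; rewrite mulmxBl mulmxBr mul1mx mulmx1 he.
have ef v : e v *m f v = 0 by rewrite mulmxBr mulmx1 ee subrr.
have fe v : f v *m e v = 0 by rewrite mulmxBl mul1mx ee subrr.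
have rc n (a : 'M[C]_n) : a *m a = a -> row_base a *m col_base a = 1%:M.
  move=> aa; apply: (row_full_inj (col_base_full a)).
  apply: (row_free_inj (row_base_free a)) => /=.
  by rewrite mulmx1 (mulmxA (col_base a)) mulmx_base -(mulmxA a) mulmx_base.
have z n (a b : 'M[C]_n) : a *m b = 0 -> row_base a *m col_base b = 0.
  move=> ab; apply: (row_full_inj (col_base_full a)).
  apply: (row_free_inj (row_base_free b)) => /=.
  by rewrite mulmx0 mul0mx (mulmxA (col_base a)) mulmx_base -(mulmxA a) mulmx_base.
have ac n (a : 'M[C]_n) : a *m a = a -> a *m col_base a = col_base a.
  move=> aa; have := congr1 (mulmx (col_base a)) (rc _ a aa).
  by rewrite mulmxA mulmx_base mulmx1.
have ra n (a : 'M[C]_n) : a *m a = a -> row_base a *m a = row_base a.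
  move=> aa; have := congr1 (mulmx^~ (row_base a)) (rc _ a aa).
  by rewrite -mulmxA mulmx_base mul1mx.
pose im (a : gmx M M) := @Rep R Q (fun v => \rank (a v))
  (fun h => row_base (a (src h)) *m rmap M h *m col_base (a (tgt h))).
have hc a : is_hom a -> (forall v, a v *m a v = a v) ->
    @is_hom M (im a) (fun v => col_base (a v)).
  move=> ha aa h /=; set c := col_base (a (tgt h)).
  rewrite -(mulmxA _ (rmap M h) c) (mulmxA (col_base _)) mulmx_base.
  rewrite (mulmxA (a _)) -ha -mulmxA.
  by rewrite /c ac.
have hr a : is_hom a -> (forall v, a v *m a v = a v) ->
    @is_hom (im a) M (fun v => row_base (a v)).
  move=> ha aa h /=; set r := row_base (a (src h)).
  rewrite -(mulmxA _ (col_base _)) mulmx_base -(mulmxA r) ha (mulmxA r).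
  by rewrite /r ra.
exists (im e), (im f); split=> //; apply/rep_iso_sumP.
exists (fun v => col_base (e v)), (fun v => col_base (f v)).
exists (fun v => row_base (e v)), (fun v => row_base (f v)).
split=> [|v|v|v]; first by split; [exact: hc|exact: hc|exact: hr|exact: hr].
- by rewrite !mulmx_base addrC subrK.
- by split; apply: rc.
- by split; apply: z.
Qed.

Lemma indecomposable_idempotent M (e : gmx M M) : indecomposable M ->
  is_hom e -> (forall v, e v *m e v = e v) ->
  (forall v, e v = 0) \/ (forall v, e v = 1%:M).
Proof.
move=> [_ indM] he ee; have [N [N' [iso dN dN']]] := idempotent_split he ee.
case: (indM _ _ iso) => z; [left=> v|right=> v].
  by apply/eqP; rewrite -mxrank_eq0 -dN z.
by apply/esym/eqP; rewrite -subr_eq0 -mxrank_eq0 -dN' z.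
Qed.

Lemma idempotent_indecomposable M : ~ is_zero_rep M ->
  (forall e : gmx M M, is_hom e -> (forall v, e v *m e v = e v) ->
     (forall v, e v = 0) \/ (forall v, e v = 1%:M)) ->
  indecomposable M.
Proof.
move=> M0 H; split=> // N N' /rep_iso_sumP.
move=> [p [p' [i [i' [[hp hp' hi hi'] s1 s2 s3]]]]].
have := H (fun v => p v *m i v) (is_hom_comp hp hi).
case=> [v|e0|e1].
- by rewrite mulmxA -(mulmxA _ (i v)); have [-> _] := s2 v; rewrite mulmx1.
- left=> v; have : 1%:M = 0 :> 'M[C]_(dimv N v).
    have [e _] := s2 v.
    by rewrite -[LHS]mul1mx -{1}e -mulmxA -e !mulmxA -(mulmxA (i v)) e0 mulmx0 mul0mx.
  by move/(congr1 mxrank); rewrite mxrank1 mxrank0.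
- right=> v; have : 1%:M = 0 :> 'M[C]_(dimv N' v).
    have [_ e] := s2 v; have [_ e'] := s3 v.
    by rewrite -e -[i' v]mulmx1 -e1 mulmxA e' !mul0mx.
  by move/(congr1 mxrank); rewrite mxrank1 mxrank0.
Qed.

Definition total_dim M : nat := (\sum_v dimv M v)%N.

Lemma total_dim_iso M N : rep_iso M N -> total_dim M = total_dim N.
Proof. by move=> /rep_iso_dimv e; rewrite /total_dim e. Qed.

Lemma total_dim_sum M N : total_dim (rep_sum M N) = (total_dim M + total_dim N)%N.
Proof. by rewrite /total_dim -big_split. Qed.

Lemma total_dim0 M : total_dim M = 0%N <-> is_zero_rep M.
Proof.
split=> [/eqP|z]; last by rewrite /total_dim big1.
by rewrite sum_nat_eq0 => /forallP z v; apply/eqP; apply: z.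
Qed.

Definition zero_rep : rep := @Rep R Q (fun=> 0%N) (fun=> 0).

Lemma rep_sum0 M : rep_iso M (rep_sum M zero_rep).
Proof.
apply/rep_iso_sumP; exists (fun=> 1%:M), (fun=> 0), (fun=> 1%:M), (fun=> 0).
by split=> [|v|v|v]; try split; move=> *; rewrite ?mulmx1 ?mul1mx ?mulmx0 ?mul0mx ?addr0 //;
  apply/matrixP => -[].
Qed.

Lemma exists_indecomposable_summand M : ~ is_zero_rep M ->
  exists N N', rep_iso M (rep_sum N N') /\ indecomposable N.
Proof.
elim/ltn_ind: {M}_.+1 {-2}M (ltnSn (total_dim M)) => n IH M leM M0.
have [indM|nindM] := pselect (indecomposable M).
  by exists M, zero_rep; split=> //; apply: rep_sum0.
have [N [N' [iso [N0 N'0]]]] : exists N N', rep_iso M (rep_sum N N') /\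
    (~ is_zero_rep N /\ ~ is_zero_rep N').
  apply: contrapT => H; apply: nindM; split=> // N N' iso.
  apply: contrapT => /not_orP[N0 N'0]; apply: H.
  by exists N, N'.
have lt : (total_dim N < total_dim M)%N.
  rewrite (total_dim_iso iso) total_dim_sum -[X in (X < _)%N]addn0 ltn_add2l.
  by rewrite lt0n; apply/eqP => /total_dim0.
have [|//|L [L' [isoL indL]]] := IH (total_dim M) _ N lt; first by [].
exists L, (rep_sum L' N'); split=> //; exact: rep_sum_assoc iso isoL.
Qed.

End RepresentationBasics.

(** * The Auslander-Reiten translation is left exact *)

Lemma mulmx_ext (F : fieldType) m n (A B : 'M[F]_(m, n)) :
  (forall x : 'rV_m, x *m A = x *m B) -> A = B.
Proof. by move=> H; apply/row_matrixP => i; rewrite !rowE H. Qed.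

Section QuiverHeight.
Variable Q : quiver.

Definition succ_rel : rel (vertex Q) :=
  fun u v => [exists h : arrow Q, (src h == u) && (tgt h == v)].

(** The number of vertices reachable from [v]. Without oriented cycles it drops along every arrow,
    and it is the measure for all inductions over vertices, in both directions. *)
Definition ht (v : vertex Q) : nat := #|connect succ_rel v|.

Lemma connect_qpath u v : connect succ_rel u v -> exists p, qpath u p v.
Proof.
move=> /connectP[s]; elim: s u => [|w s IH] u /=.
  by move=> _ ->; exists [::] => /=.
move=> /andP[/existsP[h /andP[/eqP hu /eqP hw]] sp] vE.
have [p pv] := IH _ sp vE.
by exists (h :: p); rewrite /= hu eqxx hw.
Qed.

Hypothesis acyclic : no_oriented_cycle Q.

Lemma ht_lt (h : arrow Q) : (ht (tgt h) < ht (src h))%N.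
Proof.
have e : succ_rel (src h) (tgt h) by apply/existsP; exists h; rewrite !eqxx.
apply/proper_card/properP; split.
  apply/fintype.subsetP => w; rewrite !inE => c.
  exact: connect_trans (connect1 e) c.
exists (src h); rewrite inE ?connect0 //.
apply/negP => /connect_qpath[p pv].
by have := @acyclic (src h) (h :: p); rewrite /= eqxx pv => /(_ isT).
Qed.

Lemma qpath_size (u : vertex Q) p v : qpath u p v -> (size p + ht v <= ht u)%N.
Proof.
elim: p u => [|h p IH] u /=; first by move=> /eqP->.
move=> /andP[/eqP <- /IH le]; rewrite addSn.
exact: leq_ltn_trans le (ht_lt h).
Qed.

Lemma qpath_size_le (u : vertex Q) p v : qpath u p v -> (size p <= #|vertex Q|)%N.
Proof.
move=> /qpath_size le; apply: leq_trans (leq_trans (leq_addr _ _) le) _.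
exact: max_card.
Qed.

End QuiverHeight.

Lemma dep_choice (A : Type) (T : A -> Type) (P : forall a, T a -> Prop) :
  (forall a, exists x, P a x) -> exists f : forall a, T a, forall a, P a (f a).
Proof. by move=> H; exists (fun a => projT1 (cid (H a))) => a; case: cid. Qed.

Section ARTranslate.
Variables (R : realType) (Q : quiver).
Hypothesis acyclic : no_oriented_cycle Q.
Local Notation C := R[i].
Local Notation rep := (rep R Q).
Implicit Types L M N : rep.

Definition coeffs M := forall h : arrow Q, seq (arrow Q) -> 'rV[C]_(dimv M (src h)).

Lemma coeffs_eq M (u u' : coeffs M) : (forall h p, u h p = u' h p) -> u = u'.
Proof.
move=> e; apply: functional_extensionality_dep => h; apply/funext => p; exact: e.
Qed.

Lemma ar_space_lin M v c (u u' : coeffs M) : ar_space v u -> ar_space v u' ->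
  ar_space v (fun h p => c *: u h p + u' h p).
Proof.
move=> [u0 ur] [u'0 u'r]; split=> [h p np|i q qi f].
  by rewrite u0 // u'0 // scaler0 addr0.
under eq_bigr => h _ do rewrite mulmxDl -scalemxAl.
under [RHS]eq_bigr => h _ do rewrite !mulmxDl -!scalemxAl.
by rewrite !big_split -!scaler_sumr /= ur // u'r.
Qed.

Lemma ar_space0 M v : ar_space v (fun h _ => 0 : 'rV[C]_(dimv M (src h))).
Proof.
by split=> // i q _ f; rewrite !big1 // => h _; rewrite !mul0mx.
Qed.

(** Paths have bounded length, so a family [u h p] supported on paths has finitely many coordinates,
    and [ar_space] becomes a subspace of a finite-dimensional space. A basis of it gives the
    translate. *)
Lemma ar_translate_exists M : exists N, ar_translate M N.
Proof.
pose b := #|vertex Q|.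
pose K : finType := {h : arrow Q & (b.-bseq (arrow Q) * 'I_(dimv M (src h)))%type}.
pose dec (x : 'rV[C]_#|{: K}|) : coeffs M := fun h p =>
  if insub p is Some p' then
    \row_j x 0 (enum_rank (Tagged
      (fun h => (b.-bseq (arrow Q) * 'I_(dimv M (src h)))%type) (p', j) : K))
  else 0.
pose enc (u : coeffs M) : 'rV[C]_#|{: K}| := \row_k
  let t : K := enum_val k in u (tag t) (tagged t).1 0 (tagged t).2.
have decL c x y h p : dec (c *: x + y) h p = c *: dec x h p + dec y h p.
  rewrite /dec; case: insub => [p'|]; last by rewrite scaler0 addr0.
  by apply/rowP => j; rewrite !mxE.
have dec_sum n (c : 'I_n -> C) x h p :
    dec (\sum_i c i *: x i) h p = \sum_i c i *: dec (x i) h p.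
  elim/big_rec2: _ => [|i y1 y2 _ <-]; last exact: decL.
  by rewrite /dec; case: insub => // p'; apply/rowP => j; rewrite !mxE.
have enc_dec x : enc (dec x) = x.
  apply/rowP => k; rewrite mxE /dec /=; case E: (enum_val k) => [h [p j]] /=.
  by rewrite valK mxE -[RHS](congr1 (x 0) (enum_valK k)) E.
have dec_enc u h p : (size p <= b)%N -> dec (enc u) h p = u h p.
  move=> sp; rewrite /dec; case: insubP => [p' _ e|]; last by rewrite sp.
  by apply/rowP => j; rewrite !mxE enum_rankK /= e.
have dec_long x h p : (b < size p)%N -> dec x h p = 0.
  by move=> sp; rewrite /dec insubN // -ltnNge.
have dec_encE v u : ar_space v u -> dec (enc u) = u.
  move=> [u0 _]; apply: coeffs_eq => h p.
  case: (leqP (size p) b) => sp; first exact: dec_enc.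
  rewrite dec_long // u0 //; apply/negP => /(qpath_size_le acyclic).
  by rewrite leqNgt sp.
have dec0 : dec 0 = fun h _ => 0.
  by apply: coeffs_eq => h p; have := dec_sum 0%N (fun=> 0) (fun=> 0) h p; rewrite !big_ord0.
have sub v : exists rB : {r & 'M[C]_(r, #|{: K}|)}, row_free (tagged rB) /\
    forall x, ar_space v (dec x) <-> (x <= tagged rB)%MS.
  have [||r [B HB]] := @subspace_mx C _ (fun x => ar_space v (dec x)).
  - by rewrite dec0; apply: ar_space0.
  - move=> c x y Sx Sy; have -> : dec (c *: x + y) = fun h p => c *: dec x h p + dec y h p.
      by apply: coeffs_eq => h p; rewrite decL.
    exact: ar_space_lin.
  - by exists (existT _ r B).
have [rB HB] := choice sub.
pose r v := tag (rB v); pose B v : 'M[C]_(r v, _) := tagged (rB v).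
(* Prefixing paths with [a] preserves the defining relations; the coordinates of the shifted basis
   vectors are the rows of the matrix of [a]. *)
have shiftA (a : arrow Q) : exists A : 'M[C]_(r (src a), r (tgt a)),
    forall y h p, dec (y *m A *m B (tgt a)) h p = dec (y *m B (src a)) h (a :: p).
  have sh k : exists z : 'rV[C]_(r (tgt a)), forall h p,
      dec (z *m B (tgt a)) h p = dec (row k (B (src a))) h (a :: p).
    have : ar_space (src a) (dec (row k (B (src a)))).
      by apply/(HB (src a)).2; apply: row_sub.
    set u := dec _ => -[u0 ur].
    have Su : ar_space (tgt a) (fun h p => u h (a :: p)).
      split=> [h p np|i q qi f]; first by rewrite u0 //= eqxx.
      by rewrite -(ur i (a :: q)) //= eqxx.
    have /submxP[z zE] : (enc (fun h p => u h (a :: p)) <= B (tgt a))%MS.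
      by apply/(HB (tgt a)).2; rewrite (dec_encE _ _ Su).
    by exists z => h p; rewrite -zE (dec_encE _ _ Su).
  have [z zE] := choice sh; exists (\matrix_k z k) => y h p.
  rewrite -mulmxA 2!mulmx_sum_row !dec_sum.
  by apply: eq_bigr => k _; rewrite row_mul rowK zE.
have [A HA] := dep_choice shiftA.
exists (Rep A), (fun v x => dec (x *m B v)); split=> [v c x y h p|v x x0|v u|a x h p].
- by rewrite mulmxDl -scalemxAl decL.
- apply: (row_free_inj (HB v).1); rewrite mul0mx -[LHS]enc_dec -[RHS]enc_dec.
  by congr enc; apply: coeffs_eq => h p; rewrite x0 dec0.
- split=> [Su|[x xu]].
    have /submxP[x xE] : (enc u <= B v)%MS.
      by apply/(HB v).2; rewrite (dec_encE _ _ Su).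
    by exists x => h p; rewrite -xE (dec_encE _ _ Su).
  have <- : dec (x *m B v) = u by apply: coeffs_eq.
  by apply/(HB v).2; apply: submxMl.
- exact: HA.
Qed.

(** Surjectivity of [p] is left out, because tau does not preserve it. *)
Definition short_left_exact L M N (i : gmx L M) (p : gmx M N) : Prop :=
  [/\ is_hom i, is_hom p, forall v, row_free (i v), forall v, i v *m p v = 0
    & forall v, (kermx (p v) <= i v)%MS].

Lemma ar_space_hom L M (g : gmx L M) v (u : coeffs L) : is_hom g ->
  ar_space v u -> ar_space v (fun h q => u h q *m g (src h)).
Proof.
move=> hg [u0 ur]; split=> [h p np|i q qi f]; first by rewrite u0 // mul0mx.
have := ur i q qi (fun j => g j *m f j).
under eq_bigr => h _ do rewrite mulmxA.
under [RHS]eq_bigr => h _ do rewrite mulmxA -(mulmxA _ (rmap L h)) hg mulmxA.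
by [].
Qed.

(** The condition inside [ar_translate] with its isomorphism named: the effect of tau on morphisms
    is computed through [phi]. *)
Definition ar_iso M N (phi : forall v, 'rV[C]_(dimv N v) -> coeffs M) : Prop :=
    [/\ forall v (c : C) x y h p,
          phi v (c *: x + y) h p = c *: phi v x h p + phi v y h p,
        forall v x, (forall h p, phi v x h p = 0) -> x = 0,
        forall v u, ar_space v u <->
          exists x, forall h p, phi v x h p = u h p
      & forall (a : arrow Q) (x : 'rV[C]_(dimv N (src a))) h p,
          phi (tgt a) (x *m rmap N a) h p = phi (src a) x h (a :: p)].

Section ARIso.
Variables (M N : rep) (phi : forall v, 'rV[C]_(dimv N v) -> coeffs M).
Hypothesis isoP : ar_iso phi.

Lemma ar_iso0 v h p : @phi v 0 h p = 0.
Proof.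
have [lin _ _ _] := isoP; have := lin v 1 0 0 h p.
rewrite scaler0 addr0 scale1r => /eqP.
by rewrite -[X in X == _]addr0 (inj_eq (addrI _)) eq_sym => /eqP.
Qed.

Lemma ar_iso_sum v n (c : 'I_n -> C) x h p :
  @phi v (\sum_i c i *: x i) h p = \sum_i c i *: @phi v (x i) h p.
Proof.
have [lin _ _ _] := isoP.
elim/big_rec2: _ => [|i y1 y2 _ <-]; [exact: ar_iso0 | exact: lin].
Qed.

Lemma ar_iso_inj v x y : (forall h p, @phi v x h p = @phi v y h p) -> x = y.
Proof.
have [lin inj _ _] := isoP; move=> e; apply/eqP; rewrite -subr_eq0; apply/eqP.
by apply: inj => h p; rewrite -scaleN1r addrC lin e scaleN1r addNr.
Qed.

Lemma ar_iso_space v x : ar_space v (@phi v x).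
Proof. by have [_ _ im _] := isoP; apply/im; exists x. Qed.

End ARIso.

Lemma ar_functor L L' M M' (phiL : forall v, 'rV[C]_(dimv L' v) -> coeffs L)
    (phiM : forall v, 'rV[C]_(dimv M' v) -> coeffs M) (g : gmx L M) :
  ar_iso phiL -> ar_iso phiM -> is_hom g ->
  exists g' : gmx L' M', is_hom g' /\
    forall v x h p, phiM v (x *m g' v) h p = phiL v x h p *m g (src h).
Proof.
move=> PL PM hg; have [linM _ imM actM] := PM; have [_ _ _ actL] := PL.
have ex v : exists G : 'M[C]_(dimv L' v, dimv M' v), forall x h p,
    phiM v (x *m G) h p = phiL v x h p *m g (src h).
  have exk k : exists y, forall h p, phiM v y h p = phiL v (delta_mx 0 k) h p *m g (src h).
    by apply/imM; apply: ar_space_hom => //; apply: ar_iso_space.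
  have [y yE] := choice exk; exists (\matrix_k y k) => x h p.
  rewrite mulmx_sum_row (ar_iso_sum PM) [in RHS](row_sum_delta x) (ar_iso_sum PL).
  rewrite mulmx_suml; apply: eq_bigr => k _; rewrite rowK yE.
  by rewrite scalemxAl.
have [g' g'E] := dep_choice ex; exists g'; split=> // h.
apply: mulmx_ext => x; apply: (ar_iso_inj PM) => k p.
by rewrite !mulmxA g'E actL actM g'E.
Qed.

Lemma ar_translateP M N : ar_translate M N <->
  exists phi : forall v, 'rV[C]_(dimv N v) -> coeffs M, ar_iso phi.
Proof. by []. Qed.

Lemma ar_left_exact L M N L' M' N' (i : gmx L M) (p : gmx M N) :
  ar_translate L L' -> ar_translate M M' -> ar_translate N N' ->
  short_left_exact i p ->
  exists (i' : gmx L' M') (p' : gmx M' N'), short_left_exact i' p'.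
Proof.
move=> /ar_translateP[fL PL] /ar_translateP[fM PM] /ar_translateP[fN PN].
move=> [hi hp i0 ip0 ex].
have [i' [hi' i'E]] := ar_functor PL PM hi.
have [p' [hp' p'E]] := ar_functor PM PN hp.
exists i', p'; split=> // v.
- apply/row_freeP; exists (pinvmx (i' v)).
  suff : row_free (i' v) by move=> f; apply: mulmxVp.
  rewrite -kermx_eq0; apply/eqP/row_matrixP => k; rewrite row0.
  apply: (ar_iso_inj PL) => h q; rewrite (ar_iso0 PL).
  apply: (row_free_inj (i0 (src h))); rewrite /= mul0mx -i'E.
  by rewrite -row_mul mulmx_ker row0 (ar_iso0 PM).
- apply: mulmx_ext => x; rewrite mulmx0 mulmxA; apply: (ar_iso_inj PN) => h q.
  by rewrite p'E i'E -mulmxA ip0 mulmx0 (ar_iso0 PN).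
- apply/row_subP => k; set x := row k _.
  have xp : x *m p' v = 0 by rewrite -row_mul mulmx_ker row0.
  have [u0 ur] := ar_iso_space PM x.
  pose u : coeffs L := fun h q => fM v x h q *m pinvmx (i (src h)).
  have uE h q : u h q *m i (src h) = fM v x h q.
    apply: mulmxKpV; apply: submx_trans (ex (src h)).
    by apply/sub_kermxP; rewrite -p'E xp (ar_iso0 PN).
  have Su : ar_space v u.
    split=> [h q nq|j q qj f]; first by rewrite /u u0 // mul0mx.
    (* Each form on L_j extends along the injection [i] to a form on M_j, so the relations known for
       [x] test [u] against all forms on [L]. *)
    pose f' j := pinvmx (i j) *m f j.
    have f'E j' : f j' = i j' *m f' j' by rewrite mulmxA mulmxVp ?mul1mx.
    have := ur j q qj f'.
    under eq_bigr => h _ do rewrite -uE -mulmxA -f'E.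
    by under [RHS]eq_bigr => h _ do
      rewrite -uE -(mulmxA _ (i _)) -hi mulmxA -mulmxA -f'E.
  have [_ _ imL _] := PL; have [y yE] := (imL v u).1 Su.
  apply/submxP; exists y; apply: (ar_iso_inj PM) => h q.
  by rewrite i'E yE uE.
Qed.

Lemma ar_iter_exists n M : exists N, ar_translate_iter n M N.
Proof.
elim: n => [|n [N iN]] /=; first by exists M; apply: rep_iso_refl.
by have [N' tN] := ar_translate_exists N; exists N', N.
Qed.

Lemma short_left_exact_iso L M N L' M' N' (i : gmx L M) (p : gmx M N) :
  rep_iso L L' -> rep_iso M M' -> rep_iso N N' -> short_left_exact i p ->
  exists (i' : gmx L' M') (p' : gmx M' N'), short_left_exact i' p'.
Proof.
move=> /rep_iso_homs[f [f' [hf hf' ff' f'f]]] /rep_iso_homs[g [g' [hg hg' gg' g'g]]].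
move=> /rep_iso_homs[k [k' [hk hk' kk' k'k]]] [hi hp i0 ip0 ex].
exists (fun v => f' v *m i v *m g v), (fun v => g' v *m p v *m k v).
split=> [||v|v|v].
- exact: is_hom_comp (is_hom_comp hf' hi) hg.
- exact: is_hom_comp (is_hom_comp hg' hp) hk.
- rewrite -row_leq_rank (mxrankMfree _ _); last by apply/row_freeP; exists (g' v).
  by rewrite (mxrankMfree _ (i0 v)) row_leq_rank; apply/row_freeP; exists (f v).
- rewrite !mulmxA -(mulmxA _ (g v)) gg' mulmx1 -(mulmxA _ (i v)) ip0.
  by rewrite mulmx0 mul0mx.
- move: (mulmx_ker (g' v *m p v *m k v)); move: (kermx _) => K KE.
  have : K *m g' v *m p v = 0.
    by have := congr1 (mulmx^~ (k' v)) KE; rewrite mul0mx -!mulmxA kk' mulmx1.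
  move=> /sub_kermxP/submx_trans/(_ (ex v))/submxP[D DE].
  apply/submxP; exists (D *m f v).
  by rewrite !mulmxA -(mulmxA D) ff' mulmx1 -DE -mulmxA g'g mulmx1.
Qed.

Lemma ar_iter_left_exact n L M N L' M' N' (i : gmx L M) (p : gmx M N) :
  ar_translate_iter n L L' -> ar_translate_iter n M M' -> ar_translate_iter n N N' ->
  short_left_exact i p ->
  exists (i' : gmx L' M') (p' : gmx M' N'), short_left_exact i' p'.
Proof.
elim: n L' M' N' => [|n IH] L' M' N' /=; first exact: short_left_exact_iso.
move=> [L1 iL tL] [M1 iM tM] [N1 iN tN] sle.
have [i' [p' sle']] := IH _ _ _ iL iM iN sle.
exact: ar_left_exact tL tM tN sle'.
Qed.

Definition tau_nilpotent n M :=
  exists2 N, ar_translate_iter n M N & is_zero_rep N.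

Lemma short_left_exact_zero L M N (i : gmx L M) (p : gmx M N) :
  short_left_exact i p -> is_zero_rep L -> is_zero_rep N -> is_zero_rep M.
Proof.
move=> [_ _ _ _ ex] L0 N0 v.
have := mxrankS (ex v); rewrite mxrank_ker.
have -> : \rank (p v) = 0%N.
  by apply/eqP; rewrite -leqn0 -(N0 v) rank_leq_col.
have -> : \rank (i v) = 0%N.
  by apply/eqP; rewrite -leqn0 -(L0 v) rank_leq_row.
by rewrite subn0 leqn0 => /eqP.
Qed.

Lemma short_left_exact_zerol L M N (i : gmx L M) (p : gmx M N) :
  short_left_exact i p -> is_zero_rep M -> is_zero_rep L.
Proof.
move=> [_ _ i0 _ _] M0 v; apply/eqP; rewrite -leqn0 -(eqP (i0 v)).
by rewrite -(M0 v) rank_leq_col.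
Qed.

Lemma tau_nilpotent_sub n L M N (i : gmx L M) (p : gmx M N) :
  short_left_exact i p -> tau_nilpotent n M -> tau_nilpotent n L.
Proof.
move=> sle [M' iM M0].
have [L' iL] := ar_iter_exists n L; have [N' iN] := ar_iter_exists n N.
have [i' [p' sle']] := ar_iter_left_exact iL iM iN sle.
exists L' => //; exact: short_left_exact_zerol sle' M0.
Qed.

Lemma tau_nilpotent_ext n L M N (i : gmx L M) (p : gmx M N) :
  short_left_exact i p -> tau_nilpotent n L -> tau_nilpotent n N ->
  tau_nilpotent n M.
Proof.
move=> sle [L' iL L0] [N' iN N0]; have [M' iM] := ar_iter_exists n M.
have [i' [p' sle']] := ar_iter_left_exact iL iM iN sle.
exists M' => //; exact: short_left_exact_zero sle' L0 N0.
Qed.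

Lemma ar_translate_zero M N : ar_translate M N -> is_zero_rep M -> is_zero_rep N.
Proof.
move=> [phi [_ inj _ _]] M0 v; have e0 x : x = 0 :> 'rV[C]_(dimv N v).
  apply: inj => h p; apply/rowP => j.
  by have := ltn_ord j; rewrite [X in (_ < X)%N]M0.
have : 1%:M = 0 :> 'M[C]_(dimv N v).
  by apply: mulmx_ext => x; rewrite (e0 x) !mul0mx.
by move/(congr1 mxrank); rewrite mxrank1 mxrank0.
Qed.

Lemma tau_nilpotent_leq m n M : (m <= n)%N -> tau_nilpotent m M -> tau_nilpotent n M.
Proof.
move=> /subnK <-; elim: (n - m)%N => // k IH /IH[N iN N0].
have [N' tN] := ar_translate_exists N.
by exists N'; [exists N | apply: ar_translate_zero tN N0].
Qed.

Lemma rep_sum_left_exact M N N' : rep_iso M (rep_sum N N') ->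
  exists (i : gmx N M) (p : gmx M N'), short_left_exact i p.
Proof.
move=> /rep_iso_sumP[p [p' [i [i' [[hp hp' hi hi'] s1 s2 s3]]]]].
exists i, p'; split=> // v.
- by apply/row_freeP; exists (p v); have [] := s2 v.
- by have [] := s3 v.
- apply/submxP; exists (kermx (p' v) *m p v).
  by rewrite -[LHS]mulmx1 -(s1 v) mulmxDr !mulmxA mulmx_ker mul0mx addr0.
Qed.

Lemma preprojective_tau_nilpotent M :
  preprojective M <-> exists n, tau_nilpotent n M.
Proof.
split=> [|[n nilM] N N' iso indN]; last first.
  have [i [p sle]] := rep_sum_left_exact iso.
  (* [preprojective_indec] asks for a positive exponent while [n] may be 0, hence the shift to
     [n.+1]. *)
  have [|L iL L0] := @tau_nilpotent_leq n n.+1 N _ (tau_nilpotent_sub sle nilM) => //.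
  by split=> //; exists n.+1, L.
elim/ltn_ind: {M}_.+1 {-2}M (ltnSn (total_dim M)) => k IH M leM prepM.
have [M0|M0] := pselect (is_zero_rep M).
  by exists 0%N, M => //; apply: rep_iso_refl.
have [N [N' [iso indN]]] := exists_indecomposable_summand M0.
have [_ [n [Z [_ iZ Z0]]]] := prepM _ _ iso indN.
have lt : (total_dim N' < total_dim M)%N.
  rewrite (total_dim_iso iso) total_dim_sum -[X in (X < _)%N]add0n ltn_add2r.
  by rewrite lt0n; apply/eqP => /total_dim0; case: indN.
have [|m nilN'] := IH _ leM N' lt.
  move=> L L' isoN' indL.
  exact: (prepM _ _ (rep_sum_assoc (rep_sum_swap iso) isoN') indL).
have [i [p sle]] := rep_sum_left_exact iso; exists (maxn n m).
apply: tau_nilpotent_ext sle _ _.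
  by apply: (@tau_nilpotent_leq n); [exact: leq_maxl | exists Z].
by apply: tau_nilpotent_leq nilN'; exact: leq_maxr.
Qed.

Lemma preprojective_ext L M N (i : gmx L M) (p : gmx M N) :
  short_left_exact i p -> preprojective L -> preprojective N -> preprojective M.
Proof.
move=> sle /preprojective_tau_nilpotent[m nL] /preprojective_tau_nilpotent[n nN].
apply/preprojective_tau_nilpotent; exists (maxn m n).
apply: tau_nilpotent_ext sle _ _.
  by apply: tau_nilpotent_leq nL; apply: leq_maxl.
by apply: tau_nilpotent_leq nN; apply: leq_maxr.
Qed.

Lemma preprojective_iso M N : rep_iso M N -> preprojective M -> preprojective N.
Proof.
by move=> iso prepM L L' iso'; apply: prepM; apply: rep_iso_trans iso'.
Qed.

End ARTranslate.

(** * Reflections *)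

Lemma sum_sig (T : finType) (P : pred T) (W : zmodType) (F : T -> W) :
  \sum_(s : {x | P x}) F (val s) = \sum_(x | P x) F x.
Proof. by rewrite -(big_sub (fun x => P x) F). Qed.

Lemma mulmx_extr (F : fieldType) m n (A B : 'M[F]_(m, n)) :
  (forall x : 'cV_n, A *m x = B *m x) -> A = B.
Proof.
move=> H; apply: trmx_inj; apply: mulmx_ext => x.
by apply: trmx_inj; rewrite !trmx_mul !trmxK H.
Qed.

(** The rows of [A *m pinvmx A - 1] lie in the kernel of [A], which [B] kills. *)
Lemma mulmx_pinv_factor (F : fieldType) m n p (A : 'M[F]_(m, n))
    (B : 'M[F]_(m, p)) : kermx A *m B = 0 -> A *m (pinvmx A *m B) = B.
Proof.
move=> kB; apply/eqP; rewrite -subr_eq0 mulmxA -[X in _ - X]mul1mx -mulmxBl.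
have /sub_kermxP/submxP[D ->] : (A *m pinvmx A - 1%:M) *m A = 0.
  by rewrite mulmxBl mul1mx mulmxKpV ?subrr.
by rewrite -mulmxA kB mulmx0.
Qed.

(** * The translate described vertex by vertex *)

Section LocalTranslate.
Variables (R : realType) (Q : quiver).
Local Notation C := R[i].
Local Notation rep := (rep R Q).
Local Notation vertex := (vertex Q).
Local Notation arrow := (arrow Q).
Implicit Types L M N Z : rep.

Definition nbr (v : vertex) : finType :=
  ({h : arrow | tgt h == v} + {a : arrow | src a == v})%type.

Definition nbr_dim M N v (x : nbr v) : nat :=
  match x with
  | inl h => dimv M (src (val h))
  | inr a => dimv N (tgt (val a))
  end.

(** One map against the direction of each arrow: these are the reversed arrows that join [N] to [M]
    in a partially reflected representation. *)
Definition glue M N := forall h : arrow, 'M[C]_(dimv N (tgt h), dimv M (src h)).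

Definition glue_in M N (w : glue M N) v : 'M[C]_(dimv N v, dsum (@nbr_dim M N v)) :=
  rowsum (fun x => match x return 'M[C]_(dimv N v, nbr_dim M N x) with
  | inl h => dlt C (dimv N) v (tgt (val h)) *m w (val h)
  | inr a => dlt C (dimv N) v (src (val a)) *m rmap N (val a)
  end).

(** With [Z = M] this is the second map of the local sequence, and the sign turns its composite with
    [glue_in] into the mesh relation. A general [Z] lets the composite with a morphism M -> Z be
    written down before that morphism is known at [v]. *)
Definition glue_out M N Z (f : forall h : arrow, 'M[C]_(dimv M (src h), dimv Z (tgt h)))
    (w : forall h : arrow, 'M[C]_(dimv N (tgt h), dimv Z (src h))) v :
    'M[C]_(dsum (@nbr_dim M N v), dimv Z v) :=
  colsum (fun x => match x return 'M[C]_(nbr_dim M N x, dimv Z v) with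
  | inl h => - (f (val h) *m dlt C (dimv Z) (tgt (val h)) v)
  | inr a => w (val a) *m dlt C (dimv Z) (src (val a)) v
  end).

Lemma glue_in_out M N Z (w : glue M N) f w' v :
  glue_in w v *m @glue_out M N Z f w' v =
  \sum_(a | src a == v) dlt C (dimv N) v (src a) *m rmap N a *m w' a
                        *m dlt C (dimv Z) (src a) v
  - \sum_(h | tgt h == v) dlt C (dimv N) v (tgt h) *m w h *m f h
                        *m dlt C (dimv Z) (tgt h) v.
Proof.
rewrite mul_rowsum_colsum big_sumType /= addrC; congr (_ + _).
  rewrite (sum_sig _ (fun a => dlt C (dimv N) v (src a) *m rmap N a *m
    (w' a *m dlt C (dimv Z) (src a) v))).
  by apply: eq_bigr => a _; rewrite !mulmxA.
rewrite -sumrN (sum_sig _ (fun h => dlt C (dimv N) v (tgt h) *m w h *m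
    - (f h *m dlt C (dimv Z) (tgt h) v))).
by apply: eq_bigr => h _; rewrite mulmxN !mulmxA.
Qed.

Notation glue_rel w v := (glue_in w v *m glue_out (rmap _) w v = 0).

(* N is glued to M so that, for every v,
   0 -> N_v -> (+)_(h : _ -> v) M_(src h) (+) (+)_(a : v -> _) N_(tgt a) -> M_v
   is exact; this is Bernstein-Gelfand-Ponomarev's description of N = tau M as a
   composite of reflections at all the vertices. *)
Definition local_translate M N (w : glue M N) : Prop :=
  forall v, [/\ glue_rel w v, row_free (glue_in w v)
    & (kermx (glue_out (rmap M) w v) <= glue_in w v)%MS].

(** An element of (tau M)_v amounts to its coefficients at the trivial path, lying in the M_(src h)
    with tgt h = v, together with its shifts along the arrows [a] out of [v], lying in N_(tgt a).
    The relation for the trivial path [q] is the kernel condition at [v]; those for longer [q] are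
    the relations of the shifts. *)
Lemma ar_translate_local M N : ar_translate M N ->
  exists w : glue M N, local_translate w.
Proof.
move=> /ar_translateP[phi P]; have [lin inj im act] := P.
pose w : glue M N := fun h => \matrix_k phi (tgt h) (delta_mx 0 k) h [::].
have wE h x : x *m w h = phi (tgt h) x h [::].
  rewrite mulmx_sum_row [in RHS](row_sum_delta x) (ar_iso_sum P).
  by apply: eq_bigr => k _; rewrite rowK.
have phid v u x h p : v == u -> phi u (x *m dlt C (dimv N) v u) h p = phi v x h p.
  by move=> /eqP <-; rewrite dltii mulmx1.
exists w => v; split.
- apply: mulmx_ext => x; rewrite mulmx0; apply: mulmx_extr => c; rewrite mul0mx.
  rewrite glue_in_out mulmxBr mulmxBl !mulmx_sumr !mulmx_suml.
  have [_ /(_ v [::] _ (fun j => dlt C (dimv M) j v *m c))] := ar_iso_space P x.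
  rewrite /= eqxx => /(_ isT) e; apply/eqP; rewrite subr_eq0; apply/eqP.
  transitivity (\sum_(a | src a == v)
      phi v x a [:: a] *m (dlt C (dimv M) (src a) v *m c)).
    apply: eq_bigr => a av; rewrite !mulmxA wE act phid ?mulmxA //.
    by rewrite eq_sym.
  rewrite e; apply: eq_bigr => h hv; rewrite !mulmxA wE phid //.
  by rewrite eq_sym.
- apply: inj_row_free => x; rewrite mul_rowsum => e.
  have comp (y : nbr v) := congr1 (fun z => z *m dproj C (nbr_dim M N (v:=v)) y) e.
  apply: inj => h [|a p].
    case: (boolP (tgt h == v)) => hv; last first.
      have [u0 _] := ar_iso_space P x; apply: u0; rewrite /= eq_sym //.
    have := comp (inl (exist _ h hv)); rewrite mul_rowsum_dproj mul0mx /= mulmxA wE.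
    by rewrite phid // eq_sym.
  case: (boolP (src a == v)) => av; last first.
    by have [u0 _] := ar_iso_space P x; apply: u0; rewrite /= (negPf av).
  have := comp (inr (exist _ a av)); rewrite mul_rowsum_dproj mul0mx /= mulmxA => e'.
  rewrite -(@phid v (src a)) 1?eq_sym // -act e'; exact: (ar_iso0 P).
- apply/row_subP => k; set e := row k _.
  have eD : e *m glue_out (rmap M) w v = 0 by rewrite -row_mul mulmx_ker row0.
  move: e eD => e eD.
  (* The components of [e] are extended by zero to all arrows; matching on [idP] supplies the proof
     that an arrow is incident to [v]. *)
  pose y h : 'rV[C]_(dimv M (src h)) := match @idP (tgt h == v) with
    | ReflectT hv => e *m dproj C (@nbr_dim M N v) (inl (exist _ h hv))
    | ReflectF _ => 0 end.
  have yE (s : {h | tgt h == v}) : y (val s) = e *m dproj C (@nbr_dim M N v) (inl s).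
    case: s => h hv; rewrite /y /=; case: {-}_ / idP => // hv'.
    by rewrite (bool_irrelevance hv' hv).
  pose n a : 'rV[C]_(dimv N (tgt a)) := match @idP (src a == v) with
    | ReflectT av => e *m dproj C (@nbr_dim M N v) (inr (exist _ a av))
    | ReflectF _ => 0 end.
  have nE (s : {a | src a == v}) : n (val s) = e *m dproj C (@nbr_dim M N v) (inr s).
    case: s => a av; rewrite /n /=; case: {-}_ / idP => // av'.
    by rewrite (bool_irrelevance av' av).
  have y0 h : tgt h != v -> y h = 0.
    by move=> /negP hv; rewrite /y; case: {-}_ / idP.
  have n0 a : src a != v -> n a = 0.
    by move=> /negP av; rewrite /n; case: {-}_ / idP.
  have sumE : \sum_(a | src a == v) n a *m w a *m dlt C (dimv M) (src a) v =
      \sum_(h | tgt h == v) y h *m rmap M h *m dlt C (dimv M) (tgt h) v.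
    move: eD; rewrite -(rowsum_dproj e) mul_rowsum_colsum big_sumType /=.
    rewrite -(sum_sig _ (fun a => n a *m w a *m dlt C (dimv M) (src a) v)).
    rewrite -(sum_sig _ (fun h => y h *m rmap M h *m dlt C (dimv M) (tgt h) v)).
    rewrite addrC => /eqP.
    under [X in _ + X]eq_bigr => h _ do rewrite -yE mulmxN mulmxA.
    under eq_bigr => a _ do rewrite -nE mulmxA.
    by rewrite sumrN subr_eq0 => /eqP.
  (* The preimage of [e]: its coefficients are [y] at the trivial path, and those of [n a] behind a
     first arrow [a]. *)
  pose u : coeffs M := fun h p => if p is a :: p' then phi (tgt a) (n a) h p' else y h.
  have Su : ar_space v u.
    split=> [h [|a p] /= np|i [|a q] /= qi f].
    + by apply: y0; rewrite eq_sym.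
    + case: (boolP (src a == v)) => av; last by rewrite n0 // (ar_iso0 P).
      have [u0 _] := ar_iso_space P (n a); apply: u0.
      by move: np; rewrite av.
    + rewrite -(eqP qi); have := congr1 (mulmx^~ (f v)) sumE.
      rewrite !mulmx_suml => e'; transitivity (\sum_(a | src a == v)
          n a *m w a *m dlt C (dimv M) (src a) v *m f v).
        by apply: eq_bigr => a /eqP <-; rewrite dltii mulmx1 wE.
      rewrite e'; apply: eq_bigr => h /eqP <-; by rewrite dltii mulmx1.
    + have [av qi'] := andP qi; have [_ ur] := ar_iso_space P (n a).
      exact: (ur i q qi' f).
  have [x xE] := (im v u).1 Su; apply/submxP; exists x.
  rewrite mul_rowsum -[LHS]rowsum_dproj; apply: eq_rowsum => -[h|a].
  + rewrite -yE mulmxA wE phid; last by rewrite eq_sym (valP h).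
    by rewrite xE.
  + rewrite -nE mulmxA; apply: (ar_iso_inj P) => h p.
    rewrite act phid; last by rewrite eq_sym (valP a).
    by rewrite xE.
Qed.

End LocalTranslate.

Lemma dsumE (I : finType) (d : I -> nat) : dsum d = (\sum_i d i)%N.
Proof.
rewrite /dsum card_tagged sumnE big_map big_enum.
by apply: eq_bigr => i _; rewrite card_ord.
Qed.

Lemma mx_norow (F : fieldType) m n (A B : 'M[F]_(m, n)) : m = 0%N -> A = B.
Proof. by move=> m0; apply/matrixP => i; have := ltn_ord i; rewrite [X in (_ < X)%N]m0. Qed.

(** * Dimensions and morphisms across the reflections *)

Section LocalTranslateTheory.
Variables (R : realType) (Q : quiver).
Hypothesis acyclic : no_oriented_cycle Q.
Local Notation C := R[i].
Local Notation rep := (rep R Q).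
Implicit Types L M N Z : rep.
Local Notation gin w v := (glue_in w v).
Local Notation gout w v := (glue_out (rmap _) w v).

Definition succ_closed (S : pred (vertex Q)) := forall h : arrow Q, S (src h) -> S (tgt h).

Lemma local_dimE M N (w : glue M N) v : local_translate w -> row_full (gout w v) ->
  (dimv N v + dimv M v = \sum_(x : nbr v) nbr_dim M N x)%N.
Proof.
move=> loc /eqP full; have [JD /eqP rJ ker] := loc v.
rewrite -rJ; have -> : \rank (gin w v) = \rank (kermx (gout w v)).
  by apply/eqP; rewrite eqn_leq !mxrankS //; apply/sub_kermxP.
rewrite mxrank_ker full subnK ?dsumE //.
by rewrite -{1}full -dsumE rank_leq_row.
Qed.

(** Where the local sequence is also onto, dim N_v is determined by [M] and by [N] at the targets of
    arrows out of [v]; the recursion starts at the sinks. The set [S] allows it to stop below a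
    vertex where surjectivity fails. *)
Lemma local_dim_eq (S : pred (vertex Q)) M N (w : glue M N) M' N' (w' : glue M' N') :
  succ_closed S -> local_translate w -> local_translate w' ->
  dimv M = dimv M' ->
  (forall v, S v -> row_full (gout w v)) -> (forall v, S v -> row_full (gout w' v)) ->
  forall v, S v -> dimv N v = dimv N' v.
Proof.
move=> cl loc loc' eM full full'.
suff H n v : (ht v < n)%N -> S v -> dimv N v = dimv N' v by move=> v; apply: H (ltnSn _).
elim: n v => // n IH v lev Sv.
have := local_dimE loc' (full' v Sv); rewrite -eM.
have -> : (\sum_(x : nbr v) nbr_dim M' N' x = \sum_(x : nbr v) nbr_dim M N x)%N.
  apply: eq_bigr => -[[h hv]|[a av]] _ /=; first by rewrite eM.
  rewrite (IH (tgt a)) //; last by apply: cl; rewrite (eqP av).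
  by apply: leq_trans (ht_lt acyclic a) _; rewrite (eqP av) -ltnS.
by rewrite -(local_dimE loc (full v Sv)) => /addIn.
Qed.

Definition partial_target M N Z (g : gmx M Z) (om : glue Z N) v :
    'M[C]_(dsum (@nbr_dim R Q M N v), dimv Z v) :=
  @glue_out R Q M N Z (fun h => g (src h) *m rmap Z h) om v.

(* The part of a morphism M -> Z lying over vertices in S is obtained from its
   values outside S and from its prescribed effect [om] on the gluing maps, one
   vertex at a time starting from the sources: exactness makes M_v receive a map
   from the cokernel of N_v -> (+) M_(src h) (+) (+) N_(tgt a). *)
Lemma local_lift (S : pred (vertex Q)) M N Z (w : glue M N) (om : glue Z N)
    (g0 : gmx M Z) : succ_closed S -> local_translate w ->
  (forall v, S v -> gin om v *m gout om v = 0) ->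
  (forall h, ~~ S (tgt h) -> rmap M h *m g0 (tgt h) = g0 (src h) *m rmap Z h) ->
  (forall h, S (tgt h) -> ~~ S (src h) -> w h *m g0 (src h) = om h) ->
  exists g : gmx M Z, [/\ is_hom g, forall v, ~~ S v -> g v = g0 v &
    forall h, S (tgt h) -> w h *m g (src h) = om h].
Proof.
move=> cl loc rel hom0 glue0.
pose b := #|vertex Q|.+1.
have htB (v : vertex Q) : (ht v < b)%N by rewrite ltnS; exact: max_card.
(* After [k] rounds the conditions hold at all heights from [b - k] on. Since [b] exceeds every
   height, round 0 only asks for what is given outside [S]. *)
suff H k : (k <= b)%N -> exists g : gmx M Z, [/\ forall v, ~~ S v -> g v = g0 v,
    forall h, ~~ S (tgt h) || (b - k <= ht (tgt h))%N ->
      rmap M h *m g (tgt h) = g (src h) *m rmap Z h &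
    forall h, S (tgt h) -> ~~ S (src h) || (b - k <= ht (src h))%N ->
      w h *m g (src h) = om h].
  have [g [g_off hg wg]] := H b (leqnn b); rewrite subnn in hg wg.
  by exists g; split=> // h *; [apply: hg | apply: wg]; rewrite ?orbT.
elim: k => [|k IH] lek.
  exists g0; rewrite subn0; split=> [//|h|h]; rewrite leqNgt htB orbF.
    exact: hom0.
  exact: glue0.
have [g [g_off hg wg]] := IH (ltnW lek).
set t := (_ - k.+1)%N; have tE : (b - k)%N = t.+1 by rewrite /t subnSK.
rewrite tE in hg wg.
have ex v : exists gam : 'M[C]_(dimv M v, dimv Z v), S v -> ht v = t ->
    gout w v *m gam = partial_target g om v.
  case: (boolP (S v)) => Sv; last by exists 0.
  have [htv|ne] := eqVneq (ht v) t; last by exists 0 => _ /eqP; rewrite (negPf ne).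
  exists (pinvmx (gout w v) *m partial_target g om v) => _ _.
  (* The target has to vanish on the kernel of [glue_out], hence on the image of [glue_in]. There
     the gluing equations, already valid above height [t], reduce it to the relation assumed for
     [om]. *)
  apply: mulmx_pinv_factor.
  have [_ _ /submxP[D ->]] := loc v.
  rewrite -mulmxA; apply/eqP; rewrite (_ : gin w v *m _ = 0) ?mulmx0 //.
  rewrite glue_in_out -[RHS](rel v Sv) glue_in_out; congr (_ - _).
  apply: eq_bigr => h /eqP hv; rewrite -!mulmxA (mulmxA (w h)) wg ?hv //.
  by apply/orP; right; rewrite -htv -hv ht_lt.
have [gam gamE] := dep_choice ex.
exists (fun v => if S v && (ht v == t) then gam v else g v); split=> [v|h|h].
- by move=> Sv; rewrite (negPf Sv) /= g_off.
- case: (boolP (S (tgt h))) => Sh /=; last first.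
    move=> _; have /negPf -> : ~~ S (src h) by apply: contra Sh; apply: cl.
    by apply: hg; rewrite Sh.
  move=> leh.
  have /negPf -> : ht (src h) != t.
    by rewrite neq_ltn; apply/orP; right; apply: leq_ltn_trans leh (ht_lt acyclic h).
  rewrite andbF; have [e|ne] := eqVneq (ht (tgt h)) t; last first.
    by apply: hg; rewrite ltn_neqAle leh eq_sym ne orbT.
  have := gamE _ Sh e; rewrite mul_colsum => /eq_colsum/(_ (inl (exist _ h (eqxx _)))).
  by rewrite /= mulNmx !dltii !mulmx1 => /oppr_inj.
- move=> Sh; case: (boolP (S (src h))) => Ss /= leh; last by apply: wg; rewrite ?Ss.
  have [e|ne] := eqVneq (ht (src h)) t; last first.
    by apply: wg => //; rewrite ltn_neqAle leh eq_sym ne orbT.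
  have := gamE _ Ss e; rewrite mul_colsum => /eq_colsum/(_ (inr (exist _ h (eqxx _)))).
  by rewrite /= !dltii !mulmx1.
Qed.

(** Since [glue_out] is onto, [g v] is determined by [g] at the sources of arrows into [v] and by
    its composites with the gluing maps. The induction descends from large heights. *)
Lemma local_lift_unique (S : pred (vertex Q)) M N Z (w : glue M N) (g g' : gmx M Z) :
  (forall v, S v -> row_full (gout w v)) -> is_hom g -> is_hom g' ->
  (forall v, ~~ S v -> g v = g' v) ->
  (forall h, S (src h) -> w h *m g (src h) = w h *m g' (src h)) ->
  forall v, g v = g' v.
Proof.
move=> full hg hg' e_off e_w.
suff H n v : (#|vertex Q| - ht v < n)%N -> g v = g' v by move=> v; apply: H (ltnSn _).
elim: n v => // n IH v lev; case: (boolP (S v)) => [Sv|]; last exact: e_off.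
apply: (row_full_inj (full v Sv)); rewrite !mul_colsum; apply/eq_colsum => -[[h hv]|[a av]] /=.
- rewrite !mulNmx -!mulmxA !dlt_nat !mulmxA hg hg' (IH (src h)) //.
  have lt := ht_lt acyclic h; rewrite (eqP hv) in lt.
  by rewrite -ltnS; apply: leq_ltn_trans lev; rewrite ltn_sub2l // (leq_trans lt) ?max_card.
- rewrite -!mulmxA !dlt_nat !mulmxA e_w //.
  by rewrite (eqP av).
Qed.

End LocalTranslateTheory.

Lemma colsum_eq0 (F : fieldType) (I : finType) (d : I -> nat) n
    (A : forall i, 'M[F]_(d i, n)) : colsum A = 0 -> forall i, A i = 0.
Proof.
by move=> A0; apply/eq_colsum; rewrite A0; apply/matrixP => r c; rewrite !mxE.
Qed.

(** * Indecomposables and their translates *)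

Section PreprojectiveIndecomposables.
Variables (R : realType) (Q : quiver).
Hypothesis acyclic : no_oriented_cycle Q.
Local Notation C := R[i].
Local Notation rep := (rep R Q).
Implicit Types L M N Z : rep.
Local Notation gin w v := (glue_in w v).
Local Notation gout w v := (glue_out (rmap _) w v).

Lemma ht_ind (P : vertex Q -> Prop) :
  (forall v, (forall u, (ht u < ht v)%N -> P u) -> P v) -> forall v, P v.
Proof.
move=> H v; elim/ltn_ind: {v}(ht v).+1 {-2}v (ltnSn (ht v)) => n IH v lev.
by apply: H => u lt; apply: (IH (ht v)).
Qed.

Lemma ht_coind (P : vertex Q -> Prop) :
  (forall v, (forall u, (ht v < ht u)%N -> P u) -> P v) -> forall v, P v.
Proof.
move=> H v; have lt := ltnSn (#|vertex Q| - ht v).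
elim/ltn_ind: {v}(#|vertex Q| - ht v).+1 {-2}v lt => n IH v lev.
apply: H => u lt; apply: (IH (#|vertex Q| - ht v)%N) => //.
by apply: ltn_sub2l => //; apply: leq_trans lt _; apply: max_card.
Qed.

Lemma glue_in0 M N (w : glue M N) v : local_translate w ->
  (forall x : nbr v, match x with
    | inl h => w (val h) = 0
    | inr a => dimv N (tgt (val a)) = 0%N
    end) -> dimv N v = 0%N.
Proof.
move=> loc H; have [_ /eqP rJ _] := loc v; rewrite -rJ; apply/eqP; rewrite mxrank_eq0; apply/eqP.
rewrite -[LHS]mul1mx mul_rowsum -[RHS]rowsum_dproj; apply: eq_rowsum => x.
rewrite mul0mx mul1mx; case: x (H x) => [h|a] /= e; first by rewrite e mulmx0.
by apply: trmx_inj; apply: mx_norow.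
Qed.

(** The injective [glue_in] tests [e v] in the spaces M_(src h), where it dies by assumption, and in
    the N_(tgt a), where it factors through [e] at a smaller height. *)
Lemma glue_hom_eq0 M N (w : glue M N) (e : gmx N N) : local_translate w ->
  is_hom e -> (forall h, e (tgt h) *m w h = 0) -> forall v, e v = 0.
Proof.
move=> loc he ew; apply: ht_ind => v IH; have [_ free _] := loc v.
apply: (row_free_inj free); rewrite /= mul_rowsum mul0mx -[RHS]rowsum_dproj.
apply: eq_rowsum => -[[h hv]|[a av]] /=; rewrite mul0mx mulmxA -dlt_nat -mulmxA.
  by rewrite ew mulmx0.
by rewrite -he IH ?mulmx0 // -(eqP av) ht_lt.
Qed.

Lemma full_dim0 M N (w : glue M N) v : row_full (gout w v) ->
  (forall x : nbr v, nbr_dim M N x = 0%N) -> dimv M v = 0%N.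
Proof.
move=> /eqP <- x0; apply/eqP; rewrite -leqn0; apply: leq_trans (rank_leq_row _) _.
by rewrite dsumE big1.
Qed.

(** The data describe an idempotent of a partially reflected representation: [g0] outside [S], and
    inside [S] an endomorphism of [N] seen only through its composites [om] with the gluing maps;
    the last hypothesis expresses its idempotency. [local_lift] extends it to [M], uniqueness makes
    the extension idempotent, and indecomposability makes it 0 or 1. *)
Lemma idempotent_lift (S : pred (vertex Q)) M N (w : glue M N) (om : glue M N)
    (g0 : gmx M M) : indecomposable M -> succ_closed S -> local_translate w ->
  (forall v, S v -> row_full (gout w v)) ->
  (forall v, S v -> gin om v *m gout om v = 0) ->
  (forall h, ~~ S (tgt h) -> rmap M h *m g0 (tgt h) = g0 (src h) *m rmap M h) ->
  (forall h, S (tgt h) -> ~~ S (src h) -> w h *m g0 (src h) = om h) ->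
  (forall v, ~~ S v -> g0 v *m g0 v = g0 v) ->
  (forall (g : gmx M M) h, S (tgt h) ->
     w h *m g (src h) = om h -> om h *m g (src h) = om h) ->
  ((forall v, ~~ S v -> g0 v = 0) /\ forall h, S (tgt h) -> om h = 0) \/
  ((forall v, ~~ S v -> g0 v = 1%:M) /\ forall h, S (tgt h) -> om h = w h).
Proof.
move=> indM cl loc full rel hom0 glue0 idem0 omg.
have [g [hg g_off wg]] := local_lift acyclic cl loc rel hom0 glue0.
have gg v : g v *m g v = g v.
  apply: (local_lift_unique acyclic full (is_hom_comp hg hg) hg) v.
    by move=> v Sv; rewrite g_off // idem0.
  move=> h /cl Sh; rewrite mulmxA wg // (omg g) ?wg //.
case: (indecomposable_idempotent indM hg gg) => e; [left|right]; split=> v Sv.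
- by rewrite -g_off.
- by rewrite -wg // e mulmx0.
- by rewrite -g_off.
- by rewrite -wg // e mulmx1.
Qed.

(* If v is a minimal vertex at which the cokernel map to M_v is not onto, then
   the corresponding partially reflected representation splits off the simple
   representation at v, and so coincides with it. *)
Lemma not_full_simple M N (w : glue M N) v : indecomposable M -> local_translate w ->
  ~~ row_full (gout w v) -> (forall u, (ht u < ht v)%N -> row_full (gout w u)) ->
  [/\ dimv M v = 1%N, forall u, ~~ (ht u < ht v)%N -> u != v -> dimv M u = 0%N
    & is_zero_rep N].
Proof.
move=> indM loc nfull full; pose S (u : vertex Q) := (ht u < ht v)%N.
have cl : succ_closed S by move=> h; apply: leq_ltn_trans; apply/ltnW/ht_lt.
have Sv : S v = false by rewrite /S ltnn.
(* [f] is a nonzero linear form on the cokernel at [v]. With [m] chosen so that [m *m f = 1], the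
   matrix [f *m m] is a rank-one idempotent of M_v killing everything that arrives at [v]. *)
have [f f0 Df] : exists2 f : 'cV[C]_(dimv M v), f != 0 & gout w v *m f = 0.
  have : cokermx (gout w v) != 0 by rewrite -mxrank_eq0 mxrank_coker subn_eq0 -ltnNge
    ltn_neqAle rank_leq_col andbT.
  rewrite -trmx_eq0 => /rowV0Pn[z /submxP[D zE] z0].
  exists z^T; first by rewrite trmx_eq0.
  by rewrite zE trmx_mul trmxK mulmxA mulmx_coker mul0mx.
have [m mf] : exists m : 'rV[C]_(dimv M v), m *m f = 1%:M.
  apply/row_fullP; rewrite /row_full eqn_leq rank_leq_col lt0n mxrank_eq0 //.
have in_f (h : arrow Q) : tgt h = v -> rmap M h *m dlt C (dimv M) (tgt h) v *m f = 0.
  move=> /eqP hv; have := Df; rewrite mul_colsum => /colsum_eq0.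
  by move=> /(_ (inl (exist _ h hv)))/eqP /=; rewrite mulNmx oppr_eq0 => /eqP.
have out_f (a : arrow Q) : src a = v -> w a *m dlt C (dimv M) (src a) v *m f = 0.
  move=> /eqP av; have := Df; rewrite mul_colsum => /colsum_eq0.
  by move=> /(_ (inr (exist _ a av))).
pose g0 : gmx M M := fun u => dlt C (dimv M) u v *m f *m m *m dlt C (dimv M) v u.
have g00 (u : vertex Q) : u != v -> g0 u = 0 by move=> uv; rewrite /g0 dlt0 // !mul0mx.
have g0v : g0 v = f *m m by rewrite /g0 !dltii mul1mx mulmx1.
(* The idempotent is zero on the reflected part, hence [om = 0]. Its value [f *m m] at [v] excludes
   the alternative 0. *)
have [|||||[H _]|[H1 H2]] := @idempotent_lift S M N w (fun=> 0) g0 indM cl loc full.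
- move=> u _; rewrite glue_in_out !big1 ?subr0 // => a _; rewrite ?mulmx0 ?mul0mx //.
- move=> h Sh; have -> : g0 (src h) = 0.
    by apply: g00; apply: contraNneq Sh => e; rewrite /S -e ht_lt.
  rewrite mul0mx; have [e|hv] := eqVneq (tgt h) v; last by rewrite g00 // mulmx0.
  by rewrite /g0 !mulmxA in_f // !mul0mx.
- move=> h _ _; have [e|hv] := eqVneq (src h) v; last by rewrite g00 // mulmx0.
  by rewrite /g0 !mulmxA out_f // !mul0mx.
- move=> u _; have [->|uv] := eqVneq u v; last by rewrite g00 // mulmx0.
  by rewrite g0v mulmxA -(mulmxA f) mf mulmx1.
- by move=> g h _ _; rewrite mul0mx.
- have := H v; rewrite Sv g0v => /(_ isT) fm0.
  by case/eqP: f0; rewrite -[f]mulmx1 -mf mulmxA fm0 mul0mx.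
have dimM (u : vertex Q) : ~~ (ht u < ht v)%N -> u != v -> dimv M u = 0%N.
  move=> Su uv; have := H1 u Su; rewrite g00 // => /(congr1 mxrank).
  by rewrite mxrank0 mxrank1.
split=> //.
  apply: (@invertible_dim R _ _ f m) => //.
  by rewrite -g0v H1 ?Sv.
(* All gluing maps vanish: those starting at a vertex of [S] because the idempotent is 1 and [om] is
   0, the others because M_(src h) is zero. *)
apply: ht_ind => u IH; apply: (glue_in0 loc) => -[[h hu]|[a au]] /=; last first.
  by apply: IH; rewrite -(eqP au) ht_lt.
case: (boolP (S (tgt h))) => Sh; first by rewrite -H2.
apply: trmx_inj; apply: mx_norow; apply: dimM; last first.
  by apply: contraNneq Sh => e; rewrite /S -e ht_lt.
by apply: contra Sh; apply: cl.
Qed.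

(** An idempotent [e] of [N] is lifted to [M] with [S] the set of all vertices and
    [om h = e (tgt h) *m w h]; [glue_hom_eq0] carries the outcome back from [om] to [e]. *)
Lemma full_indecomposable M N (w : glue M N) : indecomposable M ->
  local_translate w -> (forall v, row_full (gout w v)) -> indecomposable N.
Proof.
move=> indM loc full; apply: idempotent_indecomposable.
  move=> N0; case: (indM) => M0 _; apply: M0; apply: ht_coind => v IH.
  apply: (full_dim0 (full v)) => -[[h hv]|[a av]] /=; last exact: N0.
  by apply: IH; rewrite -(eqP hv) ht_lt.
move=> e he ee.
have [|||||||[_ H]|[_ H]] := @idempotent_lift predT M N w
  (fun h => e (tgt h) *m w h) (fun=> 0) indM _ loc _.
- by [].
- by [].
- move=> v _; have [JD _ _] := loc v.
  rewrite -[RHS](mulmx0 _ (e v)) -JD !glue_in_out mulmxBr !mulmx_sumr.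
  congr (_ - _); apply: eq_bigr => a _; last by rewrite !mulmxA dlt_nat.
  by rewrite !mulmxA -(mulmxA _ _ (e _)) he !mulmxA dlt_nat.
- by [].
- by [].
- by [].
- by move=> g h _; rewrite -mulmxA => ->; rewrite mulmxA ee.
- by left; apply: (glue_hom_eq0 loc he) => h; apply: H.
- right=> v; apply/eqP; rewrite -subr_eq0; apply/eqP.
  apply: (glue_hom_eq0 (e := fun v => e v - 1%:M) loc) => [h|h].
    by rewrite mulmxBr mulmxBl mulmx1 mul1mx he.
  by rewrite mulmxBl mul1mx H // subrr.
Qed.

Lemma full_hom_lift M N M' N' (w : glue M N) (w' : glue M' N') (k : gmx N N') :
  local_translate w -> local_translate w' -> is_hom k ->
  exists g : gmx M M', is_hom g /\ forall h, w h *m g (src h) = k (tgt h) *m w' h.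
Proof.
move=> loc loc' hk.
have [//||//|//|g [hg _ wg]] := @local_lift R Q acyclic predT M N M' w
  (fun h => k (tgt h) *m w' h) (fun=> 0) _ loc; last first.
  by exists g; split=> // h; apply: wg.
move=> v _; have [JD _ _] := loc' v.
rewrite -[RHS](mulmx0 _ (k v)) -JD !glue_in_out mulmxBr !mulmx_sumr.
congr (_ - _); apply: eq_bigr => a _; last by rewrite !mulmxA dlt_nat.
by rewrite !mulmxA -(mulmxA _ _ (k _)) hk !mulmxA dlt_nat.
Qed.

(** Both composites of the lifted morphisms agree with the identity on the gluing maps, and
    surjectivity leaves only one morphism with that property. *)
Lemma full_iso M N M' N' (w : glue M N) (w' : glue M' N') :
  local_translate w -> local_translate w' ->
  (forall v, row_full (gout w v)) -> (forall v, row_full (gout w' v)) ->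
  rep_iso N N' -> rep_iso M M'.
Proof.
move=> loc loc' full full' /rep_iso_homs[k [k' [hk hk' kk' k'k]]].
have [g [hg wg]] := full_hom_lift loc loc' hk.
have [g' [hg' wg']] := full_hom_lift loc' loc hk'.
have id_hom L : @is_hom R Q L L (fun=> 1%:M) by move=> h; rewrite mulmx1 mul1mx.
exists g, g'; split=> // v.
- apply: (local_lift_unique (S := predT) acyclic (fun v _ => full v)
    (is_hom_comp hg hg') (id_hom M)) => // h _.
  by rewrite mulmxA wg -mulmxA wg' mulmxA kk' mul1mx mulmx1.
- apply: (local_lift_unique (S := predT) acyclic (fun v _ => full' v)
    (is_hom_comp hg' hg) (id_hom M')) => // h _.
  by rewrite mulmxA wg' -mulmxA wg mulmxA k'k mul1mx mulmx1.
Qed.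

(** As with Hom(P_v, M') = M'_v, a morphism may be prescribed freely at [v]: with [N] zero the
    gluing conditions are empty, and [local_lift] fills in the lower vertices. *)
Lemma simple_hom_lift M N M' N' (w : glue M N) v (k : 'M[C]_(dimv M v, dimv M' v)) :
  local_translate w -> is_zero_rep N -> is_zero_rep N' ->
  (forall u, ~~ (ht u < ht v)%N -> u != v -> dimv M u = 0%N) ->
  exists g : gmx M M', is_hom g /\ g v = k.
Proof.
move=> loc N0 N'0 M0; pose S (u : vertex Q) := (ht u < ht v)%N.
have cl : succ_closed S by move=> h; apply: leq_ltn_trans; apply/ltnW/ht_lt.
have [|||g [hg g_off _]] := @local_lift R Q acyclic S M N M' w (fun=> 0)
   (fun u => dlt C (dimv M) u v *m k *m dlt C (dimv M') v u) cl loc.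
- move=> u _; rewrite glue_in_out !big1 ?subr0 // => a _; rewrite ?mulmx0 ?mul0mx //.
- move=> h Sh; apply: mx_norow; apply: M0; first by apply: contra Sh; apply: cl.
  by apply: contraNneq Sh => e; rewrite /S -e ht_lt.
- by move=> h _ _; apply: mx_norow.
- exists g; split=> //; rewrite g_off /S ?ltnn //.
  by rewrite !dltii mul1mx mulmx1.
Qed.

Lemma simple_iso M N M' N' (w : glue M N) (w' : glue M' N') v :
  local_translate w -> local_translate w' -> is_zero_rep N -> is_zero_rep N' ->
  dimv M = dimv M' ->
  (forall u, (ht u < ht v)%N -> row_full (gout w u)) ->
  (forall u, (ht u < ht v)%N -> row_full (gout w' u)) ->
  (forall u, ~~ (ht u < ht v)%N -> u != v -> dimv M u = 0%N) -> rep_iso M M'.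
Proof.
(* The two dimension vectors are identified, so that the identity matrix can be prescribed at
   [v]. *)
case: M w => d x w; case: M' w' => d' x' w' /= loc loc' N0 N'0 e.
move: e x' w' loc'; case: _ / => x' w' loc' full full' d0.
have [g [hg gv]] := @simple_hom_lift _ _ (Rep x') N' w v 1%:M loc N0 N'0 d0.
have [g' [hg' gv']] := @simple_hom_lift _ _ (Rep x) N w' v 1%:M loc' N'0 N0 d0.
have id_hom L : @is_hom R Q L L (fun=> 1%:M) by move=> h; rewrite mulmx1 mul1mx.
exists g, g'; split=> // u.
- apply: (local_lift_unique acyclic full (is_hom_comp hg hg') (id_hom (Rep x))) => [i Si|h _].
    have [->|iv] := eqVneq i v; first by rewrite gv gv' mulmx1.
    by apply: mx_norow; apply: d0.
  exact: mx_norow.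
- apply: (local_lift_unique acyclic full' (is_hom_comp hg' hg) (id_hom (Rep x'))) => [i Si|h _].
    have [->|iv] := eqVneq i v; first by rewrite gv gv' mulmx1.
    by apply: mx_norow; apply: d0.
  exact: mx_norow.
Qed.

End PreprojectiveIndecomposables.

(** * Finitely many preprojectives of bounded dimension *)

Section PreprojectiveFiniteness.
Variables (R : realType) (Q : quiver).
Hypothesis acyclic : no_oriented_cycle Q.
Local Notation C := R[i].
Local Notation rep := (rep R Q).
Implicit Types L M N Z : rep.
Local Notation gout w v := (glue_out (rmap _) w v).

Lemma indecomposable_iso M N : rep_iso M N -> indecomposable M -> indecomposable N.
Proof.
move=> iso [M0 indM]; split.
  by move=> N0; apply: M0 => v; rewrite (rep_iso_dimv iso).
by move=> L L' iso'; apply: indM; apply: rep_iso_trans iso'.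
Qed.

Lemma ar_translate_iterS n M Z : ar_translate_iter n.+1 M Z ->
  exists L N, [/\ rep_iso M L, ar_translate L N & ar_translate_iter n N Z].
Proof.
elim: n Z => [|n IH] Z /=.
  by move=> [L iso tL]; exists L, Z; split=> //; apply: rep_iso_refl.
move=> [K /IH[L [N [iso tL iN]]] tK].
by exists L, N; split=> //; exists K.
Qed.

(** [M'] must fail at [v] as well. Otherwise M'_v would be covered by spaces that are all zero,
    above [v] because [M] vanishes there and below [v] because [N] does, against dim M'_v = 1. Both
    are then determined by their values at [v]. *)
Lemma not_full_iso M N M' N' (w : glue M N) (w' : glue M' N') v :
  local_translate w -> local_translate w' ->
  indecomposable M -> indecomposable M' -> dimv M = dimv M' ->
  (forall u, (ht u < ht v)%N -> row_full (gout w u)) ->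
  (forall u, (ht u < ht v)%N -> row_full (gout w' u)) ->
  ~~ row_full (gout w v) -> rep_iso M M'.
Proof.
move=> loc loc' indM indM' e full full' nfull.
have [d1 d0 N0] := not_full_simple acyclic indM loc nfull full.
have [full'v|nfull'] := boolP (row_full (gout w' v)); last first.
  have [_ _ N'0] := not_full_simple acyclic indM' loc' nfull' full'.
  exact: (@simple_iso _ _ acyclic _ _ _ _ w w' v).
have := d1; rewrite e (full_dim0 full'v) // => -[[h hv]|[a av]] /=.
  rewrite -e; apply: d0; rewrite -(eqP hv).
    by rewrite -leqNgt ltnW // ht_lt.
  by apply/eqP => /(congr1 (@ht Q)) eh; have := ht_lt acyclic h; rewrite eh ltnn.
pose S (u : vertex Q) := (ht u < ht v)%N; have cl : succ_closed S.
  by move=> h; apply: leq_ltn_trans; apply/ltnW/ht_lt.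
have := local_dim_eq acyclic cl loc loc' e full full'.
by move=> /(_ (tgt a)) <-; [exact: N0 | rewrite /S -(eqP av) ht_lt].
Qed.

Lemma tau_nilpotent_dimv_iso n M M' : indecomposable M -> indecomposable M' ->
  tau_nilpotent n M -> tau_nilpotent n M' -> dimv M = dimv M' -> rep_iso M M'.
Proof.
elim: n M M' => [|n IH] M M' indM indM'.
  move=> [Z /= iso Z0] _ _; case: indM => M0 _; case: M0 => v.
  by rewrite (rep_iso_dimv iso).
move=> [Z /ar_translate_iterS[L [N [isoL tL iN]]] Z0].
move=> [Z' /ar_translate_iterS[L' [N' [isoL' tL' iN']]] Z'0] e.
suff iso : rep_iso L L'.
  apply: rep_iso_trans isoL _; apply: rep_iso_trans iso _; exact: rep_iso_sym.
have {}e : dimv L = dimv L' by rewrite -(rep_iso_dimv isoL) e (rep_iso_dimv isoL').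
have {}indM := indecomposable_iso isoL indM.
have {}indM' := indecomposable_iso isoL' indM'.
have [w loc] := ar_translate_local tL; have [w' loc'] := ar_translate_local tL'.
have [full|] := pselect (forall v, row_full (gout w v) && row_full (gout w' v)).
  have fw v : row_full (gout w v) by have /andP[] := full v.
  have fw' v : row_full (gout w' v) by have /andP[] := full v.
  apply: (full_iso acyclic loc loc' fw fw'); apply: IH.
  - exact: (full_indecomposable acyclic indM loc fw).
  - exact: (full_indecomposable acyclic indM' loc' fw').
  - by exists Z.
  - by exists Z'.
  - apply/funext => v.
    exact: (@local_dim_eq _ _ acyclic predT _ _ w _ _ w').
move=> /existsNP[v0 /negP nv0].
(* A vertex of least height where either sequence fails to be onto: below it both are onto, as
   [not_full_iso] demands. *)
pose P v := ~~ (row_full (gout w v) && row_full (gout w' v)).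
have [v Pv vmin] := @arg_minnP _ v0 P (@ht Q) nv0.
have full u : (ht u < ht v)%N -> row_full (gout w u) && row_full (gout w' u).
  by apply: contraTT => /vmin; rewrite -leqNgt.
have fw u : (ht u < ht v)%N -> row_full (gout w u) by move=> /full/andP[].
have fw' u : (ht u < ht v)%N -> row_full (gout w' u) by move=> /full/andP[].
move: Pv; rewrite /P negb_and => /orP[nf|nf].
  exact: not_full_iso loc loc' indM indM' e fw fw' nf.
apply: rep_iso_sym; exact: not_full_iso loc' loc indM' indM (esym e) fw' fw nf.
Qed.

Lemma preprojective_dimv_iso M M' : indecomposable M -> indecomposable M' ->
  preprojective M -> preprojective M' -> dimv M = dimv M' -> rep_iso M M'.
Proof.
move=> indM indM' /(preprojective_tau_nilpotent acyclic)[m nM].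
move=> /(preprojective_tau_nilpotent acyclic)[n nM'].
apply: (@tau_nilpotent_dimv_iso (maxn m n)) => //.
  by apply: tau_nilpotent_leq nM; rewrite ?leq_maxl.
by apply: tau_nilpotent_leq nM'; rewrite ?leq_maxr.
Qed.

Lemma rep_sum_iso M M' N N' : rep_iso M M' -> rep_iso N N' ->
  rep_iso (rep_sum M N) (rep_sum M' N').
Proof.
move=> [f [f' [ff' f'f hf]]] [g [g' [gg' g'g hg]]].
exists (fun v => block_mx (f v) 0 0 (g v)), (fun v => block_mx (f' v) 0 0 (g' v)).
split=> [v|v|h] /=; rewrite !mulmx_block !mulmx0 !mul0mx !addr0 !add0r.
- by rewrite ff' gg' -scalar_mx_block.
- by rewrite f'f g'g -scalar_mx_block.
- by rewrite hf hg.
Qed.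

(** One representative per dimension vector covers the indecomposables. A nonzero module of
    dimension at most k+1 is one of these plus a module of dimension at most [k]. *)
Lemma preprojective_finite (D : nat) : exists Xs : seq rep, forall M,
  preprojective M -> (total_dim M <= D)%N -> exists2 X, List.In X Xs & rep_iso M X.
Proof.
have /choice[X XP] : forall d : {ffun vertex Q -> 'I_D.+1}, exists X : rep,
    forall M, preprojective M -> indecomposable M ->
      (forall v, dimv M v = d v) -> rep_iso M X.
  move=> d; have [[X [[pX iX] dX]]|nX] := pselect (exists X : rep,
    (preprojective X /\ indecomposable X) /\ forall v, dimv X v = d v).
    exists X => M pM iM dM; apply: preprojective_dimv_iso => //.
    by apply/funext => v; rewrite dM dX.
  (* A placeholder for the dimension vectors of no preprojective indecomposable. *)
  by exists (zero_rep R Q) => M pM iM dM; case: nX; exists M.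
pose indecs := [seq X d | d <- enum {ffun vertex Q -> 'I_D.+1}].
have indecP M : preprojective M -> indecomposable M -> (total_dim M <= D)%N ->
    exists2 Y, List.In Y indecs & rep_iso M Y.
  move=> pM iM le; pose d := [ffun v => inord (dimv M v)] : {ffun vertex Q -> 'I_D.+1}.
  exists (X d); last first.
    apply: XP => // v; rewrite ffunE inordK // ltnS; apply: leq_trans le.
    by rewrite /total_dim (bigD1 v) //= leq_addr.
  have : d \in enum {ffun vertex Q -> 'I_D.+1} by rewrite mem_enum.
  rewrite /indecs; elim: (enum _) => //= x s IH.
  by rewrite inE => /orP[/eqP ->|/IH]; [left|right].
suff H k : (k <= D)%N -> exists Xs : seq rep, forall M, preprojective M ->
    (total_dim M <= k)%N -> exists2 Y, List.In Y Xs & rep_iso M Y by exact: H.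
elim: k => [|k IH] lek.
  exists [:: zero_rep R Q] => M pM; rewrite leqn0 => /eqP/total_dim0 M0.
  by exists (zero_rep R Q); [left | apply: is_zero_rep_iso].
have [Xs XsP] := IH (ltnW lek).
exists (Xs ++ [seq rep_sum Y Z | Y <- indecs, Z <- Xs]) => M pM leM.
have [M0|M0] := pselect (is_zero_rep M).
  have [|Y YXs iso] := XsP M pM; first by rewrite (total_dim0 M).2.
  by exists Y => //; apply/List.in_or_app; left.
have [N [N' [iso indN]]] := exists_indecomposable_summand M0.
have pN : preprojective N.
  by move=> L L' isoN; apply: pM; apply: rep_sum_assoc iso isoN.
have pN' : preprojective N'.
  by move=> L L' isoN; apply: pM; apply: rep_sum_assoc (rep_sum_swap iso) isoN.
have dM : (total_dim N + total_dim N' <= k.+1)%N.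
  by rewrite -total_dim_sum -(total_dim_iso iso).
have N_gt0 : (0 < total_dim N)%N.
  by rewrite lt0n; apply/eqP => /total_dim0; case: indN.
have [|Y YI isoY] := indecP N pN indN.
  by apply: leq_trans lek; apply: leq_trans dM; apply: leq_addr.
have [|Z ZXs isoZ] := XsP N' pN'.
  by rewrite -ltnS; apply: leq_trans dM; rewrite -[X in (X <= _)%N]add1n leq_add2r.
exists (rep_sum Y Z); last by apply: rep_iso_trans iso _; apply: rep_sum_iso.
apply/List.in_or_app; right.
elim: (indecs) YI => //= Y' s IHs [->|YI]; apply/List.in_or_app; last first.
  by right; apply: IHs.
by left; apply: List.in_map.
Qed.

End PreprojectiveFiniteness.

(** * Constructibility of orbits *)

(** A single calculus for sums, products, determinants and adjugates, shared by the classes of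
    polynomial, regular, complex regular and continuous functions. *)
Record ring_closed (K : comNzRingType) (T : Type) (P : (T -> K) -> Prop) : Prop :=
  RingClosed {
    rc_cst : forall a, P (fun=> a);
    rcD : forall F G, P F -> P G -> P (fun x => F x + G x);
    rcM : forall F G, P F -> P G -> P (fun x => F x * G x) }.

Section RingClosed.
Variables (K : comNzRingType) (T : Type) (P : (T -> K) -> Prop).
Hypothesis PK : ring_closed P.

Lemma rcN F : P F -> P (fun x => - F x).
Proof.
move=> pF; have -> : (fun x => - F x) = (fun x => -1 * F x).
  by apply/funext => x; rewrite mulN1r.
exact (rcM PK (rc_cst PK _) pF).
Qed.

Lemma rcB F G : P F -> P G -> P (fun x => F x - G x).
Proof. by move=> pF pG; exact (rcD PK pF (rcN pG)). Qed.

Lemma rc_sum (I : Type) (r : seq I) (Q : pred I) F :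
  (forall i, P (F i)) -> P (fun x => \sum_(i <- r | Q i) F i x).
Proof.
move=> pF; elim: r => [|i r IH].
  rewrite (_ : (fun x => _) = fun=> 0); first exact: rc_cst.
  by apply/funext => x; rewrite big_nil.
case Qi : (Q i).
  rewrite (_ : (fun x => _) = fun x => F i x + \sum_(j <- r | Q j) F j x).
    exact (rcD PK (pF i) IH).
  by apply/funext => x; rewrite big_cons Qi.
rewrite (_ : (fun x => _) = fun x => \sum_(j <- r | Q j) F j x) //.
by apply/funext => x; rewrite big_cons Qi.
Qed.

Lemma rc_prod (I : Type) (r : seq I) (Q : pred I) F :
  (forall i, P (F i)) -> P (fun x => \prod_(i <- r | Q i) F i x).
Proof.
move=> pF; elim: r => [|i r IH].
  rewrite (_ : (fun x => _) = fun=> 1); first exact: rc_cst.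
  by apply/funext => x; rewrite big_nil.
case Qi : (Q i).
  rewrite (_ : (fun x => _) = fun x => F i x * \prod_(j <- r | Q j) F j x).
    exact (rcM PK (pF i) IH).
  by apply/funext => x; rewrite big_cons Qi.
rewrite (_ : (fun x => _) = fun x => \prod_(j <- r | Q j) F j x) //.
by apply/funext => x; rewrite big_cons Qi.
Qed.

Lemma rc_exp F k : P F -> P (fun x => F x ^+ k).
Proof.
move=> pF; rewrite (_ : (fun x => _) = fun x => \prod_(i <- iota 0 k) F x).
  by apply: (@rc_prod nat _ predT (fun=> F)).
by apply/funext => x; rewrite big_const_seq count_predT size_iota iter_mulr_1.
Qed.

Lemma rc_meval m (p : mpoly.mpoly m K) (F : T -> 'I_m -> K) :
  (forall i, P (F^~ i)) -> P (fun x => mpoly.meval (F x) p).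
Proof.
move=> pF; rewrite (_ : (fun x => _) = fun x => \sum_(mm <- mpoly.msupp p)
    mpoly.mcoeff mm p * \prod_(i < m) F x i ^+ mpoly.fun_of_multinom mm i).
  apply: rc_sum => mm; apply: (rcM PK (rc_cst PK _)).
  by apply: rc_prod => i; apply: rc_exp.
by apply/funext => x; rewrite mpoly.mevalE.
Qed.

Lemma rc_mulmx p q r (A : T -> 'M[K]_(p, q)) (B : T -> 'M[K]_(q, r)) :
  (forall k l, P (fun x => A x k l)) -> (forall k l, P (fun x => B x k l)) ->
  forall k l, P (fun x => (A x *m B x) k l).
Proof.
move=> pA pB k l; rewrite (_ : (fun x => _) = fun x => \sum_j A x k j * B x j l).
  by apply: rc_sum => j; exact: (rcM PK).
by apply/funext => x; rewrite mxE.
Qed.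

Lemma rc_addmx p q (A B : T -> 'M[K]_(p, q)) k l :
  P (fun x => A x k l) -> P (fun x => B x k l) -> P (fun x => (A x + B x) k l).
Proof.
move=> pA pB; rewrite (_ : (fun x => _) = fun x => A x k l + B x k l).
  exact: (rcD PK).
by apply/funext => x; rewrite mxE.
Qed.

Lemma rc_submx p q (A B : T -> 'M[K]_(p, q)) k l :
  P (fun x => A x k l) -> P (fun x => B x k l) -> P (fun x => (A x - B x) k l).
Proof.
move=> pA pB; rewrite (_ : (fun x => _) = fun x => A x k l - B x k l).
  exact: rcB.
by apply/funext => x; rewrite !mxE.
Qed.

Lemma rc_det p (A : T -> 'M[K]_p) :
  (forall k l, P (fun x => A x k l)) -> P (fun x => \det (A x)).
Proof.
move=> pA; apply: rc_sum => s; apply: (rcM PK (rc_cst PK _)).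
by apply: rc_prod => i; exact: pA.
Qed.

Lemma rc_adj p (A : T -> 'M[K]_p) k l :
  (forall k l, P (fun x => A x k l)) -> P (fun x => (\adj (A x)) k l).
Proof.
move=> pA; rewrite (_ : (fun x => _) = fun x => (-1) ^+ (l + k) * \det (row' l (col' k (A x)))).
  apply: (rcM PK (rc_cst PK _)); apply: rc_det => i j.
  rewrite (_ : (fun x => _) = fun x => A x (lift l i) (lift k j)) //.
  by apply/funext => x; rewrite !mxE.
by apply/funext => x; rewrite mxE.
Qed.

End RingClosed.

Section PolynomialFunctions.
Variables (K : comNzRingType) (T : Type) (n : nat) (c : T -> 'I_n -> K).

Definition polyfun (F : T -> K) : Prop :=
  exists p : mpoly.mpoly n K, forall x, F x = mpoly.meval (c x) p.

Lemma polyfun_rc : ring_closed polyfun.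
Proof.
split=> [a|F G [p pE] [q qE]|F G [p pE] [q qE]].
- by exists (mpoly.mpolyC n a) => x; rewrite mpoly.mevalC.
- by eexists => x; rewrite pE qE -mpoly.mevalD.
- by eexists => x; rewrite pE qE -mpoly.mevalM.
Qed.

Lemma polyfun_coord i : polyfun (fun x => c x i).
Proof. by exists (mpoly.mpolyX K (mpoly.mnm1 i)) => x; rewrite mpoly.mevalXU. Qed.

Lemma eq_polyfun F G : (forall x, F x = G x) -> polyfun F -> polyfun G.
Proof. by move=> /funext ->. Qed.

End PolynomialFunctions.

Section BooleanGenerated.
Variables (T : Type) (G : set (set T)).
Local Notation BG := (boolean_generated G).

Lemma boolean_generatedU S S' : BG S -> BG S' -> BG (S `|` S').
Proof.
move=> bS bS'; rewrite -[_ `|` _]setCK setCU.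
by apply: BG_setC; apply: BG_setI; apply: BG_setC.
Qed.

Hypothesis BT : BG setT.

Lemma boolean_generated0 : BG set0.
Proof. by rewrite -setCT; apply: BG_setC. Qed.

Lemma boolean_generated_cst (P : Prop) : BG [set _ | P].
Proof.
have [p|np] := pselect P.
  by have -> : [set _ | P] = setT :> set T by apply/seteqP; split.
have -> : [set _ | P] = set0 :> set T by apply/seteqP; split.
exact: boolean_generated0.
Qed.

Lemma boolean_generated_bigcup (I : finType) (S : I -> set T) :
  (forall i, BG (S i)) -> BG [set x | exists i, S i x].
Proof.
move=> bS; suff H (s : seq I) : BG [set x | exists2 i, i \in s & S i x].
  have -> : [set x | exists i, S i x] = [set x | exists2 i, i \in enum I & S i x].
    apply/seteqP; split=> x /=; last by move=> [i _ Si]; exists i.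
    by move=> [i Si]; exists i; rewrite ?mem_enum.
  exact: H.
elim: s => [|i s IH].
  have -> : [set x | exists2 i, i \in [::] & S i x] = set0.
    by apply/seteqP; split=> x //= [].
  exact: boolean_generated0.
have -> : [set x | exists2 j, j \in i :: s & S j x] =
    S i `|` [set x | exists2 j, j \in s & S j x].
  apply/seteqP; split=> x /=.
    by move=> [j]; rewrite inE => /orP[/eqP ->|]; [left | right; exists j].
  move=> [Si|[j js Sj]]; first by exists i; rewrite ?mem_head.
  by exists j; rewrite // inE js orbT.
exact: boolean_generatedU.
Qed.

Lemma boolean_generated_bigcap (I : finType) (S : I -> set T) :
  (forall i, BG (S i)) -> BG [set x | forall i, S i x].
Proof.
move=> bS; have -> : [set x | forall i, S i x] = ~` [set x | exists i, (~` S i) x].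
  apply/seteqP; split=> x /= H; first by move=> [j]; apply; apply: H.
  by move=> i; apply: contrapT => nSi; apply: H; exists i.
by apply: BG_setC; apply: boolean_generated_bigcup => i; apply: BG_setC.
Qed.

End BooleanGenerated.

(** * Projections of constructible sets *)

Section Chevalley.
Variables (R : realType) (T : Type) (n : nat) (c : T -> 'I_n -> R[i]).
Local Notation C := R[i].

Lemma constructible_zero F : polyfun c F -> constructible c [set x | F x = 0].
Proof.
move=> [p pE]; apply: BG_gen; exists p; apply/seteqP.
by split=> x /=; rewrite pE.
Qed.

Lemma constructibleT : constructible c setT.
Proof.
have -> : setT = [set x : T | (0 : C) = 0] by apply/seteqP; split.
exact: constructible_zero (rc_cst (polyfun_rc c) 0).
Qed.

(** The coordinates of [x] as the environment in which first-order formulas are evaluated; variables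
    from [n] on read as 0 until they are quantified. *)
Definition coord_env (x : T) : seq C := [seq c x i | i <- enum 'I_n].

Lemma nth_coord_env x k : (coord_env x)`_k = if insub k is Some i then c x i else 0.
Proof.
rewrite /coord_env; case: insubP => [i lt <-|].
  rewrite (nth_map i) ?nth_ord_enum // size_enum_ord; exact: ltn_ord.
by rewrite -leqNgt => le; rewrite nth_default // size_map size_enum_ord.
Qed.

Lemma polyfun_eval (t : GRing.term C) : GRing.rterm t ->
  polyfun c (fun x => GRing.eval (coord_env x) t).
Proof.
have rc := polyfun_rc c; elim: t => //=.
- move=> k _; case: (insubP 'I_n k) => [i _ ik|nk].
    apply: eq_polyfun (polyfun_coord c i) => x.
    by rewrite nth_coord_env -ik valK.
  by apply: eq_polyfun (rc_cst rc 0) => x; rewrite nth_coord_env insubN.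
- by move=> a _; exact: (rc_cst rc).
- by move=> k _; exact: (rc_cst rc).
- by move=> t IH t' IH' /andP[/IH pt /IH' pt']; exact: (rcD rc).
- by move=> t IH /IH pt; exact: (rcN rc).
- move=> t IH k /IH pt.
  by apply: eq_polyfun (rcM rc pt (rc_cst rc k%:R)) => x; rewrite mulr_natr.
- by move=> t IH t' IH' /andP[/IH pt /IH' pt']; exact: (rcM rc).
- by move=> t IH k /IH pt; exact: (rc_exp rc).
Qed.

Lemma constructible_qf (f : GRing.formula C) : GRing.qf_form f -> GRing.rformula f ->
  constructible c [set x | GRing.qf_eval (coord_env x) f].
Proof.
elim: f => //=.
- by move=> b _ _; apply: boolean_generated_cst; apply: constructibleT.
- move=> t t' _ /andP[rt rt'].
  have -> : [set x | GRing.eval (coord_env x) t == GRing.eval (coord_env x) t'] =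
      [set x | GRing.eval (coord_env x) t - GRing.eval (coord_env x) t' = 0].
    by apply/seteqP; split=> x /=; rewrite -subr_eq0 => /eqP.
  by apply: constructible_zero; apply: (rcB (polyfun_rc c)); apply: polyfun_eval.
- move=> f IH f' IH' /andP[q q'] /andP[r r'].
  have -> : [set x | GRing.qf_eval (coord_env x) f && GRing.qf_eval (coord_env x) f'] =
      [set x | GRing.qf_eval (coord_env x) f] `&` [set x | GRing.qf_eval (coord_env x) f'].
    by apply/seteqP; split=> x /=; [move=> /andP[] | move=> [-> ->]].
  by apply: BG_setI; [apply: IH | apply: IH'].
- move=> f IH f' IH' /andP[q q'] /andP[r r'].
  have -> : [set x | GRing.qf_eval (coord_env x) f || GRing.qf_eval (coord_env x) f'] =
      [set x | GRing.qf_eval (coord_env x) f] `|` [set x | GRing.qf_eval (coord_env x) f'].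
    by apply/seteqP; split=> x /=; move=> /orP.
  by apply: boolean_generatedU; [apply: IH | apply: IH'].
- move=> f IH f' IH' /andP[q q'] /andP[r r'].
  have -> : [set x | GRing.qf_eval (coord_env x) f ==> GRing.qf_eval (coord_env x) f'] =
      ~` [set x | GRing.qf_eval (coord_env x) f] `|` [set x | GRing.qf_eval (coord_env x) f'].
    apply/seteqP; split=> x /=; rewrite implybE; first by move=> /orP[/negP|]; [left|right].
    by move=> [/negP ->|->]; rewrite ?orbT.
  by apply: boolean_generatedU; [apply: BG_setC; apply: IH | apply: IH'].
- move=> f IH q r.
  have -> : [set x | ~~ GRing.qf_eval (coord_env x) f] =
      ~` [set x | GRing.qf_eval (coord_env x) f].
    by apply/seteqP; split=> x /=; move/negP.
  by apply: BG_setC; apply: IH.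
Qed.

Lemma constructible_holds (f : GRing.formula C) : GRing.rformula f ->
  constructible c [set x | GRing.holds (coord_env x) f].
Proof.
move=> rf; set proj := @closed_field.ClosedFieldQE.ex_elim C.
have wf : GRing.wf_QE_proj proj by exact: closed_field.ClosedFieldQE.wf_ex_elim.
have ok : GRing.valid_QE_proj proj.
  by apply: closed_field.ClosedFieldQE.holds_ex_elim; exact: solve_monicpoly.
have /andP[q r] := GRing.quantifier_elim_wf wf rf.
have -> : [set x | GRing.holds (coord_env x) f] =
    [set x | GRing.qf_eval (coord_env x) (GRing.quantifier_elim proj f)].
  by apply/seteqP; split=> x /=; move/(GRing.quantifier_elim_rformP wf ok _ rf).
exact: constructible_qf.
Qed.

Definition join_coord m (xy : T * ('I_m -> C)) (i : 'I_(n + m)) : C :=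
  match fintype.split i with inl j => c xy.1 j | inr j => xy.2 j end.

(** The existence of [y] is a formula with [m] quantifiers, binding the variables [n], ...,
    [n + m - 1] placed after the coordinates of [x]. *)
Lemma constructible_projection (m : nat) (I : finType)
    (E : I -> T * ('I_m -> C) -> C) :
  (forall i, polyfun (@join_coord m) (E i)) ->
  constructible c [set x | exists y, forall i, E i (x, y) = 0].
Proof.
move=> /choice[p pE].
(* Formulas are built from ring terms, so each polynomial is rewritten as a term without
   inverses. *)
pose tm (q : mpoly.mpoly (n + m) C) : GRing.term C :=
  \big[@GRing.Add C/GRing.Const 0]_(mm <- mpoly.msupp q)
    GRing.Mul (GRing.Const (mpoly.mcoeff mm q))
      (\big[@GRing.Mul C/GRing.Const 1]_(i < n + m)
         GRing.Exp (GRing.Var C i) (mpoly.fun_of_multinom mm i)).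
have tm_eval e q : GRing.eval e (tm q) = mpoly.meval (fun i => e`_(nat_of_ord i)) q.
  rewrite mpoly.mevalE (big_morph (GRing.eval e) (id1 := 0) (op1 := +%R)) //=.
  apply: eq_bigr => mm _; congr (_ * _).
  by rewrite (big_morph (GRing.eval e) (id1 := 1) (op1 := *%R)).
have tm_r q : GRing.rterm (tm q).
  apply: (big_ind (fun t => GRing.rterm t)) => //= [t t' -> ->//|mm _].
  by apply: (big_ind (fun t => GRing.rterm t)) => //= t t' -> ->.
pose f := \big[@GRing.And C/@GRing.Bool C true]_i GRing.Equal (tm (p i)) (GRing.Const 0).
have f_r : GRing.rformula f.
  apply: (big_ind (fun f => GRing.rformula f)) => //= [g g' -> ->//|i _].
  by rewrite tm_r.
have f_holds e : GRing.holds e f <-> forall i, GRing.eval e (tm (p i)) = 0.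
  suff H s : GRing.holds e (\big[@GRing.And C/@GRing.Bool C true]_(i <- s)
      GRing.Equal (tm (p i)) (GRing.Const 0)) <->
      forall i, i \in s -> GRing.eval e (tm (p i)) = 0.
    split=> [/H h i|h]; first by apply: h; rewrite mem_index_enum.
    by apply/H => i _.
  elim: s => [|i s IH]; first by rewrite big_nil.
  rewrite big_cons /=; split=> [[e0 /IH h] j|h].
    by rewrite inE => /orP[/eqP->|/h].
  split; first by apply: h; rewrite mem_head.
  by apply/IH => j js; apply: h; rewrite inE js orbT.
have rfold : GRing.rformula (foldr (@GRing.Exists C) f (iota n m)).
  by elim: (iota n m).
have -> : [set x | exists y, forall i, E i (x, y) = 0] =
    [set x | GRing.holds (coord_env x) (foldr (@GRing.Exists C) f (iota n m))].
  apply/seteqP; split=> x /=.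
    move=> [y xy]; apply/GRing.foldExistsP.
    exists (coord_env x ++ [seq y j | j <- enum 'I_m]).
      move=> k; rewrite !inE mem_iota => nk; rewrite nth_cat size_map size_enum_ord.
      case: ltnP => // le; rewrite [LHS]nth_default; last by rewrite size_map size_enum_ord.
      rewrite nth_default // size_map size_enum_ord leqNgt.
      by move: nk; rewrite le /= ltn_subLR.
    apply/f_holds => i; rewrite tm_eval; apply: etrans (xy i); rewrite pE.
    apply: mpoly.meval_eq => k; rewrite /join_coord nth_cat size_map size_enum_ord.
    case: fintype.splitP => j kj; rewrite kj.
      by rewrite nth_coord_env valK.
    rewrite addKn (nth_map j) ?nth_ord_enum // size_enum_ord; exact: ltn_ord.
  move=> /GRing.foldExistsP[e' se /f_holds h].
  exists (fun j => e'`_(n + j)) => i; apply: etrans (h i); rewrite tm_eval pE.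
  apply: mpoly.meval_eq => k; rewrite /join_coord; case: fintype.splitP => j kj; rewrite kj //.
  rewrite -se ?nth_coord_env ?valK // !inE mem_iota leqNgt ltn_ord //.
exact: constructible_holds.
Qed.

End Chevalley.

Section OrbitConstructible.
Variables (R : realType) (Q : quiver).
Local Notation C := R[i].
Local Notation rep := (rep R Q).

Lemma orbit_constructible (P : rep) (a : vertex Q -> nat) :
  constructible (@rep_coord R Q a) [set x | rep_iso (Rep x) P].
Proof.
have [e|ne] := pselect (a = dimv P); last first.
  have -> : [set x : rep_space R a | rep_iso (Rep x) P] = set0.
    by apply/seteqP; split=> x //= /rep_iso_dimv.
  apply: boolean_generated0; exact: constructibleT.
case: P e => b z /= e; move: z; rewrite -e => {b e} z.
(* The unknowns, indexed by [K + K], are the entries of the isomorphism and of its inverse; [E]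
   lists the two inverse equations and, indexed by [H], the commutation with the arrows. *)
pose K : finType := {i : vertex Q & ('I_(a i) * 'I_(a i))%type}.
pose H : finType := {h : arrow Q & ('I_(a (src h)) * 'I_(a (tgt h)))%type}.
pose T := (rep_space R a * ('I_#|{: K + K}| -> C))%type.
pose g (xy : T) i : 'M[C]_(a i) := \matrix_(k, l)
  xy.2 (enum_rank (inl (Tagged (fun i => 'I_(a i) * 'I_(a i))%type (k, l)) : K + K)%type).
pose g' (xy : T) i : 'M[C]_(a i) := \matrix_(k, l)
  xy.2 (enum_rank (inr (Tagged (fun i => 'I_(a i) * 'I_(a i))%type (k, l)) : K + K)%type).
pose E (t : K + K + H) (xy : T) : C := match t with
  | inl (inl t) => (g xy (tag t) *m g' xy (tag t) - 1%:M) (tagged t).1 (tagged t).2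
  | inl (inr t) => (g' xy (tag t) *m g xy (tag t) - 1%:M) (tagged t).1 (tagged t).2
  | inr t => (xy.1 (tag t) *m g xy (tgt (tag t)) - g xy (src (tag t)) *m z (tag t))
               (tagged t).1 (tagged t).2
  end.
pose jc := @join_coord R (rep_space R a) _ (@rep_coord R Q a) #|{: K + K}|.
have p2 j : polyfun jc (fun xy : T => xy.2 j).
  apply: eq_polyfun (polyfun_coord jc (rshift _ j)) => xy.
  by rewrite /jc /join_coord; case: fintype.splitP => i /= /eqP;
    [have := ltn_ord i; rewrite ltnNge => /negP + /eqP ie; rewrite -ie leq_addr
    | rewrite eqn_add2l => /eqP/val_inj ->].
have p1 h k l : polyfun jc (fun xy : T => xy.1 h k l).
  pose i := enum_rank (Tagged (fun h => 'I_(a (src h)) * 'I_(a (tgt h)))%type (k, l) : H).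
  apply: eq_polyfun (polyfun_coord jc (lshift _ i)) => xy.
  rewrite /jc /join_coord; case: fintype.splitP => j /= jE.
    by rewrite -(val_inj jE) /rep_coord /i enum_rankK.
  by have := ltn_ord i; rewrite jE ltnNge leq_addr.
have pg i k l : polyfun jc (fun xy => g xy i k l).
  by apply: eq_polyfun (p2 _) => xy; rewrite mxE.
have pg' i k l : polyfun jc (fun xy => g' xy i k l).
  by apply: eq_polyfun (p2 _) => xy; rewrite mxE.
have rc := polyfun_rc jc.
have pE t : polyfun jc (E t).
  case: t => [[t|t]|t] /=; apply: (rc_submx rc); first [exact: (rc_cst rc)
    | apply: (rc_mulmx rc) => // ? ?; exact: (rc_cst rc) | exact: (rc_mulmx rc)].
have -> : [set x : rep_space R a | rep_iso (Rep x) (Rep z)] =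
    [set x | exists y, forall t, E t (x, y) = 0].
  apply/seteqP; split=> x /=.
    move=> [f [f' [/= ff' f'f hf]]].
    pose y (j : 'I_#|{: K + K}|) : C := match enum_val j with
      | inl t => f (tag t) (tagged t).1 (tagged t).2
      | inr t => f' (tag t) (tagged t).1 (tagged t).2 end.
    exists y.
    have gE i : g (x, y) i = f i by apply/matrixP=> k l; rewrite mxE /y /= enum_rankK.
    have g'E i : g' (x, y) i = f' i by apply/matrixP=> k l; rewrite mxE /y /= enum_rankK.
    by move=> [[t|t]|t] /=; rewrite ?gE ?g'E ?ff' ?f'f ?hf subrr mxE.
  move=> [y yE]; exists (g (x, y)), (g' (x, y)); split=> [i|i|h] /=;
    apply/eqP; rewrite -subr_eq0; apply/eqP/matrixP => k l; rewrite [RHS]mxE.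
  - exact: (yE (inl (inl (Tagged (fun i => 'I_(a i) * 'I_(a i))%type (k, l))))).
  - exact: (yE (inl (inr (Tagged (fun i => 'I_(a i) * 'I_(a i))%type (k, l))))).
  - exact: (yE (inr (Tagged (fun h => 'I_(a (src h)) * 'I_(a (tgt h)))%type (k, l)))).
exact: constructible_projection.
Qed.

End OrbitConstructible.

(** * Euler characteristics under rational homeomorphisms *)

Section RegularFunctions.
Variable R : realType.
Local Notation C := R[i].

Definition rvcoord n (v : 'rV[R]_n) (i : 'I_n) : R := v 0 i.

(** Numerator and denominator are polynomials on the whole space, so sign conditions on [F] become
    polynomial inequalities; only the nonvanishing of [B] is restricted to [X]. *)
Definition regular n (X : set 'rV[R]_n) (F : 'rV[R]_n -> R) : Prop :=
  exists A B, [/\ polyfun (@rvcoord n) A, polyfun (@rvcoord n) B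
    & forall v, X v -> B v != 0 /\ F v = A v / B v].

Lemma eq_regular n (X : set 'rV[R]_n) F G :
  (forall v, X v -> F v = G v) -> regular X F -> regular X G.
Proof.
move=> e [A [B [pA pB FE]]]; exists A, B; split=> // v Xv.
by rewrite -e //; apply: FE.
Qed.

Lemma regular_polyfun n (X : set 'rV[R]_n) F : polyfun (@rvcoord n) F -> regular X F.
Proof.
move=> pF; exists F, (fun=> 1); split=> // [|v _]; last by rewrite oner_neq0 divr1.
exact: (rc_cst (polyfun_rc _)).
Qed.

Lemma regular_rc n (X : set 'rV[R]_n) : ring_closed (regular X).
Proof.
have rc := polyfun_rc (@rvcoord n).
split=> [a|F G|F G].
- by apply: regular_polyfun; exact: (rc_cst rc).
- move=> [A [B [pA pB FE]]] [A' [B' [pA' pB' GE]]].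
  exists (fun v => A v * B' v + A' v * B v), (fun v => B v * B' v); split=> [||v Xv].
  + by apply: (rcD rc); apply: (rcM rc).
  + exact: (rcM rc).
  + have [B0 ->] := FE v Xv; have [B'0 ->] := GE v Xv.
    by rewrite mulf_neq0 // addf_div.
- move=> [A [B [pA pB FE]]] [A' [B' [pA' pB' GE]]].
  exists (fun v => A v * A' v), (fun v => B v * B' v); split=> [||v Xv].
  + exact: (rcM rc).
  + exact: (rcM rc).
  + have [B0 ->] := FE v Xv; have [B'0 ->] := GE v Xv.
    by rewrite mulf_neq0 // mulf_div.
Qed.

Lemma regularV n (X : set 'rV[R]_n) F : (forall v, X v -> F v != 0) ->
  regular X F -> regular X (fun v => (F v)^-1).
Proof.
move=> F0 [A [B [pA pB FE]]]; exists B, A; split=> // v Xv.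
have [B0 e] := FE v Xv; rewrite e invf_div; split=> //.
by have := F0 v Xv; rewrite e; apply: contraNneq => ->; rewrite mul0r.
Qed.

Lemma semialgebraic_pos n F : polyfun (@rvcoord n) F -> semialgebraic [set v | 0 < F v].
Proof.
move=> [p pE]; apply: BG_gen; exists p; apply/seteqP.
by split=> v /=; rewrite pE.
Qed.

Lemma semialgebraicT n : semialgebraic (setT : set 'rV[R]_n).
Proof.
have -> : setT = [set v : 'rV[R]_n | 0 < (1 : R)].
  by apply/seteqP; split=> v //= _; rewrite ltr01.
by apply: semialgebraic_pos; exact: (rc_cst (polyfun_rc _)).
Qed.

Lemma semialgebraic_zero n F : polyfun (@rvcoord n) F -> semialgebraic [set v | F v = 0].
Proof.
move=> pF; have rc := polyfun_rc (@rvcoord n).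
have -> : [set v | F v = 0] = ~` ([set v | 0 < F v] `|` [set v | 0 < - F v]).
  apply/seteqP; split=> v /=; first by move=> -> [|]; rewrite ?oppr0 ltxx.
  move=> H; apply/eqP; rewrite eq_le !leNgt; apply/andP; split; apply/negP => h; apply: H.
    by left.
  by right; rewrite oppr_gt0.
apply: BG_setC; apply: boolean_generatedU; apply: semialgebraic_pos => //.
exact: (rcN rc).
Qed.

Lemma semialgebraic_regular_zero n F : regular setT F ->
  semialgebraic [set v : 'rV[R]_n | F v = 0].
Proof.
move=> [A [B [pA pB FE]]].
have -> : [set v | F v = 0] = [set v | A v = 0].
  apply/seteqP; split=> v /=; have [B0 ->] := FE v I; last by move=> ->; rewrite mul0r.
  by move/eqP; rewrite mulf_eq0 invr_eq0 (negPf B0) orbF => /eqP.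
exact: semialgebraic_zero.
Qed.

Definition regular_map m n (X : set 'rV[R]_m) (F : 'rV[R]_m -> 'rV[R]_n) :=
  forall i, regular X (fun v => F v 0 i).

Lemma regular_comp m n (X : set 'rV[R]_m) (F : 'rV[R]_m -> 'rV[R]_n) G :
  regular_map X F -> polyfun (@rvcoord n) G -> regular X (fun v => G (F v)).
Proof.
move=> rF [p pE]; apply: (@eq_regular _ _ (fun v => mpoly.meval (rvcoord (F v)) p)).
  by move=> v _; rewrite pE.
exact: (rc_meval (regular_rc X)).
Qed.

Lemma regular_comp_poly m n (X : set 'rV[R]_n) (F : 'rV[R]_m -> 'rV[R]_n) G :
  (forall i, polyfun (@rvcoord m) (fun v => F v 0 i)) -> regular X G ->
  regular [set v | X (F v)] (fun v => G (F v)).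
Proof.
move=> pF [A [B [[p pE] [q qE] GE]]].
have pc (s : mpoly.mpoly n R) : polyfun (@rvcoord m) (fun v => mpoly.meval (rvcoord (F v)) s).
  exact: (rc_meval (polyfun_rc _)).
exists (fun v => A (F v)), (fun v => B (F v)); split=> [||v]; last exact: GE.
  by apply: eq_polyfun (pc p) => v; rewrite pE.
by apply: eq_polyfun (pc q) => v; rewrite qE.
Qed.

Lemma semialgebraic_preim m n (X : set 'rV[R]_m) (S : set 'rV[R]_n) F :
  semialgebraic X -> regular_map X F -> semialgebraic S ->
  semialgebraic [set v | X v /\ S (F v)].
Proof.
move=> sX rF; elim=> {S} [S [p ->]|S _ IH|S S' _ IH _ IH'].
- have [|A [B [pA pB FE]]] := @regular_comp _ _ X F (fun v => mpoly.meval (rvcoord v) p) rF.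
    by exists p.
  (* A quotient [A / B] has the same sign as [A * B]. *)
  have -> : [set v | X v /\ [set v0 | 0 < mpoly.meval [eta v0 0] p] (F v)] =
      X `&` [set v | 0 < A v * B v].
    apply/seteqP; split=> v [Xv] /=; have [B0 e] := FE v Xv; rewrite -/(rvcoord (F v)) e.
      move=> pos; split=> //; have -> : A v * B v = A v / B v * B v ^+ 2.
        by rewrite expr2 mulrA divfK.
      by rewrite mulr_gt0 // exprn_even_gt0.
    move=> pos; split=> //; have -> : A v / B v = A v * B v * (B v ^- 2).
      by rewrite expr2 invfM mulrA mulfK.
    by rewrite mulr_gt0 // invr_gt0 exprn_even_gt0.
  apply: BG_setI => //; apply: semialgebraic_pos.
  exact: (rcM (polyfun_rc _)).
- have -> : [set v | X v /\ (~` S) (F v)] = X `&` ~` [set v | X v /\ S (F v)].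
    apply/seteqP; split=> v /= [Xv H]; first by split=> // -[].
    by split=> // Sv; apply: H.
  by apply: BG_setI => //; apply: BG_setC.
- have -> : [set v | X v /\ (S `&` S') (F v)] =
      [set v | X v /\ S (F v)] `&` [set v | X v /\ S' (F v)].
    by apply/seteqP; split=> v /=; [move=> [? [? ?]] | move=> [[? ?] [? ?]]].
  exact: BG_setI.
Qed.

Definition cont_at n (X : set 'rV[R]_n) v (F : 'rV[R]_n -> R) :=
  F @ within X (nbhs v) --> F v.

Lemma cont_at_rc n (X : set 'rV[R]_n) v : ring_closed (cont_at X v).
Proof.
split=> [a|F G|F G]; first exact: cvg_cst.
  exact: cvgD.
exact: cvgM.
Qed.

Lemma cont_at_polyfun n (X : set 'rV[R]_n) v F : polyfun (@rvcoord n) F -> cont_at X v F.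
Proof.
move=> [p pE]; have -> : F = fun v => mpoly.meval (rvcoord v) p by apply/funext.
apply: (rc_meval (cont_at_rc X v)) => i; apply: cvg_within_filter.
exact: coord_continuous.
Qed.

Lemma cont_at_regular n (X : set 'rV[R]_n) v F : X v -> regular X F -> cont_at X v F.
Proof.
move=> Xv [A [B [pA pB FE]]]; rewrite /cont_at; have [B0 ->] := FE v Xv.
have cA : A @ within X (nbhs v) --> A v := @cont_at_polyfun _ X v _ pA.
have cB : B @ within X (nbhs v) --> B v := @cont_at_polyfun _ X v _ pB.
apply: cvg_trans (cvgM cA (cvgV B0 cB)).
apply: near_eq_cvg; apply: filterS (withinT _ _) => x Xx.
by have [_ ->] := FE x Xx.
Qed.

Lemma cont_regular_map m n (X : set 'rV[R]_m) (F : 'rV[R]_m -> 'rV[R]_n) v :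
  X v -> regular_map X F -> F @ within X (nbhs v) --> F v.
Proof.
move=> Xv rF; apply/cvg_mx_entourageP => A entA.
apply: filter_forall => i; apply: filter_forall => j; rewrite (ord1 i).
have /cvg_entourageP/(_ A entA) H := cont_at_regular Xv (rF j).
have {}H : nbhs v (fun x => X x -> A (F v 0 j, F x 0 j)) by exact: H.
change (nbhs v (fun x => X x -> (F v 0 j, F x 0 j) \in A)).
by apply: filterS H => x H Xx; rewrite inE; apply: H.
Qed.

(** The chart of [S] is composed with [F] and [G]. The graph of the new chart is the preimage of the
    old graph under the regular map applying [G] to the first block of coordinates. *)
Lemma cell_transfer n d (X S : set 'rV[R]_n) (F G : 'rV[R]_n -> 'rV[R]_n) :
  semialgebraic X -> regular_map X F -> regular_map X G ->
  (forall v, X v -> X (F v)) -> (forall v, X v -> X (G v)) ->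
  (forall v, X v -> G (F v) = v) -> (forall v, X v -> F (G v) = v) ->
  S `<=` X -> is_cell d S -> is_cell d [set v | X v /\ S (G v)].
Proof.
move=> sX rF rG XF XG GF FG SX [sS [f [g [sgr gf fg fc gc]]]].
split; first exact: semialgebraic_preim.
exists (f \o G), (F \o g); split=> [|v [Xv Sv]|y||] /=.
- pose X2 : set 'rV[R]_(n + d) := [set w | X (lsubmx w)].
  have lc i : polyfun (@rvcoord (n + d)) (fun w => lsubmx w 0 i).
    by apply: eq_polyfun (polyfun_coord _ (lshift d i)) => w; rewrite mxE.
  have rc i : polyfun (@rvcoord (n + d)) (fun w => rsubmx w 0 i).
    by apply: eq_polyfun (polyfun_coord _ (rshift n i)) => w; rewrite mxE.
  have sX2 : semialgebraic X2.
    have -> : X2 = [set w | setT w /\ X (lsubmx w)].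
      by apply/seteqP; split=> w //= [].
    apply: semialgebraic_preim => //; first exact: semialgebraicT.
    by move=> i; apply: regular_polyfun.
  have -> : [set w | (X (lsubmx w) /\ S (G (lsubmx w))) /\ rsubmx w = f (G (lsubmx w))] =
      [set w | X2 w /\ [set w | S (lsubmx w) /\ rsubmx w = f (lsubmx w)]
        (row_mx (G (lsubmx w)) (rsubmx w))].
    apply/seteqP; split=> w /=; rewrite row_mxKl row_mxKr.
      by move=> [[? ?] ?].
    by move=> [? [? ?]].
  apply: semialgebraic_preim => // i; rewrite -(splitK i); case: (fintype.split i) => j /=.
    apply: (@eq_regular _ _ (fun w => G (lsubmx w) 0 j)); last first.
      exact: (@regular_comp_poly _ _ X (@lsubmx R 1 n d) (fun u => G u 0 j) lc (rG j)).
    by move=> w _; rewrite row_mxEl.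
  apply: (@eq_regular _ _ (fun w => rsubmx w 0 j)); last exact: regular_polyfun.
  by move=> w _; rewrite row_mxEr.
- by rewrite gf // FG.
- by have [Sg fgy] := fg y; rewrite GF; [split=> //; split=> //; apply: XF; apply: SX | apply: SX].
- apply/subspace_continuousP => v [Xv Sv] /=.
  have fc' := (subspace_continuousP S f).1 fc (G v) Sv.
  apply: cvg_comp fc'.
  move=> A nA; have {}nA : nbhs (G v) (fun u => S u -> A u) := nA.
  have H : nbhs v (fun x => X x -> S (G x) -> A (G x)) := cont_regular_map Xv rG nA.
  change (nbhs v (fun x => X x /\ S (G x) -> A (G x))).
  by apply: filterS H => x H [Xx Sx]; apply: H.
- move=> y; have [Sg _] := fg y.
  apply: (@cvg_comp _ _ _ g F _ (within X (nbhs (g y)))); last exact: (cont_regular_map (SX _ Sg)).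
  move=> A nA; have {}nA : nbhs (g y) (fun u => X u -> A u) := nA.
  have H : nbhs y (fun z => X (g z) -> A (g z)) := gc y _ nA.
  change (nbhs y (fun z => A (g z))).
  apply: filterS H => z H; apply: H; apply: SX.
  by have [] := fg z.
Qed.

Lemma has_euler_char_transfer n (X S : set 'rV[R]_n) (F G : 'rV[R]_n -> 'rV[R]_n) e :
  semialgebraic X -> regular_map X F -> regular_map X G ->
  (forall v, X v -> X (F v)) -> (forall v, X v -> X (G v)) ->
  (forall v, X v -> G (F v) = v) -> (forall v, X v -> F (G v) = v) ->
  S `<=` X -> has_euler_char S e -> has_euler_char [set v | X v /\ S (G v)] e.
Proof.
move=> sX rF rG XF XG GF FG SX [m [d [D [cD disj SD eE]]]].
exists m, d, (fun k => [set v | X v /\ D k (G v)]); split=> //.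
- move=> k; apply: (cell_transfer sX rF) => // v Dv; apply: SX.
  by rewrite SD; exists k.
- by move=> k l v [_ Dk] [_ Dl]; apply: disj Dk Dl.
- rewrite SD; apply/seteqP; split=> v /=; first by move=> [Xv [k Dk]]; exists k.
  by move=> [k [Xv Dk]]; split=> //; exists k.
Qed.

(** Cell partitions are carried over in both directions, so the two sets admit exactly the same
    values of [has_euler_char], and [xget] picks the same one. *)
Lemma euler_char_transfer n (X S S' : set 'rV[R]_n) (F G : 'rV[R]_n -> 'rV[R]_n) :
  semialgebraic X -> regular_map X F -> regular_map X G ->
  (forall v, X v -> X (F v)) -> (forall v, X v -> X (G v)) ->
  (forall v, X v -> G (F v) = v) -> (forall v, X v -> F (G v) = v) ->
  S `<=` X -> S' = [set v | X v /\ S (G v)] -> euler_char S' = euler_char S.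
Proof.
move=> sX rF rG XF XG GF FG SX S'E; rewrite /euler_char; congr xget.
apply/seteqP; split=> e /=; last first.
  by rewrite S'E; apply: (has_euler_char_transfer sX rF).
have -> : S = [set v | X v /\ S' (F v)].
  apply/seteqP; split=> v /=.
    by move=> Sv; have Xv := SX _ Sv; rewrite S'E /= GF //; do !split=> //; apply: XF.
  by move=> [Xv]; rewrite S'E /= GF // => -[].
apply: (has_euler_char_transfer sX rG) => //.
by rewrite S'E => v [].
Qed.

Lemma euler_char0 n : euler_char (set0 : set 'rV[R]_n) = 0.
Proof.
(* Every cell contains the point [g 0], so a partition of the empty set has no cells; the default of
   [xget] is 0 as well. *)
rewrite /euler_char; case: xgetP => // e _ [m [d [D [cD _ D0 ->]]]].
rewrite big1 // => k _; have [_ [f [g [_ _ fg _ _]]]] := cD k.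
have : (set0 : set 'rV[R]_n) (g 0) by rewrite D0; exists k; have [] := fg 0.
by [].
Qed.

End RegularFunctions.

(** * Orthogonal projectors under a change of basis *)

Section Projectors.
Variable R : realType.
Local Notation C := R[i].

Definition star m n (A : 'M[C]_(m, n)) : 'M[C]_(n, m) := (map_mx Num.conj A)^T.

Lemma starK m n (A : 'M[C]_(m, n)) : star (star A) = A.
Proof. by apply/matrixP => k l; rewrite !mxE conjCK. Qed.

Lemma starM m n p (A : 'M[C]_(m, n)) (B : 'M[C]_(n, p)) :
  star (A *m B) = star B *m star A.
Proof. by rewrite /star map_mxM trmx_mul. Qed.

Lemma starD m n (A B : 'M[C]_(m, n)) : star (A + B) = star A + star B.
Proof. by rewrite /star map_mxD linearD. Qed.

Lemma starB m n (A B : 'M[C]_(m, n)) : star (A - B) = star A - star B.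
Proof. by rewrite /star map_mxB linearB. Qed.

Lemma star1 n : star (1%:M : 'M[C]_n) = 1%:M.
Proof. by rewrite /star map_mx1 trmx1. Qed.

Lemma mul_star_eq0 m n (A : 'M[C]_(m, n)) : A *m star A = 0 -> A = 0.
Proof.
move=> AA; apply/matrixP => i j; have /matrixP/(_ i i) := AA.
rewrite !mxE; under eq_bigr => k _ do rewrite !mxE -normCK.
move/eqP; rewrite psumr_eq0 => [|k _]; last by rewrite exprn_ge0.
by move=> /allP/(_ j); rewrite mem_index_enum => /(_ isT)/=; rewrite sqrf_eq0 normr_eq0 => /eqP.
Qed.

Definition is_projector n (W : 'M[C]_n) : Prop := W *m W = W /\ star W = W.

(** Equal row spaces give [P *m W = P] and [W *m P = W]; the adjoint of the first equation reads
    [W *m P = P]. *)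
Lemma projector_unique n (W P : 'M[C]_n) : is_projector W -> is_projector P ->
  (W :=: P)%MS -> W = P.
Proof.
move=> [WW sW] [PP sP] e.
have eq1 : P *m W = P.
  have /submxP[D ->] : (P <= W)%MS by rewrite e.
  by rewrite -mulmxA WW.
have eq2 : W *m P = W.
  have /submxP[D ->] : (W <= P)%MS by rewrite e.
  by rewrite -mulmxA PP.
by rewrite -eq2 -[in LHS]sW -[in LHS]sP -starM eq1.
Qed.

Definition image_gram n (g W : 'M[C]_n) : 'M[C]_n :=
  W *m g *m star g *m W + (1%:M - W).

(* The orthogonal projector onto the image under g of the row space of W; the
   Gram matrix of W g, completed by 1 on the orthogonal of W, is invertible. *)
Definition proj_image n (g W : 'M[C]_n) : 'M[C]_n :=
  star g *m W *m invmx (image_gram g W) *m W *m g.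

Section ProjImage.
Variables (n : nat) (g g' W : 'M[C]_n).
Hypotheses (gg' : g *m g' = 1%:M) (pW : is_projector W).
Local Notation B := (image_gram g W).

Let WW : W *m W = W. Proof. by have [] := pW. Qed.
Let sW : star W = W. Proof. by have [] := pW. Qed.

Lemma image_gram_mulr : B *m W = W *m g *m star g *m W.
Proof. by rewrite /image_gram mulmxDl mulmxBl mul1mx WW subrr addr0 -!mulmxA WW. Qed.

Lemma image_gram_mull : W *m B = W *m g *m star g *m W.
Proof. by rewrite /image_gram mulmxDr mulmxBr mulmx1 WW subrr addr0 !mulmxA WW. Qed.

(** If [y] is killed, pairing with [y *m W] shows that [y *m W *m g] has norm 0, so [y *m W = 0] as
    [g] is invertible; the summand [1 - W] then gives [y = 0]. *)
Lemma image_gram_unit : B \in unitmx.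
Proof.
rewrite -row_free_unit; apply: inj_row_free => y yB.
have yW : y *m W = 0.
  have : y *m W *m g *m star (y *m W *m g) = 0.
    rewrite !starM sW !mulmxA -(mulmxA _ (star g)) -[X in X *m star y]mulmxA.
    have := congr1 (fun z => z *m W *m star y) yB.
    by rewrite /= -(mulmxA y) image_gram_mulr !mul0mx !mulmxA.
  move=> /mul_star_eq0 /(congr1 (mulmx^~ g')).
  by rewrite -!mulmxA gg' mulmx1 mul0mx.
by have := yB; rewrite /image_gram mulmxDr mulmxBr !mulmxA yW !mul0mx add0r mulmx1 subr0.
Qed.

Let BV : B *m invmx B = 1%:M. Proof. exact: mulmxV image_gram_unit. Qed.
Let VB : invmx B *m B = 1%:M. Proof. exact: mulVmx image_gram_unit. Qed.

Lemma image_gram_inv_comm : invmx B *m W = W *m invmx B.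
Proof.
rewrite -[LHS]mulmx1 -BV mulmxA -(mulmxA _ W) image_gram_mull -image_gram_mulr.
by rewrite (mulmxA (invmx B)) VB mul1mx.
Qed.

Lemma mul_proj_image : W *m g *m proj_image g W = W *m g.
Proof.
rewrite /proj_image !mulmxA -image_gram_mulr -[B *m W *m invmx B]mulmxA.
by rewrite -image_gram_inv_comm mulmxA BV mul1mx WW.
Qed.

Lemma proj_imageE : (proj_image g W :=: W *m g)%MS.
Proof.
apply/eqmxP; apply/andP; split; first by rewrite /proj_image -mulmxA submxMl.
by rewrite -{1}mul_proj_image submxMl.
Qed.

Lemma star_image_gram : star B = B.
Proof. by rewrite /image_gram starD starB star1 sW !starM starK sW !mulmxA. Qed.

Lemma proj_image_projector : is_projector (proj_image g W).
Proof.
split.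
  by rewrite {1}/proj_image -2!mulmxA (mulmxA W) mul_proj_image mulmxA.
have sV : star (invmx B) = invmx B.
  rewrite -[LHS]mulmx1 -BV mulmxA -{2}star_image_gram -starM BV star1 mul1mx.
  by [].
by rewrite /proj_image !starM starK sW sV !mulmxA.
Qed.

End ProjImage.

Lemma proj_imageK n (g g' W : 'M[C]_n) : g *m g' = 1%:M -> g' *m g = 1%:M ->
  is_projector W -> proj_image g' (proj_image g W) = W.
Proof.
move=> gg' g'g pW; have pP := proj_image_projector gg' pW.
apply: projector_unique => //; first exact: (proj_image_projector g'g pP).
apply: eqmx_trans (proj_imageE g'g pP) _.
apply: eqmx_trans (eqmxMr _ (proj_imageE gg' pW)) _.
by rewrite -mulmxA gg' mulmx1.
Qed.

(** Regularity over the real field, in real and imaginary parts: the formula for the projector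
    involves complex conjugation, which is not polynomial over the complex numbers. *)
Definition cregular n (X : set 'rV[R]_n) (F : 'rV[R]_n -> C) : Prop :=
  regular X (fun v => complex.Re (F v)) /\ regular X (fun v => complex.Im (F v)).

Lemma ReD (x y : C) : complex.Re (x + y) = complex.Re x + complex.Re y.
Proof. by case: x; case: y. Qed.
Lemma ImD (x y : C) : complex.Im (x + y) = complex.Im x + complex.Im y.
Proof. by case: x; case: y. Qed.
Lemma ReM (x y : C) : complex.Re (x * y) =
  complex.Re x * complex.Re y - complex.Im x * complex.Im y.
Proof. by case: x; case: y. Qed.
Lemma ImM (x y : C) : complex.Im (x * y) =
  complex.Re x * complex.Im y + complex.Im x * complex.Re y.
Proof. by case: x; case: y. Qed.
Lemma ReJ (x : C) : complex.Re (Num.conj x) = complex.Re x.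
Proof. by case: x. Qed.
Lemma ImJ (x : C) : complex.Im (Num.conj x) = - complex.Im x.
Proof. by case: x. Qed.

Lemma cregular_rc n (X : set 'rV[R]_n) : ring_closed (cregular X).
Proof.
have rc := regular_rc X; split=> [a|F G [Fr Fi] [Gr Gi]|F G [Fr Fi] [Gr Gi]].
- by split; exact: (rc_cst rc).
- split.
    by apply: eq_regular (rcD rc Fr Gr) => v _; rewrite ReD.
  by apply: eq_regular (rcD rc Fi Gi) => v _; rewrite ImD.
- split.
    by apply: eq_regular (rcB rc (rcM rc Fr Gr) (rcM rc Fi Gi)) => v _; rewrite ReM.
  by apply: eq_regular (rcD rc (rcM rc Fr Gi) (rcM rc Fi Gr)) => v _; rewrite ImM.
Qed.

Lemma cregular_conj n (X : set 'rV[R]_n) F : cregular X F ->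
  cregular X (fun v => Num.conj (F v)).
Proof.
move=> [Fr Fi]; split; first by apply: eq_regular Fr => v _; rewrite ReJ.
by apply: eq_regular (rcN (regular_rc X) Fi) => v _; rewrite ImJ.
Qed.

Lemma eq_cregular n (X : set 'rV[R]_n) F G :
  (forall v, X v -> F v = G v) -> cregular X F -> cregular X G.
Proof.
move=> e [Fr Fi]; split; [apply: eq_regular Fr|apply: eq_regular Fi] => v Xv;
  by rewrite e.
Qed.

Lemma cregularV n (X : set 'rV[R]_n) F : (forall v, X v -> F v != 0) ->
  cregular X F -> cregular X (fun v => (F v)^-1).
Proof.
move=> F0 [Fr Fi]; have rc := regular_rc X.
pose N v := complex.Re (F v) ^+ 2 + complex.Im (F v) ^+ 2.
have N0 v : X v -> N v != 0.
  move=> /F0; apply: contraNneq => /eqP; rewrite paddr_eq0 ?sqr_ge0 // !sqrf_eq0.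
  by case: (F v) => x y /= /andP[/eqP-> /eqP->].
have rN : regular X (fun v => (N v)^-1).
  by apply: regularV => //; apply: (rcD rc); exact: (rc_exp rc).
split.
  by apply: eq_regular (rcM rc Fr rN) => v _; rewrite /N; case: (F v).
by apply: eq_regular (rcN rc (rcM rc Fi rN)) => v _; rewrite /N; case: (F v).
Qed.

Lemma cregular_invmx n p (X : set 'rV[R]_n) (A : 'rV[R]_n -> 'M[C]_p) :
  (forall v, X v -> A v \in unitmx) ->
  (forall k l, cregular X (fun v => A v k l)) ->
  forall k l, cregular X (fun v => invmx (A v) k l).
Proof.
move=> uA rA k l; have rc := cregular_rc X.
apply: (@eq_cregular _ _ (fun v => (\det (A v))^-1 * (\adj (A v)) k l)).
  by move=> v Xv; rewrite /invmx uA // [RHS]mxE.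
apply: (rcM rc); last exact: (rc_adj rc).
apply: cregularV; last exact: (rc_det rc).
by move=> v /uA; rewrite unitmxE unitfE.
Qed.

Lemma cregular_proj_image n p (X : set 'rV[R]_n) (A : 'rV[R]_n -> 'M[C]_p) g g' :
  g *m g' = 1%:M -> (forall v, X v -> is_projector (A v)) ->
  (forall k l, cregular X (fun v => A v k l)) ->
  forall k l, cregular X (fun v => proj_image g (A v) k l).
Proof.
move=> gg' pA rA; have rc := cregular_rc X.
have cst q r (B : 'M[C]_(q, r)) k l : cregular X (fun=> B k l) by exact: (rc_cst rc).
have rB k l : cregular X (fun v => image_gram g (A v) k l).
  apply: (rc_addmx rc); last exact: (rc_submx rc).
  have r1 := rc_mulmx rc rA (cst _ _ g).
  have r2 := rc_mulmx rc r1 (cst _ _ (star g)).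
  exact: (rc_mulmx rc r2 rA).
have rV k l : cregular X (fun v => invmx (image_gram g (A v)) k l).
  by apply: cregular_invmx => // v /pA pAv; apply: (image_gram_unit gg').
move=> k l; have r1 := rc_mulmx rc (cst _ _ (star g)) rA.
have r2 := rc_mulmx rc r1 rV; have r3 := rc_mulmx rc r2 rA.
exact: (rc_mulmx rc r3 (cst _ _ g)).
Qed.

End Projectors.

(** * Subrepresentations and the fibres of the product *)

Section SubQuotient.
Variables (R : realType) (Q : quiver).
Local Notation C := R[i].
Local Notation rep := (rep R Q).
Implicit Types L M N : rep.

Lemma mono_iso L L' M (i : gmx L M) (i' : gmx L' M) : is_hom i -> is_hom i' ->
  (forall v, row_free (i v)) -> (forall v, row_free (i' v)) ->
  (forall v, (i v :=: i' v)%MS) -> rep_iso L L'.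
Proof.
move=> hi hi' fi fi' e.
have kE v : i v *m pinvmx (i' v) *m i' v = i v by rewrite mulmxKpV // e.
have k'E v : i' v *m pinvmx (i v) *m i v = i' v by rewrite mulmxKpV // e.
exists (fun v => i v *m pinvmx (i' v)), (fun v => i' v *m pinvmx (i v)).
split=> [v|v|h].
- by apply: (row_free_inj (fi v)); rewrite /= -(mulmxA (_ *m _)) k'E kE mul1mx.
- by apply: (row_free_inj (fi' v)); rewrite /= -(mulmxA (_ *m _)) kE k'E mul1mx.
- apply: (row_free_inj (fi' (tgt h))).
  by rewrite /= -(mulmxA (rmap L h)) kE hi -(mulmxA (_ *m _)) hi' mulmxA kE.
Qed.

Lemma epi_iso M N N' (p : gmx M N) (p' : gmx M N') : is_hom p -> is_hom p' ->
  (forall v, row_full (p v)) -> (forall v, row_full (p' v)) ->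
  (forall v, (kermx (p v) :=: kermx (p' v))%MS) -> rep_iso N N'.
Proof.
move=> hp hp' fp fp' e.
have kE v : p v *m (pinvmx (p v) *m p' v) = p' v.
  by apply: mulmx_pinv_factor; apply/sub_kermxP; rewrite e.
have k'E v : p' v *m (pinvmx (p' v) *m p v) = p v.
  by apply: mulmx_pinv_factor; apply/sub_kermxP; rewrite e.
exists (fun v => pinvmx (p v) *m p' v), (fun v => pinvmx (p' v) *m p v).
split=> [v|v|h].
- by apply: (row_full_inj (fp v)); rewrite /= mulmxA kE k'E mulmx1.
- by apply: (row_full_inj (fp' v)); rewrite /= mulmxA k'E kE mulmx1.
- apply: (row_full_inj (fp (src h))).
  by rewrite [in RHS]mulmxA kE [in LHS]mulmxA -hp -mulmxA kE hp'.
Qed.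

Definition quot_proj M (W : forall v, 'M[C]_(dimv M v)) : gmx M (quot_rep W) :=
  fun v => cokermx (W v) *m pinvmx (row_base (cokermx (W v))).

Section FixedSubspace.
Variables (M : rep) (W : forall v, 'M[C]_(dimv M v)).

Lemma quot_projK v : quot_proj W v *m row_base (cokermx (W v)) = cokermx (W v).
Proof. by rewrite mulmxKpV // eq_row_base. Qed.

Lemma quot_proj_full v : row_full (quot_proj W v).
Proof.
rewrite /row_full eqn_leq rank_leq_col /=.
by rewrite -{1}(quot_projK v) mxrankM_maxl.
Qed.

Lemma ker_quot_proj v : (kermx (quot_proj W v) :=: W v)%MS.
Proof.
apply/eqmxP/andP; split.
  by rewrite submxE -quot_projK mulmxA mulmx_ker mul0mx.
by apply/sub_kermxP; rewrite /quot_proj mulmxA mulmx_coker mul0mx.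
Qed.

Hypothesis sW : stable W.

Lemma sub_incl_hom : @is_hom R Q (sub_rep W) M (fun v => row_base (W v)).
Proof.
move=> h /=; rewrite mulmxKpV // eq_row_base; apply: submx_trans (sW h).
by apply: submxMr; rewrite eq_row_base.
Qed.

Lemma quot_proj_hom : is_hom (quot_proj W).
Proof.
move=> h; have -> : rmap (quot_rep W) h = row_base (cokermx (W (src h))) *m
    (pinvmx (cokermx (W (src h))) *m (rmap M h *m quot_proj W (tgt h))).
  by rewrite /quot_proj /= !mulmxA.
rewrite (mulmxA (quot_proj W (src h))) quot_projK (mulmxA (cokermx _)).
apply/eqP; rewrite -subr_eq0.
rewrite -[X in X - _]mul1mx -mulmxBl.
(* The chosen section of the quotient map is an inverse up to vectors of [W], and stability sends
   these to zero in the quotient. *)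
have /submxP[D ->] : (1%:M - cokermx (W (src h)) *m pinvmx (cokermx (W (src h))) <=
    W (src h))%MS.
  by rewrite submxE mulmxBl mul1mx mulmxKpV // subrr.
have := sW h; rewrite -(ker_quot_proj (tgt h)) => /sub_kermxP e.
by rewrite -mulmxA (mulmxA (W _)) e mulmx0.
Qed.

Lemma sub_quot_left_exact :
  @short_left_exact R Q (sub_rep W) M (quot_rep W) (fun v => row_base (W v)) (quot_proj W).
Proof.
split=> [||v|v|v]; first exact: sub_incl_hom.
- exact: quot_proj_hom.
- exact: row_base_free.
- by apply/sub_kermxP; rewrite ker_quot_proj eq_row_base.
- by rewrite ker_quot_proj eq_row_base.
Qed.

End FixedSubspace.

(** [sub_rep] and [quot_rep] depend on chosen bases; up to isomorphism only the image of the
    inclusion and the kernel of the projection count, and [g] matches these. *)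
Lemma subquotient_transfer M M' (g : gmx M M') (g' : gmx M' M) W W' :
  is_hom g -> is_hom g' ->
  (forall v, g v *m g' v = 1%:M) -> (forall v, g' v *m g v = 1%:M) ->
  (forall v, (W' v :=: W v *m g v)%MS) -> stable W ->
  [/\ stable W', rep_iso (sub_rep W) (sub_rep W') & rep_iso (quot_rep W) (quot_rep W')].
Proof.
move=> hg hg' gg' g'g e sW.
have gfree v : row_free (g v) by apply/row_freeP; exists (g' v).
have sW' : stable W'.
  move=> h; rewrite (eqmxMr _ (e (src h))) e -mulmxA -hg mulmxA; exact: submxMr.
split=> //.
  apply: (@mono_iso (sub_rep W) (sub_rep W') M'
    (fun v => row_base (W v) *m g v) (fun v => row_base (W' v))).
  - exact: (is_hom_comp (sub_incl_hom sW) hg).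
  - exact: sub_incl_hom.
  - by move=> v; rewrite /row_free (mxrankMfree _ (gfree v)); exact: row_base_free.
  - by move=> v; apply: row_base_free.
  - move=> v; apply: eqmx_trans (eqmxMr _ (eq_row_base _)) _.
    apply: eqmx_trans (eqmx_sym (e v)) _; apply: eqmx_sym; exact: eq_row_base.
apply: (@epi_iso M' (quot_rep W) (quot_rep W') (fun v => g' v *m quot_proj W v) (quot_proj W')).
- exact: (is_hom_comp hg' (quot_proj_hom sW)).
- exact: quot_proj_hom.
- move=> v; rewrite /row_full eqn_leq rank_leq_col /=.
  have := mxrankM_maxr (g v) (g' v *m quot_proj W v).
  by rewrite mulmxA gg' mul1mx (eqP (quot_proj_full W v)).
- exact: quot_proj_full.
- move=> v; apply: eqmx_trans (eqmx_sym (eqmx_trans (ker_quot_proj W' v) (e v))).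
  apply/eqmxP/andP; split.
    have : (kermx (g' v *m quot_proj W v) *m g' v <= W v)%MS.
      by rewrite -ker_quot_proj; apply/sub_kermxP; rewrite -mulmxA mulmx_ker.
    by move=> /(submxMr (g v)); rewrite -mulmxA g'g mulmx1.
  apply/sub_kermxP; rewrite (mulmxA _ (g' v)) -(mulmxA (W v)) gg' mulmx1.
  by apply/sub_kermxP; rewrite ker_quot_proj.
Qed.

Section FibreCoordinates.
Variable a : vertex Q -> nat.

Local Notation K := {i : vertex Q & ('I_(a i) * 'I_(a i) * bool)%type}.
Local Notation n := #|{: K}|.

Definition real_uncoord (v : 'rV[R]_n) i : 'M[C]_(a i) := \matrix_(k, l)
  (v 0 (enum_rank (Tagged (fun i => ('I_(a i) * 'I_(a i) * bool)%type) (k, l, true))) +i*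
   v 0 (enum_rank (Tagged (fun i => ('I_(a i) * 'I_(a i) * bool)%type) (k, l, false))))%C.

Lemma real_coordK (W : forall i, 'M[C]_(a i)) : real_uncoord (real_coord W) = W.
Proof.
apply: functional_extensionality_dep => i; apply/matrixP => k l.
by rewrite !mxE !enum_rankK /=; case: (W i k l).
Qed.

Lemma real_uncoordK v : real_coord (real_uncoord v) = v.
Proof.
apply/rowP => j; rewrite mxE; case E : (enum_val j) => [i [[k l] b]] /=.
rewrite mxE; transitivity (v 0 (enum_rank (enum_val j))); last by rewrite enum_valK.
by rewrite E; case: b {E}.
Qed.

(** The semialgebraic set on which the change of basis acts: for projectors the Gram matrices are
    invertible, so [proj_map] is regular there. *)
Definition projector_coords : set 'rV[R]_n := [set v | is_graded_subspace (real_uncoord v)].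

Lemma real_uncoord_cregular (X : set 'rV[R]_n) i k l :
  cregular X (fun v => real_uncoord v i k l).
Proof.
pose t b := enum_rank (Tagged (fun i => ('I_(a i) * 'I_(a i) * bool)%type) (k, l, b)).
split; apply: regular_polyfun.
  by apply: eq_polyfun (polyfun_coord _ (t true)) => v; rewrite mxE.
by apply: eq_polyfun (polyfun_coord _ (t false)) => v; rewrite mxE.
Qed.

Lemma semialgebraic_projector_coords : semialgebraic projector_coords.
Proof.
pose I : finType := {i : vertex Q & ('I_(a i) * 'I_(a i))%type}.
pose F (b : bool) (t : I) (v : 'rV[R]_n) : C := let W := real_uncoord v (tag t) in
  if b then (W *m W - W) (tagged t).1 (tagged t).2
  else (star W - W) (tagged t).1 (tagged t).2.
have rc := cregular_rc (setT : set 'rV[R]_n).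
have rF b t : cregular setT (F b t).
  case: t => i [k l]; case: b => /=.
    apply: (rc_submx rc); last exact: real_uncoord_cregular.
    by apply: (rc_mulmx rc) => ? ?; exact: real_uncoord_cregular.
  apply: (rc_submx rc); last exact: real_uncoord_cregular.
  have := cregular_conj (@real_uncoord_cregular setT i l k).
  by apply: eq_cregular => v _; rewrite [RHS]mxE [RHS]mxE.
have sF b t : semialgebraic [set v | F b t v = 0].
  have [rR rI] := rF b t.
  have -> : [set v | F b t v = 0] =
      [set v | complex.Re (F b t v) = 0] `&` [set v | complex.Im (F b t v) = 0].
    apply/seteqP; split=> v /=; first by move=> ->.
    by case: (F b t v) => x y /= [-> ->].
  by apply: BG_setI; apply: semialgebraic_regular_zero.
have -> : projector_coords = [set v | forall bt : bool * I, F bt.1 bt.2 v = 0].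
  apply/seteqP; split=> v /=.
    move=> H [[] [i [k l]]]; rewrite /F /=; have [WW sW] := H i.
      by rewrite WW subrr mxE.
    by rewrite /star sW subrr mxE.
  move=> H i; split; apply/eqP; rewrite -subr_eq0; apply/eqP/matrixP => k l; rewrite [RHS]mxE.
    exact: (H (true, Tagged (fun i => ('I_(a i) * 'I_(a i))%type) (k, l))).
  exact: (H (false, Tagged (fun i => ('I_(a i) * 'I_(a i))%type) (k, l))).
apply: boolean_generated_bigcap => [|bt]; last exact: sF.
exact: semialgebraicT.
Qed.

Definition proj_map (g : forall i, 'M[C]_(a i)) (v : 'rV[R]_n) : 'rV[R]_n :=
  real_coord (fun i => proj_image (g i) (real_uncoord v i)).

Lemma proj_map_regular (g g' : forall i, 'M[C]_(a i)) :
  (forall i, g i *m g' i = 1%:M) -> regular_map projector_coords (proj_map g).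
Proof.
move=> gg' j; case E : (enum_val j) => [i [[k l] b]].
have [rR rI] : cregular projector_coords (fun v => proj_image (g i) (real_uncoord v i) k l).
  apply: (cregular_proj_image (gg' i)) => [v H|? ?]; first exact: H.
  exact: real_uncoord_cregular.
case: b E => E; [apply: eq_regular rR|apply: eq_regular rI] => v _;
  by rewrite /proj_map [RHS]mxE E.
Qed.

End FibreCoordinates.

Lemma fibre_transfer (f f' : rep -> C) (a b : vertex Q -> nat) (x x' : rep_space R a)
    (g g' : forall i, 'M[C]_(a i)) z (W : forall i, 'M[C]_(a i)) :
  (forall M N, rep_iso M N -> f M = f N) -> (forall M N, rep_iso M N -> f' M = f' N) ->
  @is_hom R Q (Rep x) (Rep x') g -> @is_hom R Q (Rep x') (Rep x) g' ->
  (forall i, g i *m g' i = 1%:M) -> (forall i, g' i *m g i = 1%:M) ->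
  @mul_fibre R Q f f' (Rep x) b z W ->
  @mul_fibre R Q f f' (Rep x') b z (fun i => proj_image (g i) (W i)).
Proof.
move=> fi f'i hg hg' gg' g'g [/= pW sW rW fW].
have e i : (proj_image (g i) (W i) :=: W i *m g i)%MS by apply: (proj_imageE (gg' i)); exact: pW.
have [sW' isub iquot] := @subquotient_transfer (Rep x) (Rep x') g g' W
  (fun i => proj_image (g i) (W i)) hg hg' gg' g'g e sW.
split=> //=.
- by move=> i; apply: (proj_image_projector (gg' i)); exact: pW.
- move=> i; rewrite e mxrankMfree ?rW //; apply/row_freeP; by exists (g' i).
- by rewrite -(fi _ _ iquot) -(f'i _ _ isub).
Qed.

Lemma Hall_mul_iso (f f' : rep -> C) M M' :
  (forall M N, rep_iso M N -> f M = f N) -> (forall M N, rep_iso M N -> f' M = f' N) ->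
  rep_iso M M' -> Hall_mul f f' M = Hall_mul f f' M'.
Proof.
move=> fi f'i iso; have := rep_iso_homs iso; have := rep_iso_dimv iso.
(* Both representations are moved to one dimension vector, so that their fibres lie in the same real
   affine space. *)
case: M M' {iso} => a x [a' x'] /= e; move: x'; rewrite -e => {e a'} x'.
move=> [g [g' [hg hg' gg' g'g]]].
suff H b z : euler_char [set real_coord W | W in @mul_fibre R Q f f' (Rep x) b z] =
    euler_char [set real_coord W | W in @mul_fibre R Q f f' (Rep x') b z].
  apply: eq_bigr => b _; apply: eq_fsbigr => z _.
  exact: (congr1 (fun e : int => z * e%:~R) (H _ z)).
apply/esym; apply: (@euler_char_transfer R _ (@projector_coords a) _ _ (proj_map g) (proj_map g')).
- exact: semialgebraic_projector_coords.
- exact: (proj_map_regular gg').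
- exact: (proj_map_regular g'g).
- move=> v H i; rewrite /proj_map real_coordK.
  by apply: (proj_image_projector (gg' i)); exact: H.
- move=> v H i; rewrite /proj_map real_coordK.
  by apply: (proj_image_projector (g'g i)); exact: H.
- move=> v H; rewrite /proj_map real_coordK -[RHS]real_uncoordK; congr real_coord.
  apply: functional_extensionality_dep => i.
  by apply: proj_imageK => //; exact: H.
- move=> v H; rewrite /proj_map real_coordK -[RHS]real_uncoordK; congr real_coord.
  apply: functional_extensionality_dep => i.
  by apply: proj_imageK => //; exact: H.
- by move=> v [W [pW _ _ _] <-]; rewrite /projector_coords /= real_coordK.
- apply/seteqP; split=> v /=.
    move=> [W FW <-]; have [pW _ _ _] := FW; rewrite /projector_coords /= real_coordK; split=> //.
    exists (fun i => proj_image (g' i) (W i)); last by rewrite /proj_map real_coordK.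
    exact: (fibre_transfer fi f'i hg' hg g'g gg').
  move=> [H [W FW WE]].
  exists (fun i => proj_image (g i) (W i)); first exact: (fibre_transfer fi f'i hg hg' gg' g'g).
  rewrite -[RHS]real_uncoordK; congr real_coord; apply: functional_extensionality_dep => i.
  rewrite -[in LHS](real_coordK W) WE /proj_map real_coordK.
  by apply: proj_imageK => //; exact: H.
Qed.

End SubQuotient.

(** * The span of the functions 1_P *)

Section PreprojectiveSpan.
Variables (R : realType) (Q : quiver).
Hypothesis acyclic : no_oriented_cycle Q.
Local Notation C := R[i].
Local Notation rep := (rep R Q).
Implicit Types (M N P X : rep) (f g : rep -> C).

Lemma char_orbit1 P M : rep_iso P M -> char_orbit P M = 1.
Proof. by move=> iso; rewrite /char_orbit asboolT. Qed.

Lemma char_orbit0 P M : ~ rep_iso P M -> char_orbit P M = 0.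
Proof. by move=> niso; rewrite /char_orbit asboolF. Qed.

Lemma char_orbit_iso P M N : rep_iso M N -> char_orbit P M = char_orbit P N.
Proof.
move=> iso; have [PM|nPM] := pselect (rep_iso P M).
  by rewrite !char_orbit1 //; apply: rep_iso_trans iso.
rewrite !char_orbit0 // => PN; apply: nPM.
exact: rep_iso_trans PN (rep_iso_sym iso).
Qed.

Lemma eq_char_orbit P P' : char_orbit P = char_orbit P' <-> rep_iso P P'.
Proof.
split=> [e|iso].
  apply: contrapT => /char_orbit0; rewrite e char_orbit1; last exact: rep_iso_refl.
  by move/eqP; rewrite oner_eq0.
apply/funext => M; have [PM|nPM] := pselect (rep_iso P M).
  by rewrite !char_orbit1 //; apply: rep_iso_trans PM; apply: rep_iso_sym.
by rewrite !char_orbit0 // => P'M; apply: nPM; apply: rep_iso_trans P'M.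
Qed.

Lemma Hall0 : Hall (fun _ : rep => 0 : C).
Proof.
split=> //.
- suff -> : [set a : vertex Q -> nat | exists x : rep_space R a, (0 : C) <> 0] = set0.
    exact: finite_set0.
  by apply/seteqP; split=> a //= [].
- move=> a; apply: (@sub_finite_set _ _ [set 0]); last exact: finite_set1.
  by move=> _ [x _ <-].
- move=> a z; apply: boolean_generated_cst; exact: constructibleT.
Qed.

(** Each fibre is cut along the orbit of [P]: on the orbit the values are shifted by [c], off it
    they are unchanged. *)
Lemma Hall_add_orbit f (c : C) P : Hall f ->
  Hall (fun M => f M + c * char_orbit P M).
Proof.
move=> [fin iso rng cons]; split.
- apply: (@sub_finite_set _ _ ([set a | exists x : rep_space R a, f (Rep x) <> 0] `|`
      [set dimv P])); last by rewrite finite_setU; split=> //; exact: finite_set1.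
  move=> a [x] /=; have [PM _|nPM] := pselect (rep_iso P (Rep x)).
    by right; rewrite (rep_iso_dimv PM).
  by rewrite char_orbit0 // mulr0 addr0 => fx; left; exists x.
- by move=> M N MN; rewrite (iso _ _ MN) (char_orbit_iso P MN).
- move=> a; pose A := range (fun x : rep_space R a => f (Rep x)).
  apply: (@sub_finite_set _ _ (A `|` [set z + c | z in A])).
    move=> _ [x _ <-]; have [PM|nPM] := pselect (rep_iso P (Rep x)).
      by right; rewrite char_orbit1 // mulr1; exists (f (Rep x)) => //; exists x.
    by left; rewrite char_orbit0 // mulr0 addr0; exists x.
  by rewrite finite_setU; split; [exact: rng | apply: finite_image; exact: rng].
- move=> a z; pose O := [set x : rep_space R a | rep_iso (Rep x) P].
  have -> : [set x : rep_space R a | f (Rep x) + c * char_orbit P (Rep x) = z] =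
      (O `&` [set x | f (Rep x) = z - c]) `|` (~` O `&` [set x | f (Rep x) = z]).
    apply/seteqP; split=> x /=.
      have [Ox|nOx] := pselect (O x).
        by rewrite char_orbit1 ?mulr1 => [<-|]; [left; rewrite addrK|exact: rep_iso_sym].
      rewrite char_orbit0 ?mulr0 ?addr0 => [<-|/rep_iso_sym //]; by right.
    case=> -[Ox ->].
      by rewrite char_orbit1 ?mulr1 ?subrK //; exact: rep_iso_sym.
    by rewrite char_orbit0 ?mulr0 ?addr0 // => /rep_iso_sym.
  have cO := orbit_constructible P a.
  by apply: boolean_generatedU; apply: BG_setI => //; [exact: cons | exact: BG_setC | exact: cons].
Qed.

Variable K : set C.
Hypothesis KZ : forall m : int, K m%:~R.
Hypothesis KD : forall x y, K x -> K y -> K (x + y).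
Hypothesis KM : forall x y, K x -> K y -> K (x * y).

(** Combinations are built one term at a time, repetitions allowed, so that closure properties
    follow by induction; [prep_span_lin] recovers finite sums. *)
Inductive prep_span : set (rep -> C) :=
| prep_span0 : prep_span (fun=> 0)
| prep_spanD f c P : prep_span f -> K c -> preprojective P ->
    prep_span (fun M => f M + c * char_orbit P M).

Lemma prep_span_Hall f : prep_span f -> Hall f.
Proof. by elim=> [|g c P _ Hg _ _]; [exact: Hall0 | exact: Hall_add_orbit]. Qed.

Lemma prep_span_add f g : prep_span f -> prep_span g -> prep_span (fun M => f M + g M).
Proof.
move=> sf; elim=> [|g' c P _ sg Kc pP].
  by rewrite (_ : (fun M => _) = f) //; apply/funext => M; rewrite addr0.
rewrite (_ : (fun M => _) = fun M => f M + g' M + c * char_orbit P M).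
  exact: prep_spanD.
by apply/funext => M; rewrite addrA.
Qed.

Lemma prep_span_scale c f : K c -> prep_span f -> prep_span (fun M => c * f M).
Proof.
move=> Kc; elim=> [|g' d P _ sg Kd pP].
  by rewrite (_ : (fun M => _) = fun=> 0); [exact: prep_span0 | apply/funext => M; rewrite mulr0].
rewrite (_ : (fun M => _) = fun M => c * g' M + (c * d) * char_orbit P M).
  by apply: prep_spanD => //; exact: KM.
by apply/funext => M; rewrite mulrDr mulrA.
Qed.

Lemma prep_span_values f M : prep_span f -> K (f M).
Proof.
elim=> [|g c P _ Kg Kc _]; first exact: (KZ 0).
apply: (KD Kg); apply: (KM Kc).
have [PM|nPM] := pselect (rep_iso P M); first by rewrite char_orbit1 //; exact: (KZ 1).
by rewrite char_orbit0 //; exact: (KZ 0).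
Qed.

Lemma prep_span_support f : prep_span f -> exists D, forall M, f M <> 0 ->
  preprojective M /\ (total_dim M <= D)%N.
Proof.
elim=> [|g c P _ [D IH] Kc pP]; first by exists 0%N.
exists (maxn D (total_dim P)) => M.
have [PM _|nPM] := pselect (rep_iso P M).
  split; first exact: preprojective_iso PM pP.
  by rewrite -(total_dim_iso PM) leq_maxr.
rewrite char_orbit0 // mulr0 addr0 => /IH[pM le]; split=> //.
by rewrite leq_max le.
Qed.

(** Subtracting [f X * char_orbit X] removes the class of [X] from the support and leaves the other
    values unchanged; the coefficient is a value of [f], hence in [K]. *)
Lemma prep_span_of_support (Xs : seq rep) f :
  (forall M N, rep_iso M N -> f M = f N) -> (forall M, K (f M)) ->
  (forall M, f M <> 0 -> preprojective M /\ exists2 X, List.In X Xs & rep_iso M X) ->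
  prep_span f.
Proof.
elim: Xs f => [|X Xs IH] f iso Kf supp.
  rewrite (_ : f = fun=> 0); first exact: prep_span0.
  by apply/funext => M; apply: contrapT => /supp[_ []].
pose g M := f M - f X * char_orbit X M.
have gX M : rep_iso M X -> g M = 0.
  move=> MX; rewrite /g char_orbit1; last exact: rep_iso_sym.
  by rewrite mulr1 (iso _ _ MX) subrr.
have gN M : ~ rep_iso M X -> g M = f M.
  by move=> nMX; rewrite /g char_orbit0 ?mulr0 ?subr0 // => /rep_iso_sym.
have sg : prep_span g.
  apply: IH => [M N MN|M|M gM].
  - by rewrite /g (iso _ _ MN) (char_orbit_iso X MN).
  - have [MX|nMX] := pselect (rep_iso M X); first by rewrite gX //; exact: (KZ 0).
    by rewrite gN.
  - have [MX|nMX] := pselect (rep_iso M X); first by case: gM; apply: gX.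
    have [|pM [Y [<-|YXs] MY]] := supp M; first by rewrite -gN.
      by case: nMX.
    by split=> //; exists Y.
have [fX0|fX] := pselect (f X = 0).
  by rewrite (_ : f = g) //; apply/funext => M; rewrite /g fX0 mul0r subr0.
have [pX _] := supp X fX.
rewrite (_ : f = fun M => g M + f X * char_orbit X M); first exact: prep_spanD.
by apply/funext => M; rewrite /g subrK.
Qed.

Lemma mul_fibre_nonempty f g M b z :
  euler_char [set real_coord W | W in @mul_fibre R Q f g M b z] != 0 ->
  exists W, @mul_fibre R Q f g M b z W.
Proof.
move=> chi0; apply: contrapT => /forallNP nW; case/eqP: chi0.
rewrite (_ : [set _ | _ in _] = set0) ?euler_char0 //.
by apply/seteqP; split=> v //= [W /nW].
Qed.

Lemma prep_span_mul f g : prep_span f -> prep_span g -> prep_span (Hall_mul f g).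
Proof.
move=> sf sg; have [_ isof _ _] := prep_span_Hall sf; have [_ isog _ _] := prep_span_Hall sg.
have [Df suppf] := prep_span_support sf; have [Dg suppg] := prep_span_support sg.
have [Xs XsP] := preprojective_finite R acyclic (Df + Dg).
apply: (@prep_span_of_support Xs) => [M N MN|M|M].
- exact: Hall_mul_iso.
- rewrite /Hall_mul; apply: (big_ind K) => [||b _]; [exact: (KZ 0) | exact: KD |].
  apply: (big_ind K) => [||z _]; [exact: (KZ 0) | exact: KD |].
  set e := euler_char _; have [->|chi0] := eqVneq e 0; first by rewrite mulr0; exact: (KZ 0).
  (* [z] runs over all complex numbers, but a nonzero Euler characteristic makes its fibre nonempty,
     so that [z] is a product of a value of [f] and a value of [g]. *)
  have [W [_ _ _ <-]] := mul_fibre_nonempty chi0.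
  by apply: KM => //; apply: KM; exact: prep_span_values.
move=> fgM.
have [b [z [W [[_ stW rW fW] z0]]]] : exists b z W, @mul_fibre R Q f g M b z W /\ z <> 0.
  apply: contrapT => nW; apply: fgM; rewrite /Hall_mul big1 // => b _.
  apply: fsbig1 => z _; have [->|/eqP z0] := eqVneq z 0; first by rewrite mul0r.
  set e := euler_char _; have [->|/mul_fibre_nonempty[W FW]] := eqVneq e 0; first by rewrite mulr0.
  by case: nW; exists (fun i => b i : nat), z, W.
have fq : f (quot_rep W) <> 0 by move=> e; apply: z0; rewrite -fW e mul0r.
have gs : g (sub_rep W) <> 0 by move=> e; apply: z0; rewrite -fW e mulr0.
have [pq dq] := suppf _ fq; have [ps ds] := suppg _ gs.
have pM : preprojective M.
  exact: (preprojective_ext acyclic (sub_quot_left_exact stW) ps pq).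
split=> //; apply: XsP => //.
suff -> : total_dim M = (total_dim (quot_rep W) + total_dim (sub_rep W))%N by exact: leq_add.
rewrite /total_dim -big_split; apply: eq_bigr => i _ /=.
by rewrite mxrank_coker subnK // rank_leq_row.
Qed.

Lemma prep_span_subalgebra : is_subalgebra K prep_span.
Proof.
split; [exact: prep_span_Hall | exact: prep_span0 | | | exact: prep_span_mul].
  by move=> f g; apply: prep_span_add.
by move=> c f; apply: prep_span_scale.
Qed.

Lemma prep_span_lin f : prep_span f ->
  exists (n : nat) (b : 'I_n -> rep -> C) (c : 'I_n -> C),
    [/\ forall k, prep_functions (b k), forall k, K (c k)
      & f = fun M => \sum_(k < n) c k * b k M].
Proof.
elim=> [|g d P _ [n [b [c [Bb Kc ->]]]] Kd pP].
  exists 0%N, (fun=> fun=> 0), (fun=> 0); split=> [[]//|[]//|].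
  by apply/funext => M; rewrite big_ord0.
exists n.+1, (fun k => if unlift ord0 k is Some j then b j else char_orbit P).
exists (fun k => if unlift ord0 k is Some j then c j else d); split=> [k|k|].
- by case: (unlift ord0 k) => [j|]; [exact: Bb | exists P].
- by case: (unlift ord0 k).
- apply/funext => M; rewrite big_ord_recl unlift_none addrC; congr (_ + _).
  by apply: eq_bigr => k _; rewrite liftK.
Qed.

Lemma prep_functions_basis :
  is_basis K (generated_subalgebra K (@prep_functions R Q)) (@prep_functions R Q).
Proof.
split.
- by move=> f Bf A _; apply.
- move=> f /(_ prep_span) Af; apply: prep_span_lin; apply: Af.
    exact: prep_span_subalgebra.
  move=> _ [P pP <-]; rewrite (_ : char_orbit P = fun M => 0 + 1 * char_orbit P M).
    by apply: prep_spanD => //; [exact: prep_span0 | exact: (KZ 1)].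
  by apply/funext => M; rewrite mul1r add0r.
- move=> n b c inj Bb Kc sum0 k.
  have [P pP bP] : exists2 P, preprojective P & char_orbit P = b k by exact: Bb.
  (* Evaluation at [P] isolates the coefficient of its orbit, the other orbits being disjoint from
     it. *)
  have := sum0 P; rewrite (bigD1 k) //= big1 ?addr0 => [|l lk].
    by rewrite -bP char_orbit1 ?mulr1 //; exact: rep_iso_refl.
  have [P' pP' bP'] : exists2 P', preprojective P' & char_orbit P' = b l by exact: Bb.
  rewrite -bP' char_orbit0 ?mulr0 // => iso.
  by case/eqP: lk; apply: inj; rewrite -bP -bP'; apply/eq_char_orbit.
Qed.

End PreprojectiveSpan.

Theorem proposition5p6 (R : realType) (Q : quiver)
    (Qconn : connected_quiver Q) (Qacyclic : no_oriented_cycle Q) :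
  [/\ (forall P P' : rep R Q, preprojective P -> preprojective P' ->
         char_orbit P = char_orbit P' <-> rep_iso P P'),
      is_basis (int_scalars (R := R)) (C_prep_Z (R := R) (Q := Q))
               (prep_functions (R := R) (Q := Q))
    & is_basis setT (C_prep (R := R) (Q := Q))
               (prep_functions (R := R) (Q := Q))].
Proof.
split; first by move=> P P' _ _; exact: eq_char_orbit.
- apply: prep_functions_basis => //.
  + by move=> m; exists m.
  + by move=> _ _ [m _ <-] [n _ <-]; exists (m + n) => //; rewrite intrD.
  + by move=> _ _ [m _ <-] [n _ <-]; exists (m * n) => //; rewrite intrM.
- exact: prep_functions_basis.
Qed.
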